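(* (i) There exist a holomorphic endomorphism $f$ of $\mathbb{P}^2$ of degree at least $2$ and a proper attracting set of $f$ containing infinitely many repelling periodic cycles. (ii) There exist a holomorphic endomorphism $f$ of $\mathbb{P}^2$ of degree at least $2$ and a quasi-attractor of $f$ which is not an attracting set.
   Context: An attracting set of $f$ is a compact set $A=\bigcap_{n\ge0}f^n(U)$ where $U\subset\mathbb{P}^2$ is open with $\overline{f(U)}\subset U$; it is proper if $A\neq\mathbb{P}^2$. A quasi-attractor of $f$ is an intersection $\bigcap_{n\ge1}A_n$ of an infinite decreasing sequence $A_1\supset A_2\supset\cdots$ of attracting sets of $f$. *)

(* Defs.v *)
From HB Require Import structures.
From mathcomp Require Import all_boot all_order all_algebra.
From mathcomp Require Import complex.
From mathcomp Require Import all_classical all_reals all_analysis.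
Export Order.TTheory GRing.Theory Num.Theory.
Export numFieldNormedType.Exports.

Set Implicit Arguments.
Unset Strict Implicit.
Unset Printing Implicit Defensive.

Local Open Scope ring_scope.
Local Open Scope classical_set_scope.

(* The complex numbers, viewed as a normed space over themselves (the ^o
   alias provides the mathcomp-analysis topology/normed structure). *)
Definition Cx (R : realType) := ((R[i])^o : numFieldType).

Section P2.
Variable R : realType.
Local Notation C := (Cx R).

Definition hpoly (d : nat) (c : 'I_d.+1 -> 'I_d.+1 -> C) (z : 'rV[C]_3) : C :=
  \sum_(a < d.+1) \sum_(b < d.+1 | (a + b <= d)%N)
     c a b * z 0 0 ^+ a * z 0 1 ^+ b * z 0 2%:R ^+ (d - a - b).

Definition hlift (d : nat) (c : 'I_3 -> 'I_d.+1 -> 'I_d.+1 -> C)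
  (z : 'rV[C]_3) : 'rV[C]_3 := \row_(k < 3) hpoly (c k) z.

(* F defines a holomorphic endomorphism of P^2: F^{-1}(0) = {0} *)
Definition P2nondeg (d : nat) (c : 'I_3 -> 'I_d.+1 -> 'I_d.+1 -> C) :=
  forall z : 'rV[C]_3, z != 0 -> hlift c z != 0.

(** * The projective plane, as normalized representatives:
      first nonzero homogeneous coordinate equal to 1 *)

Definition normalized (z : 'rV[C]_3) : bool :=
  [exists k : 'I_3, (z 0 k == 1) && [forall j : 'I_3, (j < k)%N ==> (z 0 j == 0)]].

Definition P2 := {z : 'rV[C]_3 | normalized z}.

Definition e0 : 'rV[C]_3 := \row_(j < 3) (j == 0 :> 'I_3)%:R.

Lemma e0_normalized : normalized e0.
Proof.
apply/existsP; exists 0; rewrite /e0 mxE eqxx /= eqxx /=.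
by apply/forallP => j; rewrite /= ?ltn0.
Qed.

Definition P2e0 : P2 := exist _ e0 e0_normalized.

Definition firstnz (z : 'rV[C]_3) : option 'I_3 :=
  [pick k : 'I_3 | (z 0 k != 0) && [forall j : 'I_3, (j < k)%N ==> (z 0 j == 0)]].

Definition P2of (z : 'rV[C]_3) : P2 :=
  match firstnz z with
  | Some k => insubd P2e0 ((z 0 k)^-1 *: z)
  | None => P2e0
  end.

Definition endo (d : nat) (c : 'I_3 -> 'I_d.+1 -> 'I_d.+1 -> C) (p : P2) : P2 :=
  P2of (hlift c (val p)).

(** * Topology of P^2 (quotient topology of C^3 \ {0}) *)

Definition P2open (U : set P2) : Prop :=
  open [set z : 'rV[C]_3 | z != 0 /\ U (P2of z)].

Definition P2closure (S : set P2) : set P2 :=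
  [set p | forall U, P2open U -> U p -> exists q, U q /\ S q].

Definition P2compact (A : set P2) : Prop :=
  forall (I : Type) (U : I -> set P2), (forall i, P2open (U i)) ->
    A `<=` \bigcup_i U i ->
    exists J : set I, finite_set J /\ A `<=` \bigcup_(i in J) U i.

Definition attracting_set (f : P2 -> P2) (A : set P2) : Prop :=
  P2compact A /\
  exists U : set P2, P2open U /\ P2closure (f @` U) `<=` U /\
    A = \bigcap_(n in [set: nat]) (iter n f @` U).

Definition proper_attracting_set (f : P2 -> P2) (A : set P2) : Prop :=
  attracting_set f A /\ A <> [set: P2].

Definition quasi_attractor (f : P2 -> P2) (Q : set P2) : Prop :=
  exists An : nat -> set P2,
    (forall n, attracting_set f (An n)) /\
    (forall n, An n.+1 `<=` An n) /\
    Q = \bigcap_(n in [set: nat]) An n.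

Definition chart (k : 'I_3) (z : 'rV[C]_3) : 'rV[C]_2 :=
  \row_(j < 2) (z 0 (lift k j) / z 0 k).

Definition unchart (k : 'I_3) (u : 'rV[C]_2) : 'rV[C]_3 :=
  \row_(j < 3) match unlift k j with Some j' => u 0 j' | None => 1 end.

Definition in_chart (k : 'I_3) (g : P2 -> P2) (u : 'rV[C]_2) : 'rV[C]_2 :=
  chart k (val (g (P2of (unchart k u)))).

Definition repelling_fixed (g : P2 -> P2) (p : P2) : Prop :=
  g p = p /\
  exists k : 'I_3, val p 0 k != 0 /\
    differentiable (in_chart k g) (chart k (val p)) /\
    forall a : C, eigenvalue ('J (in_chart k g) (chart k (val p))) a -> 1 < `|a|.

Definition repelling_periodic (f : P2 -> P2) (p : P2) : Prop :=
  exists n : nat, (0 < n)%N /\ repelling_fixed (iter n f) p.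

Definition cycle_of (f : P2 -> P2) (p : P2) : set P2 :=
  [set iter k f p | k in [set: nat]].

Definition repelling_cycles_in (f : P2 -> P2) (A : set P2) : set (set P2) :=
  [set Cy | exists p, repelling_periodic f p /\ Cy = cycle_of f p /\ Cy `<=` A].

End P2.

(* Main.v *)
Require Import Defs.
From HB Require Import structures.
From mathcomp Require Import all_boot all_order all_algebra.
From mathcomp Require Import complex finmap.
From mathcomp Require Import all_classical all_reals all_analysis.
From mathcomp Require Import ring lra zify.
Import Order.TTheory GRing.Theory Num.Theory numFieldNormedType.Exports.
Local Open Scope ring_scope.
Local Open Scope classical_set_scope.
Set Implicit Arguments.
Unset Strict Implicit.
Unset Printing Implicit Defensive.

(** The affine map [f_b (z, w) = (B_t z / kappa + b w + eps w^4, z + eps z^4)] extends to an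
    endomorphism of degree 4 of the projective plane, for which [{|w| < max (4 |u|, |z|)}] is a trap
    in the coordinates [[z : w : u]].  An orbit is the same thing as a solution of the three-term
    recurrence [B_t (Y_i) = kappa (Y_(i-1) - psi (Y_(i+1)))]; as [kappa] is tiny, the solutions with a
    prescribed itinerary are fixed points of a contraction.  The origin is a saddle with multipliers
    [1 / zeta] and [- b zeta], and [t = tau b] is chosen so that the fold of [B_t] at [z = 2] creates
    a homoclinic tangency.  A cycle that leaves the fold, spends [m] and [n] steps near the saddle
    and returns with eigenvalue 2 closes up where [b (b zeta)^n - zeta^m], up to small errors, changes
    sign, hence for a dense set of [b].  Since the Jacobian determinant of [f_b] is about [- b] there,
    with [b >= 2], that cycle is repelling, and it persists for nearby [b]; nested intervals give a
    parameter with infinitely many repelling cycles, all in the trap.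

    On the trap [f_b] is injective over the region of these cycles, so that a small ball around a
    repelling cycle can only be reached from a smaller one: deleting these balls from a trap leaves
    a trap.  Deleting the cycles one after the other gives a decreasing sequence of attracting sets.
    If its intersection had a trap, compactness would put one of the deleted cycles inside it. *)

(** * Weighted contractions *)

(** The tangency is what makes the sign of the closing defect readable. The decay rate
    [theta = 50 kk] that the contraction provides is much cruder than the true rate [zeta = kk / 2],
    so a first-order error [theta^N] would drown the main terms [(b zeta)^n] and [zeta^m]. At a
    tangency a displacement of the fold point acts only quadratically, and [theta^2 = zeta / 200]:
    the error is negligible as soon as [N >= 5]. Keeping [t] on the curve [t = tau b] preserves the
    tangency and leaves [b] as the one parameter that closes the cycles.

    The eigenvalue 2 is prescribed, not computed. The multiplier of a cycle depends on its position
    in the fold; with the tangent vector among the unknowns, the choice of the multiplier becomes an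
    equation for that position. The other eigenvalue follows from the determinant alone. Cycles are
    found over the reals, where intermediate values are available; only their expansion is proved
    over the complex numbers. The terms [eps w^4] and [eps z^4] make the map holomorphic at
    infinity, and [eps] is too small to disturb the estimates. *)

Section Contraction.
Variable R : realType.

Lemma le0_of_half_pow (x C : R) : (forall n, x <= C * 2^-1 ^+ n) -> x <= 0.
Proof.
move=> h; case: (leP x 0) => // x0.
have C0 : 0 < C by have := h 0%N; rewrite expr0 mulr1; apply: lt_le_trans.
pose n := Num.bound (C / x).
have Hn : C / x < n%:R by apply: archi_boundP; rewrite divr_ge0 // ltW.
have := h n; rewrite exprVn -ler_pdivrMl // => h1.
have h2 : (n%:R : R) <= 2 ^+ n.
  by rewrite -natrX ler_nat ltnW // ltn_expl.
have h3 : 2 ^+ n <= C / x.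
  by rewrite ler_pdivlMr // mulrC -ler_pdivlMr ?exprn_gt0 // mulrC mulrC -ler_pdivrMl.
lra.
Qed.

Lemma le_of_half_pow (x y C : R) : (forall n, x <= y + C * 2^-1 ^+ n) -> x <= y.
Proof.
move=> h; rewrite -subr_le0; apply: (@le0_of_half_pow _ C) => n.
by rewrite lerBlDl.
Qed.

Variables (J : Type) (c r : J -> R) (T : (J -> R) -> J -> R).

Definition box (u : J -> R) := forall j, `|u j - c j| <= r j.

(** The factor 1/2 is stated through bounds [D * rho j] and not through a weighted sup norm, which
    could be infinite when [J] is infinite. *)
Definition halves (rho : J -> R) := forall (D : R) (u u' : J -> R), 0 <= D ->
  box u -> box u' -> (forall j, `|u j - u' j| <= D * rho j) ->
  forall j, `|T u j - T u' j| <= D / 2 * rho j.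

(** The iteration starts at the centre, so its first step is at most [r] and its [n]-th at most
    [2^-n * r] in every coordinate; completeness of [R], coordinate by coordinate, is enough. *)
Lemma banach_box : (forall j, 0 <= r j) -> (forall u, box u -> box (T u)) ->
  halves r -> exists2 u, box u & forall j, T u j = u j.
Proof.
move=> r0 Tbox TL.
pose u n := iter n T c.
have bc : box c by move=> j; rewrite subrr normr0.
have bu n : box (u n) by elim: n => //= n IH; apply: Tbox.
pose h : R := 2^-1.
have h0 n : 0 <= h ^+ n by rewrite exprn_ge0 // /h; lra.
have step n j : `|u n.+1 j - u n j| <= h ^+ n * r j.
  elim: n j => [|n IH] j; first by rewrite expr0 mul1r; apply: Tbox.
  by have := TL _ _ _ (h0 n) (bu n.+1) (bu n) IH j; rewrite exprSr.
(* Lowering the iterates by the movement that may remain makes each coordinate nondecreasing in [n],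
   so that its limit is a supremum. *)
pose a j n := u n j - 2 * h ^+ n * r j.
have a_nd j n k : a j n <= a j (n + k)%N.
  elim: k => [|k IH]; first by rewrite addn0.
  apply: le_trans IH _; rewrite addnS /a.
  have := step (n + k)%N j; rewrite ler_norml => /andP[s1 _].
  have e : h ^+ (n + k).+1 = h ^+ (n + k) / 2 by rewrite exprSr.
  rewrite e; lra.
have a_ub j n k : u (n + k)%N j <= u n j + 2 * h ^+ n * r j - 2 * h ^+ (n + k) * r j.
  elim: k => [|k IH]; first by rewrite addn0; lra.
  have := step (n + k)%N j; rewrite addnS ler_norml => /andP[_ s1].
  have e : h ^+ (n + k).+1 = h ^+ (n + k) / 2 by rewrite exprSr.
  rewrite e; lra.
have hr n j : 0 <= h ^+ n * r j by rewrite mulr_ge0.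
pose l j := sup (range (a j)).
have ubd j n : ubound (range (a j)) (u n j + 2 * h ^+ n * r j).
  move=> _ [m _ <-]; apply: le_trans (a_nd j m n) _; rewrite addnC /a.
  have := a_ub j n m; have := hr (n + m)%N j; lra.
have lu j n : `|l j - u n j| <= 2 * h ^+ n * r j.
  have ne : range (a j) !=set0 by exists (a j 0%N), 0%N.
  have l1 : l j <= u n j + 2 * h ^+ n * r j by apply: ge_sup.
  have l2 : a j n <= l j.
    apply: ub_le_sup; last by exists n.
    by exists (u n j + 2 * h ^+ n * r j).
  rewrite ler_norml; move: l2; rewrite /a; lra.
have bl : box l.
  move=> j; apply: (@le_of_half_pow _ _ (2 * r j)) => n.
  have := lu j n; have := bu n j; rewrite !ler_norml -/h => /andP[? ?] /andP[? ?].
  apply/andP; split; nra.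
exists l => // j; apply/eqP; rewrite -subr_eq0 -normr_le0.
apply: (@le0_of_half_pow _ (2 * r j)) => n.
have h2 : 0 <= 2 * h ^+ n by have := h0 n; lra.
have s1 := TL (2 * h ^+ n) l (u n) h2 bl (bu n) (fun j => lu j n) j.
have s2 := lu j n.+1; move: s1 s2; rewrite -[T (u n) j]/(u n.+1 j) exprSr /h.
move: (2^-1 ^+ n) => w; rewrite !ler_norml => /andP[? ?] /andP[? ?].
apply/andP; split; lra.
Qed.

(* The weights [rho] need not be the radii of the box: this is how decay estimates are obtained. *)
Lemma box_stable (rho : J -> R) (e D0 : R) (u u' : J -> R) :
  halves rho -> 0 <= e -> 0 <= D0 -> box u -> box u' -> (forall j, 0 <= rho j) ->
  (forall j, T u j = u j) -> (forall j, `|u j - u' j| <= D0 * rho j) ->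
  (forall j, `|T u' j - u' j| <= e * rho j) ->
  forall j, `|u j - u' j| <= 2 * e * rho j.
Proof.
move=> TL e0 D00 bu bu' rho0 fu d0 du' j.
(* One use of the contraction halves the bound [2 * e + D0 / 2^n], and the residual adds [e] back:
   the form of the bound is reproduced. *)
have main n : forall j, `|u j - u' j| <= (2 * e + D0 * 2^-1 ^+ n) * rho j.
  elim: n => [|n IH] i.
    rewrite expr0 mulr1; apply: le_trans (d0 i) _.
    by rewrite ler_wpM2r //; lra.
  have p0 : 0 <= 2 * e + D0 * 2^-1 ^+ n.
    by rewrite addr_ge0 ?mulr_ge0 // exprn_ge0 //; lra.
  have := TL _ _ _ p0 bu bu' IH i; rewrite fu.
  have := du' i; rewrite exprSr; move: (2^-1 ^+ n) => w.
  rewrite !ler_norml => /andP[? ?] /andP[? ?]; apply/andP; split; lra.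
apply: (@le_of_half_pow _ _ (D0 * rho j)) => n.
by have := main n j; rewrite mulrDl -!mulrA [rho j * _]mulrC.
Qed.

End Contraction.

(** * The polynomials of the family and their local behaviour *)

Section FamilyPolynomials.
Variable K : fieldType.
Implicit Types t y b e w : K.

(** It vanishes at 0 and 1 for every [t], and has a double zero at 2 for [t = 0]: these are the
    saddle, the other site visited by the cycles, and the fold. *)
Definition Bp t y := y * (1 - y) * ((y - 2) ^+ 2 + t * y) / 4.
Definition dBp t y :=
  (4 - 16 * y + 15 * y ^+ 2 - 4 * y ^+ 3 + 2 * t * y - 3 * t * y ^+ 2) / 4.
Definition Xp b e w := b * w + e * w ^+ 4.
Definition dXp b e w := b + 4 * e * w ^+ 3.
Definition Qp e y := y + e * y ^+ 4.
Definition dQp e y := 1 + 4 * e * y ^+ 3.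
(** The [w]-coordinate of a point is [Qp] of the preceding [z], so [psi] is the contribution to the
    next [z] of the one before the present one. *)
Definition psi b e y := Xp b e (Qp e y).
Definition dpsi b e y := dXp b e (Qp e y) * dQp e y.

End FamilyPolynomials.

Section Morphisms.
Variables (K K' : fieldType) (f : {rmorphism K -> K'}).

Lemma Bp_morph t y : f (Bp t y) = Bp (f t) (f y).
Proof.
rewrite /Bp rmorphM fmorphV rmorph_nat (rmorphM f (y * _)) (rmorphM f y) (rmorphB f 1) rmorph1.
by rewrite rmorphD (rmorphM f t) rmorphXn rmorphB rmorph_nat.
Qed.

Lemma dBp_morph t y : f (dBp t y) = dBp (f t) (f y).
Proof.
rewrite /dBp rmorphM fmorphV rmorph_nat; congr (_ * _).
rewrite rmorphB rmorphD rmorphB rmorphD rmorphB !(rmorphM f _%:R) (rmorphM f (2 * t)) (rmorphM f (3 * t)).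
by rewrite !(rmorphM f _%:R) !(rmorphXn f _ y) !rmorph_nat.
Qed.

Lemma Xp_morph b e w : f (Xp b e w) = Xp (f b) (f e) (f w).
Proof. by rewrite /Xp rmorphD (rmorphM f b) (rmorphM f e) rmorphXn. Qed.

Lemma dXp_morph b e w : f (dXp b e w) = dXp (f b) (f e) (f w).
Proof. by rewrite /dXp rmorphD (rmorphM f (4 * e)) (rmorphM f 4) rmorphXn rmorph_nat. Qed.

Lemma Qp_morph e y : f (Qp e y) = Qp (f e) (f y).
Proof. by rewrite /Qp rmorphD (rmorphM f e) rmorphXn. Qed.

Lemma dQp_morph e y : f (dQp e y) = dQp (f e) (f y).
Proof. by rewrite /dQp rmorphD (rmorphM f (4 * e)) (rmorphM f 4) rmorphXn rmorph_nat rmorph1. Qed.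

End Morphisms.

Section RealEstimates.
Variable R : realType.
Implicit Types t y x b e v : R.

Lemma norm_mul_le (x y c d : R) : `|x| <= c -> `|y| <= d -> `|x * y| <= c * d.
Proof. by move=> h1 h2; rewrite normrM ler_pM. Qed.

Lemma sq_norm_le x c : `|x| <= c -> x ^+ 2 <= c ^+ 2.
Proof. by move=> h; rewrite -real_normK ?num_real // lerXn2r // nnegrE // (le_trans _ h). Qed.

Lemma dBp_lipschitz t x y : `|t| <= 1 -> `|x| <= 3 -> `|y| <= 3 ->
  `|dBp t x - dBp t y| <= 60 * `|x - y|.
Proof.
move=> ht hx hy.
have -> : dBp t x - dBp t y = (x - y) * ((- 16 + 15 * (x + y)
   - 4 * (x ^+ 2 + x * y + y ^+ 2) + 2 * t - 3 * (t * x) - 3 * (t * y)) / 4).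
  by rewrite /dBp; field.
rewrite mulrC normrM ler_wpM2r //.
have := norm_mul_le hx hx; have := norm_mul_le hy hy; have := norm_mul_le hx hy.
have := norm_mul_le ht hx; have := norm_mul_le ht hy.
move: ht hx hy; rewrite !ler_norml -!expr2; lra.
Qed.

Lemma Bp_taylor t x y : `|t| <= 1 -> `|x| <= 3 -> `|y| <= 3 ->
  `|Bp t x - Bp t y - dBp t y * (x - y)| <= 60 * (x - y) ^+ 2.
Proof.
move=> ht hx hy.
have -> : Bp t x - Bp t y - dBp t y * (x - y) = (x - y) ^+ 2 * ((- 8 + 5 * (x + 2 * y)
   - (x ^+ 2 + 2 * (x * y) + 3 * y ^+ 2) + t - t * x - 2 * (t * y)) / 4).
  by rewrite /dBp /Bp; field.
rewrite mulrC normrM [ `|_ ^+ 2|]ger0_norm ?sqr_ge0 // ler_wpM2r ?sqr_ge0 //.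
have := norm_mul_le hx hx; have := norm_mul_le hy hy; have := norm_mul_le hx hy.
have := norm_mul_le ht hx; have := norm_mul_le ht hy.
move: ht hx hy; rewrite !ler_norml -!expr2; lra.
Qed.

Definition sitev (s : bool) : R := s%:R.
(** Inverses of the slopes of [Bp 0] at the sites 1 and 0, for Newton steps with a frozen
    derivative. *)
Definition islope (s : bool) : R := if s then - 4 else 1.

Lemma islope_norm s : `|islope s| <= 4.
Proof. by case: s; rewrite /= ler_norml; lra. Qed.

Lemma islope_dBp s t y : `|t| <= 10^-1 ^+ 3 -> `|y - sitev s| <= 100^-1 ^+ 2 ->
  `|1 - islope s * dBp t y| <= 30^-1.
Proof.
move=> ht hy.
have t1 : `|t| <= 1 by apply: le_trans ht _; lra.
have y3 : `|y| <= 3.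
  move: hy; rewrite !ler_norml /sitev; case: (s) => /=; lra.
have s3 : `|sitev s| <= 3 by rewrite ler_norml /sitev; case: (s) => /=; lra.
have := dBp_lipschitz t1 y3 s3.
have e1 : dBp t (sitev s) = if s then - (1 + t) / 4 else 1.
  by rewrite /dBp /sitev; case: (s) => /=; field.
rewrite e1 => h; have {}h := le_trans h (ler_wpM2l _ hy).
have {h} := h ltac:(lra); move: ht; rewrite !ler_norml /islope.
by case: (s) => /=; move: (dBp t y) => B; lra.
Qed.

(** The coefficient of [t - t'] contains the distance to the site because [Bp t] vanishes there
    whatever [t] is. A change of [t] is thus felt less and less by points close to the saddle. *)
Lemma residual_lipschitz s t t' y y' : `|t| <= 10^-1 ^+ 3 -> `|t'| <= 10^-1 ^+ 3 ->
  `|y - sitev s| <= 100^-1 ^+ 2 -> `|y' - sitev s| <= 100^-1 ^+ 2 ->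
  `|(y - islope s * Bp t y) - (y' - islope s * Bp t' y')| <=
  10^-1 * `|y - y'| + 2 * `|y' - sitev s| * `|t - t'|.
Proof.
move=> ht ht' hy hy'.
have t1 : `|t| <= 1 by apply: le_trans ht _; lra.
have y3 : `|y| <= 3 by move: hy; rewrite !ler_norml /sitev; case: (s) => /=; lra.
have y3' : `|y'| <= 3 by move: hy'; rewrite !ler_norml /sitev; case: (s) => /=; lra.
have -> : (y - islope s * Bp t y) - (y' - islope s * Bp t' y') =
   (1 - islope s * dBp t y') * (y - y')
   - islope s * (Bp t y - Bp t y' - dBp t y' * (y - y'))
   - (islope s * (y' ^+ 2 * (1 - y') / 4)) * (t - t').
  by rewrite /Bp; field.
have h1 := islope_dBp ht hy'.
have h2 := Bp_taylor t1 y3 y3'.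
have h3 : `|y - y'| <= 2 * 100^-1 ^+ 2.
  by move: hy hy'; rewrite !ler_norml; lra.
have h4 : `|islope s * (y' ^+ 2 * (1 - y') / 4)| <= 2 * `|y' - sitev s|.
  case: s hy hy' {h1} => /= hy hy'; rewrite /sitev /=.
    have -> : - 4 * (y' ^+ 2 * (1 - y') / 4) = (y' - 1) * y' ^+ 2 by field.
    rewrite normrM mulrC ler_wpM2r // ger0_norm ?sqr_ge0 //.
    have y'2 : `|y'| <= 4 / 3 by move: hy'; rewrite /sitev !ler_norml /=; lra.
    by have := sq_norm_le y'2; lra.
  have -> : 1 * (y' ^+ 2 * (1 - y') / 4) = y' * (y' * (1 - y') / 4) by field.
  rewrite subr0 normrM mulrC ler_wpM2r //.
  have y'1 : `|1 - y'| <= 2 by move: hy'; rewrite /sitev subr0 !ler_norml; lra.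
  move: hy'; rewrite /sitev subr0 => hy'; have := norm_mul_le hy' y'1.
  by rewrite !ler_norml; lra.
have h5 : 60 * (y - y') ^+ 2 <= 80^-1 * `|y - y'|.
  rewrite -real_normK ?num_real // expr2 mulrA ler_wpM2r //; lra.
have h6 := norm_mul_le h1 (lexx `|y - y'|).
have h7 := norm_mul_le (islope_norm s) (le_trans h2 h5).
have h8 := norm_mul_le h4 (lexx `|t - t'|).
apply: le_trans (ler_normB _ _) _; apply: le_trans (lerD (ler_normB _ _) h8) _.
rewrite lerD2r; have := normr_ge0 (y - y'); lra.
Qed.

Lemma dBp_lipschitz2 t t' y y' : `|t| <= 1 -> `|y| <= 3 -> `|y'| <= 3 ->
  `|dBp t y - dBp t' y'| <= 60 * `|y - y'| + 9 * `|t - t'|.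
Proof.
move=> ht hy hy'.
have -> : dBp t y - dBp t' y' = (dBp t y - dBp t y') + (2 * y' - 3 * y' ^+ 2) / 4 * (t - t').
  by rewrite /dBp; field.
apply: le_trans (ler_normD _ _) _; apply: lerD; first exact: dBp_lipschitz.
rewrite normrM ler_wpM2r //; have := norm_mul_le hy' hy'; move: hy'.
by rewrite -expr2 !ler_norml; have := sqr_ge0 y'; lra.
Qed.

(** The second derivative of [Bp 0] at 2 is -1, so adding [v] cancels the first-order dependence on
    [v]. *)
Lemma fold_slope_lipschitz t t' v v' : `|t| <= 10^-1 ^+ 3 -> `|t'| <= 10^-1 ^+ 3 ->
  `|v| <= 10^-1 ^+ 3 -> `|v'| <= 10^-1 ^+ 3 ->
  `|(v + dBp t (2 + v)) - (v' + dBp t' (2 + v'))| <= 10^-1 * `|v - v'| + 3 * `|t - t'|.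
Proof.
move=> ht ht' hv hv'.
have -> : (v + dBp t (2 + v)) - (v' + dBp t' (2 + v')) =
  (- (9 * (v + v') + 4 * (v * v + v * v' + v' * v') + 10 * t + 3 * (t * v) + 3 * (t * v')) / 4)
     * (v - v')
  + (- (8 + 10 * v' + 3 * (v' * v')) / 4) * (t - t').
  by rewrite /dBp; field.
apply: le_trans (ler_normD _ _) _.
have := norm_mul_le hv hv; have := norm_mul_le hv' hv'; have := norm_mul_le hv hv'.
have := norm_mul_le ht hv; have := norm_mul_le ht hv'.
move: ht hv hv'; rewrite !ler_norml => ? ? ? ? ? ? ? ?.
by apply: lerD; rewrite normrM; (apply: ler_wpM2r; [exact: normr_ge0 | rewrite ler_norml; lra]).
Qed.

(** Since [Bp t 2 = - t], adding [t] cancels the first-order dependence on [t]; that on [v] is small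
    because 2 is critical at [t = 0]. *)
Lemma fold_value_lipschitz t t' v v' : `|t| <= 10^-1 ^+ 3 -> `|t'| <= 10^-1 ^+ 3 ->
  `|v| <= 10^-1 ^+ 3 -> `|v'| <= 10^-1 ^+ 3 ->
  `|(t + Bp t (2 + v)) - (t' + Bp t' (2 + v'))| <= 10^-1 * `|t - t'| + 100^-1 * `|v - v'|.
Proof.
move=> ht ht' hv hv'.
have h1 : `|(t + Bp t (2 + v')) - (t' + Bp t' (2 + v'))| <= 10^-1 * `|t - t'|.
  have -> : (t + Bp t (2 + v')) - (t' + Bp t' (2 + v')) =
     (- (8 * v' + 5 * (v' * v') + v' * (v' * v')) / 4) * (t - t').
    by rewrite /Bp; field.
  rewrite normrM ler_wpM2r //; have h := norm_mul_le hv' hv'; have := norm_mul_le hv' h.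
  by move: hv' h; rewrite !ler_norml; lra.
have h2 : `|Bp t (2 + v) - Bp t (2 + v')| <= 100^-1 * `|v - v'|.
  have -> : Bp t (2 + v) - Bp t (2 + v') = (- (2 * (v + v') + 3 * (v * v + v * v' + v' * v')
    + (v * (v * v) + v * (v * v') + v' * (v * v') + v' * (v' * v')) + 8 * t
    + 5 * (t * v) + 5 * (t * v') + t * (v * v) + t * (v * v') + t * (v' * v')) / 4) * (v - v').
    by rewrite /Bp; field.
  rewrite normrM ler_wpM2r //.
  have h := norm_mul_le hv hv; have h' := norm_mul_le hv' hv'; have h'' := norm_mul_le hv hv'.
  have := norm_mul_le hv h; have := norm_mul_le hv' h'; have := norm_mul_le hv h''.
  have := norm_mul_le hv' h''; have := norm_mul_le ht h; have := norm_mul_le ht h'.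
  have := norm_mul_le ht h''; have := norm_mul_le ht hv; have := norm_mul_le ht hv'.
  by move: ht hv hv' h h' h''; rewrite !ler_norml; lra.
have -> : (t + Bp t (2 + v)) - (t' + Bp t' (2 + v')) =
  ((t + Bp t (2 + v')) - (t' + Bp t' (2 + v'))) + (Bp t (2 + v) - Bp t (2 + v')) by ring.
by apply: le_trans (ler_normD _ _) _; apply: lerD.
Qed.

Local Notation sg := (10^-1 ^+ 3 : R).

Section Quartic.
Variable e : R.
Hypothesis e_ge0 : 0 <= e.
Hypothesis e_small : e <= 10^-1 ^+ 6.

Lemma quartic_slope_bound y : `|y| <= 4 -> `|4 * e * y ^+ 3| <= sg * `|y|.
Proof.
move=> hy; have -> : 4 * e * y ^+ 3 = (4 * (e * (y * y))) * y by ring.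
have he : `|e| <= 10^-1 ^+ 6 by rewrite ger0_norm.
rewrite normrM; apply: ler_wpM2r => //; have := norm_mul_le he (norm_mul_le hy hy).
by rewrite !ler_norml; lra.
Qed.

Lemma quartic_bound y : `|y| <= 4 -> `|e * y ^+ 4| <= sg * `|y|.
Proof.
move=> hy; have -> : e * y ^+ 4 = (e * (y * (y * y))) * y by ring.
have he : `|e| <= 10^-1 ^+ 6 by rewrite ger0_norm.
rewrite normrM; apply: ler_wpM2r => //; have := norm_mul_le he (norm_mul_le hy (norm_mul_le hy hy)).
by rewrite !ler_norml; lra.
Qed.

Lemma quartic_slope_lipschitz x y : `|x| <= 4 -> `|y| <= 4 ->
  `|4 * e * x ^+ 3 - 4 * e * y ^+ 3| <= sg * `|x - y|.
Proof.
move=> hx hy; have -> : 4 * e * x ^+ 3 - 4 * e * y ^+ 3 =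
  (4 * (e * (x * x)) + 4 * (e * (x * y)) + 4 * (e * (y * y))) * (x - y) by ring.
have he : `|e| <= 10^-1 ^+ 6 by rewrite ger0_norm.
rewrite normrM; apply: ler_wpM2r => //; have := norm_mul_le he (norm_mul_le hx hx).
have := norm_mul_le he (norm_mul_le hx hy); have := norm_mul_le he (norm_mul_le hy hy).
by rewrite !ler_norml; lra.
Qed.

Lemma quartic_taylor x y : `|x| <= 4 -> `|y| <= 4 ->
  `|e * x ^+ 4 - e * y ^+ 4 - 4 * e * y ^+ 3 * (x - y)| <= sg * (x - y) ^+ 2.
Proof.
move=> hx hy; have -> : e * x ^+ 4 - e * y ^+ 4 - 4 * e * y ^+ 3 * (x - y) =
  (e * (x * x) + 2 * (e * (x * y)) + 3 * (e * (y * y))) * (x - y) ^+ 2 by ring.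
have he : `|e| <= 10^-1 ^+ 6 by rewrite ger0_norm.
rewrite normrM [ `|_ ^+ 2|]ger0_norm ?sqr_ge0 //; apply: ler_wpM2r; first exact: sqr_ge0.
have := norm_mul_le he (norm_mul_le hx hx).
have := norm_mul_le he (norm_mul_le hx hy); have := norm_mul_le he (norm_mul_le hy hy).
by rewrite !ler_norml; lra.
Qed.

Lemma quartic_lipschitz x y : `|x| <= 4 -> `|y| <= 4 ->
  `|e * x ^+ 4 - e * y ^+ 4| <= sg * `|x - y|.
Proof.
move=> hx hy; have -> : e * x ^+ 4 - e * y ^+ 4 =
  (e * (x * (x * x)) + (e * (x * (x * y))) + (e * (x * (y * y))) + e * (y * (y * y))) * (x - y) by ring.
have he : `|e| <= 10^-1 ^+ 6 by rewrite ger0_norm.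
rewrite normrM; apply: ler_wpM2r => //.
have := norm_mul_le he (norm_mul_le hx (norm_mul_le hx hx)).
have := norm_mul_le he (norm_mul_le hx (norm_mul_le hx hy)).
have := norm_mul_le he (norm_mul_le hx (norm_mul_le hy hy)).
have := norm_mul_le he (norm_mul_le hy (norm_mul_le hy hy)).
by rewrite !ler_norml; lra.
Qed.

Lemma Qp_norm y : `|y| <= 3 -> `|Qp e y| <= 11 / 10 * `|y|.
Proof.
move=> hy; have h4 : `|y| <= 4 by apply: le_trans hy _; lra.
apply: le_trans (ler_normD _ _) _; have := quartic_bound h4; have := normr_ge0 y; lra.
Qed.

Lemma Qp_norm4 y : `|y| <= 3 -> `|Qp e y| <= 4.
Proof. by move=> hy; have := Qp_norm hy; lra. Qed.

Lemma Qp_lipschitz x y : `|x| <= 3 -> `|y| <= 3 -> `|Qp e x - Qp e y| <= 11 / 10 * `|x - y|.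
Proof.
move=> hx hy; have hx4 : `|x| <= 4 by apply: le_trans hx _; lra.
have hy4 : `|y| <= 4 by apply: le_trans hy _; lra.
have -> : Qp e x - Qp e y = (x - y) + (e * x ^+ 4 - e * y ^+ 4) by rewrite /Qp; ring.
apply: le_trans (ler_normD _ _) _; have := quartic_lipschitz hx4 hy4.
have := normr_ge0 (x - y); lra.
Qed.

Lemma dQp_bound y : `|y| <= 3 -> `|dQp e y - 1| <= sg * `|y|.
Proof.
move=> hy; have -> : dQp e y - 1 = 4 * e * y ^+ 3 by rewrite /dQp; ring.
by apply: quartic_slope_bound; apply: le_trans hy _; lra.
Qed.

Lemma dQp_norm y : `|y| <= 3 -> `|dQp e y| <= 11 / 10.
Proof. by move=> hy; have := dQp_bound hy; rewrite !ler_norml; move: hy; lra. Qed.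

Variable b : R.
Hypothesis b_ge2 : 2 <= b.
Hypothesis b_le3 : b <= 3.

Local Ltac blra := move: b_ge2 b_le3; lra.

Lemma dXp_bound y : `|y| <= 4 -> `|dXp b e y - b| <= sg * `|y|.
Proof.
move=> hy; have -> : dXp b e y - b = 4 * e * y ^+ 3 by rewrite /dXp; ring.
exact: quartic_slope_bound.
Qed.

Lemma dXp_norm y : `|y| <= 4 -> `|dXp b e y| <= 31 / 10.
Proof. by move=> hy; have := dXp_bound hy; rewrite !ler_norml; blra. Qed.

Lemma dpsi_bound y : `|y| <= 3 -> `|dpsi b e y - b| <= 10^-1 ^+ 2 * `|y|.
Proof.
move=> hy.
have -> : dpsi b e y - b = b * (dQp e y - 1) + (dXp b e (Qp e y) - b) * dQp e y.
  by rewrite /dpsi; ring.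
have h1 := dXp_bound (Qp_norm4 hy); have h2 := Qp_norm hy.
have h3 : `|dXp b e (Qp e y) - b| <= sg * (11 / 10 * `|y|).
  by apply: le_trans h1 _; apply: ler_wpM2l h2; rewrite exprn_ge0 //; blra.
have b3 : `|b| <= 3 by rewrite ger0_norm; blra.
have := norm_mul_le b3 (dQp_bound hy); have := norm_mul_le h3 (dQp_norm hy).
move: (ler_normD (b * (dQp e y - 1)) ((dXp b e (Qp e y) - b) * dQp e y)).
have := normr_ge0 y; blra.
Qed.

Lemma dpsi_norm y : `|y| <= 3 -> `|dpsi b e y| <= 32 / 10.
Proof. by move=> hy; have := dpsi_bound hy; rewrite !ler_norml; blra. Qed.

Lemma dpsi_lipschitz x y : `|x| <= 3 -> `|y| <= 3 ->
  `|dpsi b e x - dpsi b e y| <= 10^-1 ^+ 2 * `|x - y|.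
Proof.
move=> hx hy; have hx4 : `|x| <= 4 by apply: le_trans hx _; blra.
have hy4 : `|y| <= 4 by apply: le_trans hy _; blra.
have -> : dpsi b e x - dpsi b e y = dXp b e (Qp e x) * (4 * e * x ^+ 3 - 4 * e * y ^+ 3)
  + (4 * e * Qp e x ^+ 3 - 4 * e * Qp e y ^+ 3) * dQp e y.
  by rewrite /dpsi /dXp /dQp; ring.
have h1 := norm_mul_le (dXp_norm (Qp_norm4 hx)) (quartic_slope_lipschitz hx4 hy4).
have h2 := quartic_slope_lipschitz (Qp_norm4 hx) (Qp_norm4 hy).
have h3 : `|4 * e * Qp e x ^+ 3 - 4 * e * Qp e y ^+ 3| <= sg * (11 / 10 * `|x - y|).
  by apply: le_trans h2 _; apply: ler_wpM2l (Qp_lipschitz hx hy); rewrite exprn_ge0 //; blra.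
have h4 := norm_mul_le h3 (dQp_norm hy).
apply: le_trans (ler_normD _ _) _.
have := normr_ge0 (x - y); blra.
Qed.

Lemma psi_taylor x y : `|x| <= 3 -> `|y| <= 3 ->
  `|psi b e x - psi b e y - dpsi b e y * (x - y)| <= 10^-1 ^+ 2 * (x - y) ^+ 2.
Proof.
move=> hx hy; have hx4 : `|x| <= 4 by apply: le_trans hx _; blra.
have hy4 : `|y| <= 4 by apply: le_trans hy _; blra.
have -> : psi b e x - psi b e y - dpsi b e y * (x - y) =
  (e * Qp e x ^+ 4 - e * Qp e y ^+ 4 - 4 * e * Qp e y ^+ 3 * (Qp e x - Qp e y))
  + dXp b e (Qp e y) * (e * x ^+ 4 - e * y ^+ 4 - 4 * e * y ^+ 3 * (x - y)).
  by rewrite /psi /dpsi /Xp /dXp /dQp /Qp; ring.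
have h1 := quartic_taylor (Qp_norm4 hx) (Qp_norm4 hy).
have h2 := norm_mul_le (dXp_norm (Qp_norm4 hy)) (quartic_taylor hx4 hy4).
have h3 := sq_norm_le (Qp_lipschitz hx hy).
rewrite exprMn real_normK ?num_real // in h3.
move: h1 h2 h3; have := ler_normD
  (e * Qp e x ^+ 4 - e * Qp e y ^+ 4 - 4 * e * Qp e y ^+ 3 * (Qp e x - Qp e y))
  (dXp b e (Qp e y) * (e * x ^+ 4 - e * y ^+ 4 - 4 * e * y ^+ 3 * (x - y))).
have := sqr_ge0 (x - y); blra.
Qed.

Lemma psi_lipschitz x y : `|x| <= 3 -> `|y| <= 3 ->
  `|psi b e x - psi b e y - b * (x - y)| <= 10^-1 * `|x - y|.
Proof.
move=> hx hy; have -> : psi b e x - psi b e y - b * (x - y) = 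
   (psi b e x - psi b e y - dpsi b e y * (x - y)) + (dpsi b e y - b) * (x - y) by ring.
have h1 := psi_taylor hx hy; have h2 := dpsi_bound hy.
have h3 : `|x - y| <= 6 by apply: le_trans (ler_normB _ _) _; blra.
have h4 : 10^-1 ^+ 2 * (x - y) ^+ 2 <= 6 * (10^-1 ^+ 2) * `|x - y|.
  rewrite -[(x - y) ^+ 2]real_normK ?num_real //; have := normr_ge0 (x - y); nra.
have h5 : `|dpsi b e y - b| <= 3 * 10^-1 ^+ 2 by blra.
have h6 := norm_mul_le h5 (lexx `|x - y|).
apply: le_trans (ler_normD _ _) _; have := normr_ge0 (x - y); blra.
Qed.

Lemma psi_lipschitz4 x y : `|x| <= 3 -> `|y| <= 3 -> `|psi b e x - psi b e y| <= 32 / 10 * `|x - y|.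
Proof.
move=> hx hy; have h := psi_lipschitz hx hy.
have -> : psi b e x - psi b e y = (psi b e x - psi b e y - b * (x - y)) + b * (x - y) by ring.
have b3 : `|b| <= 3 by rewrite ger0_norm; blra.
have h6 := norm_mul_le b3 (lexx `|x - y|).
apply: le_trans (ler_normD _ _) _; have := normr_ge0 (x - y); blra.
Qed.

Lemma psi0 : psi b e 0 = 0.
Proof. by rewrite /psi /Xp /Qp; ring. Qed.

Lemma psi_norm y : `|y| <= 3 -> `|psi b e y| <= 32 / 10 * `|y|.
Proof.
move=> hy; have := @psi_lipschitz4 y 0 hy; rewrite normr0 psi0 !subr0; apply; blra.
Qed.

End Quartic.

End RealEstimates.

(** * Orbits of the family as solutions of a contracting system *)

(** [UY] are the positions, [UD] the components of a tangent vector carried along the orbit, [Uv]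
    the displacement of the fold point from 2, and [Ut] the parameter [t]. *)
Inductive unknown (I : Type) := UY of I | UD of I | Uv | Ut.
Arguments UY {I}. Arguments UD {I}. Arguments Uv {I}. Arguments Ut {I}.

Section System.
Variables (R : realType) (I : Type).
Variables (pr nx : I -> option I) (wp wn : I -> R) (site : I -> bool) (L0 R0 : I).
Implicit Types (u : unknown I -> R) (o : option I).

(** [pr] leads forward in time and [nx] backward. [None] stands for the fold point, where the
    tangent vector is normalised to 1. *)
Definition nbY u o := if o is Some j then u (UY j) else 2 + u Uv.
Definition nbD u o := if o is Some j then u (UD j) else 1.

Section Operator.
Variables kap b e : R.

Definition resY u i :=
  Bp (u Ut) (u (UY i)) - kap * (nbY u (pr i) - psi b e (nbY u (nx i))).
Definition resD u i := dBp (u Ut) (u (UY i)) * u (UD i)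
  - kap * (wp i * nbD u (pr i) - dpsi b e (nbY u (nx i)) * (wn i * nbD u (nx i))).
(** The tangent equation at the fold itself. Together with [resD] it expresses the tangency of the
    invariant manifolds for the homoclinic orbit, and the existence of the eigenvector for a
    cycle. *)
Definition resH u := dBp (u Ut) (2 + u Uv)
  - kap * (u (UD L0) - dpsi b e (u (UY R0)) * u (UD R0)).
Definition resG u := Bp (u Ut) (2 + u Uv) - kap * (u (UY L0) - psi b e (u (UY R0))).

(* [vf] and [tf] optionally freeze the unknowns [v] and [t]. *)
Definition sysT (vf tf : option R) u (j : unknown I) : R :=
  match j with
  | UY i => u (UY i) - islope R (site i) * resY u i
  | UD i => u (UD i) - islope R (site i) * resD u i
  | Uv => if vf is Some v0 then v0 else u Uv + resH u
  | Ut => if tf is Some t0 then t0 else u Ut + resG u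
  end.

Lemma sysT_fixed vf tf u : (forall j, sysT vf tf u j = u j) ->
  [/\ forall i, resY u i = 0, forall i, resD u i = 0,
      (if vf is Some v0 then u Uv = v0 else resH u = 0) &
      (if tf is Some t0 then u Ut = t0 else resG u = 0)].
Proof.
have sl s : islope R s != 0 by case: s; rewrite /islope ?oner_neq0 // oppr_eq0 pnatr_eq0.
have cancelr (x y : R) s : x - islope R s * y = x -> y = 0.
  move=> h; have {}h : islope R s * y = 0 by lra.
  by apply/eqP; move/eqP: h; rewrite mulf_eq0 (negbTE (sl s)).
move=> h; split.
- by move=> i; apply: cancelr (h (UY i)).
- by move=> i; apply: cancelr (h (UD i)).
- by move: (h Uv); case: vf {h} => //= h; lra.
- by move: (h Ut); case: tf {h} => //= h; lra.
Qed.

End Operator.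

Variable k : R.
Hypothesis k_gt0 : 0 < k.
Hypothesis k_small : k <= 10^-1 ^+ 6.
Local Notation theta := (50 * k).
Variable phi : I -> nat.

Definition cen (j : unknown I) : R := if j is UY i then sitev R (site i) else 0.
(** [phi] counts the steps to the places where a neighbour is not close to 0, and each step gains a
    factor [theta]. [v] and [t] respond through [kap] to positions of order [k], hence the order
    [k^2]. In [sysT_half] their images come out below [8420 * k^2] and [820 * k^2], within half of
    these radii. *)
Definition rad (j : unknown I) : R :=
  match j with
  | UY i | UD i => 100 * k * theta ^+ phi i
  | Uv => 20 * 10 ^+ 3 * k ^+ 2
  | Ut => 2 * 10 ^+ 3 * k ^+ 2
  end.

Definition nb i j := pr i = Some j \/ nx i = Some j.
Hypothesis phi_nb : forall i j, nb i j -> (phi i <= (phi j).+1)%N.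
Hypothesis phi_pos : forall i, (0 < phi i)%N ->
  [/\ pr i <> None, nx i <> None & forall j, nb i j -> ~~ site j].
Hypothesis phi_site : forall i, site i -> phi i = 0%N.
Hypothesis siteL0 : site L0 = false.
Hypothesis siteR0 : site R0 = false.
Hypothesis wp_bd : forall i, `|wp i| <= 2.
Hypothesis wn_bd : forall i, `|wn i| <= 2.

Lemma theta_pow_le1 n : theta ^+ n <= 1.
Proof. by apply: exprn_ile1; move: k_gt0 k_small; lra. Qed.

Lemma rad_ge0 j : 0 <= rad j.
Proof.
case: j => [i|i||] /=; rewrite ?mulr_ge0 ?exprn_ge0 //; move: k_gt0; lra.
Qed.

Lemma rad_le100k i : rad (UY i) <= 100 * k.
Proof. by have := theta_pow_le1 (phi i); move: k_gt0 => /= k0 h; nra. Qed.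

Lemma rad_nb i j : nb i j -> rad (UY j) * theta <= rad (UY i).
Proof.
move=> /phi_nb h /=; rewrite -mulrA -exprSr.
apply: ler_wpM2l; first by move: k_gt0; lra.
by apply: ler_wiXn2l => //; move: k_gt0 k_small; lra.
Qed.

Lemma k2_le : k ^+ 2 <= 10^-1 ^+ 6 * k.
Proof. by rewrite expr2; apply: ler_wpM2r => //; apply: ltW. Qed.

Section InBox.
Variable u : unknown I -> R.
Hypothesis bu : box cen rad u.

Lemma box_Y i : `|u (UY i) - sitev R (site i)| <= 100 * k.
Proof. exact: le_trans (bu (UY i)) (rad_le100k i). Qed.

Lemma box_Y4 i : `|u (UY i) - sitev R (site i)| <= 100^-1 ^+ 2.
Proof. by apply: le_trans (box_Y i) _; move: k_small; lra. Qed.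

Lemma box_D i : `|u (UD i)| <= rad (UY i).
Proof. by have := bu (UD i); rewrite /= subr0. Qed.

Lemma box_D100 i : `|u (UD i)| <= 100 * k.
Proof. exact: le_trans (box_D i) (rad_le100k i). Qed.

Lemma box_v : `|u Uv| <= 10^-1 ^+ 3.
Proof.
have := bu Uv; rewrite /= subr0 => h; apply: le_trans h _.
by have := k2_le; move: k_gt0 k_small; lra.
Qed.

Lemma box_t : `|u Ut| <= 10^-1 ^+ 3.
Proof.
have := bu Ut; rewrite /= subr0 => h; apply: le_trans h _.
by have := k2_le; move: k_gt0 k_small; lra.
Qed.

Lemma box_Y3 i : `|u (UY i)| <= 11 / 10.
Proof.
have := box_Y4 i; rewrite !ler_norml /sitev; case: (site i) => /=; lra.
Qed.

Lemma box_nbY o : `|nbY u o| <= 21 / 10.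
Proof.
case: o => [j|] /=; first by apply: le_trans (box_Y3 j) _; lra.
by have := box_v; rewrite !ler_norml; lra.
Qed.

Lemma box_nbY3 o : `|nbY u o| <= 3.
Proof. by apply: le_trans (box_nbY o) _; lra. Qed.

Lemma box_nbD o : `|nbD u o| <= 1.
Proof.
case: o => [j|] /=; last by rewrite normr1.
by apply: le_trans (box_D100 j) _; move: k_small; lra.
Qed.

End InBox.

Lemma box_nbY_pos u i o : box cen rad u -> (0 < phi i)%N -> o = pr i \/ o = nx i ->
  `|nbY u o| * theta <= rad (UY i).
Proof.
move=> bu /phi_pos [h1 h2 h3]; case: o => [j|]; last by case=> /esym.
move=> h; have hn : nb i j by case: h => h; [left|right].
apply: le_trans (rad_nb hn); apply: ler_wpM2r; first by move: k_gt0; lra.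
by have := bu (UY j); rewrite /= /sitev (negbTE (h3 _ hn)) subr0.
Qed.

Lemma box_nbD_pos u i o : box cen rad u -> (0 < phi i)%N -> o = pr i \/ o = nx i ->
  `|nbD u o| * theta <= rad (UY i).
Proof.
move=> bu /phi_pos [h1 h2 h3]; case: o => [j|]; last by case=> /esym.
move=> h; have hn : nb i j by case: h => h; [left|right].
apply: le_trans (rad_nb hn); apply: ler_wpM2r; first by move: k_gt0; lra.
exact: box_D.
Qed.

Variables kap b e : R.
Hypothesis kap_gt0 : 0 < kap.
Hypothesis kap_le : kap <= k.
Hypothesis e_ge0 : 0 <= e.
Hypothesis e_small : e <= 10^-1 ^+ 6.
Hypothesis b_ge2 : 2 <= b.
Hypothesis b_le3 : b <= 3.
Local Notation T := (sysT kap b e).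

Lemma sitev_Bp s t : Bp t (sitev R s) = 0.
Proof. by rewrite /Bp /sitev; case: s => /=; ring. Qed.

Lemma kap_mul_le (x c : R) : `|x| <= c -> `|kap * x| <= k * c.
Proof. by move=> h; apply: norm_mul_le => //; rewrite ger0_norm // ltW. Qed.

(** Half of the box stays free: values of [v] and [t] taken from one solution can then be frozen in
    another system, and a first-order correction of a solution remains in the box. *)
Lemma sysT_half vf tf u : box cen rad u ->
  `|odflt 0 vf| <= rad Uv / 2 ->
  `|odflt 0 tf| <= rad Ut / 2 ->
  forall j, `|T vf tf u j - cen j| <= rad j / 2.
Proof.
move=> bu hv ht; have bt := box_t bu; have bv := box_v bu.
have k0 := k_gt0; have ks := k_small; have k2 := k2_le.
have z0 : `|0 : R| <= 10^-1 ^+ 3 by rewrite normr0 exprn_ge0 //; lra.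
case=> [i|i||] /=.
- have h1 : `|(u (UY i) - islope R (site i) * Bp (u Ut) (u (UY i))) - sitev R (site i)|
     <= 10^-1 * rad (UY i).
    have s0 : `|sitev R (site i) - sitev R (site i)| <= 100^-1 ^+ 2.
      by rewrite subrr normr0 exprn_ge0 //; lra.
    have := residual_lipschitz bt bt (box_Y4 bu i) s0.
    rewrite sitev_Bp mulr0 subr0 !subrr normr0 !(mulr0, addr0) => h.
    apply: le_trans h _; apply: ler_wpM2l; [lra|exact: (bu (UY i))].
  have h2 : `|islope R (site i) * (kap * (nbY u (pr i) - psi b e (nbY u (nx i))))|
     <= 4 / 10 * rad (UY i).
    (* At depth 0 the radius is [100 * k] and absolute bounds suffice. Deeper, a neighbour is at
       most [rad / theta], and the factor [k = theta / 50] pays for it. *)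
    have [p0|p0] := posnP (phi i).
      rewrite /= p0 expr0 mulr1.
      have := psi_norm e_ge0 e_small b_ge2 b_le3 (box_nbY3 bu (nx i)).
      have := box_nbY bu (pr i); have := box_nbY bu (nx i) => a1 a2 a3.
      have a4 : `|nbY u (pr i) - psi b e (nbY u (nx i))| <= 9.
        by apply: le_trans (ler_normB _ _) _; lra.
      by have := norm_mul_le (islope_norm R (site i)) (kap_mul_le a4); lra.
    have ns : site i = false.
      by apply/negP => /phi_site ei; rewrite ei in p0.
    rewrite ns mul1r.
    have := psi_norm e_ge0 e_small b_ge2 b_le3 (box_nbY3 bu (nx i)).
    have := box_nbY_pos bu p0 (or_introl erefl).
    have := box_nbY_pos bu p0 (or_intror erefl) => a1 a2 a3.
    have a4 : `|nbY u (pr i) - psi b e (nbY u (nx i))| * theta <= 42 / 10 * rad (UY i).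
      have := ler_normB (nbY u (pr i)) (psi b e (nbY u (nx i))); nra.
    have := kap_mul_le (lexx `|nbY u (pr i) - psi b e (nbY u (nx i))|).
    move: a4; have := rad_ge0 (UY i); lra.
  have -> : u (UY i) - islope R (site i) * resY kap b e u i - sitev R (site i) =
     (u (UY i) - islope R (site i) * Bp (u Ut) (u (UY i)) - sitev R (site i))
     + islope R (site i) * (kap * (nbY u (pr i) - psi b e (nbY u (nx i)))).
    by rewrite /resY; ring.
  by apply: le_trans (ler_normD _ _) _; move: (rad_ge0 (UY i)) h1 h2; rewrite /=; lra.
- rewrite subr0.
  have h1 : `|(1 - islope R (site i) * dBp (u Ut) (u (UY i))) * u (UD i)| <= 30^-1 * rad (UY i).
    exact: norm_mul_le (islope_dBp bt (box_Y4 bu i)) (box_D bu i).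
  pose N := wp i * nbD u (pr i) - dpsi b e (nbY u (nx i)) * (wn i * nbD u (nx i)).
  have c1 := norm_mul_le (wp_bd i) (lexx `|nbD u (pr i)|).
  have c2 := norm_mul_le (dpsi_norm e_ge0 e_small b_ge2 b_le3 (box_nbY3 bu (nx i)))
     (norm_mul_le (wn_bd i) (lexx `|nbD u (nx i)|)).
  have c3 := ler_normB (wp i * nbD u (pr i)) (dpsi b e (nbY u (nx i)) * (wn i * nbD u (nx i))).
  have h2 : `|islope R (site i) * (kap * N)| <= 4 / 10 * rad (UY i).
    have [p0|p0] := posnP (phi i).
      rewrite /= p0 expr0 mulr1.
      have := box_nbD bu (pr i); have := box_nbD bu (nx i) => a1 a2.
      have a4 : `|N| <= 9 by rewrite /N; lra.
      by have := norm_mul_le (islope_norm R (site i)) (kap_mul_le a4); lra.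
    have ns : site i = false.
      by apply/negP => /phi_site ei; rewrite ei in p0.
    rewrite ns mul1r.
    have := box_nbD_pos bu p0 (or_introl erefl).
    have := box_nbD_pos bu p0 (or_intror erefl) => a1 a2.
    have a4 : `|N| * theta <= 9 * rad (UY i).
      have r0 := rad_ge0 (UY i); rewrite /N; nra.
    have := kap_mul_le (lexx `|N|).
    move: a4; have := rad_ge0 (UY i); lra.
  have -> : u (UD i) - islope R (site i) * resD kap b e u i =
     (1 - islope R (site i) * dBp (u Ut) (u (UY i))) * u (UD i) + islope R (site i) * (kap * N).
    by rewrite /resD /N; ring.
  by apply: le_trans (ler_normD _ _) _; move: (rad_ge0 (UY i)) h1 h2; rewrite /=; lra.
- rewrite subr0; case: vf hv => [v0|_] //=.
  have := fold_slope_lipschitz bt z0 bv z0.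
  have -> : dBp 0 (2 + 0) = 0 :> R by rewrite /dBp; field.
  rewrite !addr0 !subr0 => h1.
  have Y3 : `|u (UY R0)| <= 3 by apply: le_trans (box_Y3 bu R0) _; lra.
  have h2 : `|u (UD L0) - dpsi b e (u (UY R0)) * u (UD R0)| <= 420 * k.
    apply: le_trans (ler_normB _ _) _.
    have := norm_mul_le (dpsi_norm e_ge0 e_small b_ge2 b_le3 Y3) (box_D100 bu R0).
    have := box_D100 bu L0; lra.
  have h3 := kap_mul_le h2.
  have b1 := bu Uv; have b2 := bu Ut; rewrite /= !subr0 in b1 b2.
  have -> : u Uv + resH kap b e u = (u Uv + dBp (u Ut) (2 + u Uv))
     - kap * (u (UD L0) - dpsi b e (u (UY R0)) * u (UD R0)) by rewrite /resH; ring.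
  apply: le_trans (ler_normB _ _) _; move: (sqr_ge0 k); lra.
- rewrite subr0; case: tf ht => [t0|_] //=.
  have := fold_value_lipschitz bt z0 bv z0.
  have -> : Bp 0 (2 + 0) = 0 :> R by rewrite /Bp; ring.
  rewrite !addr0 !subr0 => h1.
  have Y3 : `|u (UY R0)| <= 3 by apply: le_trans (box_Y3 bu R0) _; lra.
  have h2 : `|u (UY L0) - psi b e (u (UY R0))| <= 420 * k.
    apply: le_trans (ler_normB _ _) _.
    have := psi_norm e_ge0 e_small b_ge2 b_le3 Y3.
    have := box_Y bu L0; have := box_Y bu R0; rewrite siteL0 siteR0 /sitev !subr0; lra.
  have h3 := kap_mul_le h2.
  have b1 := bu Uv; have b2 := bu Ut; rewrite /= !subr0 in b1 b2.
  have -> : u Ut + resG kap b e u = (u Ut + Bp (u Ut) (2 + u Uv))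
     - kap * (u (UY L0) - psi b e (u (UY R0))) by rewrite /resG; ring.
  apply: le_trans (ler_normB _ _) _; move: (sqr_ge0 k); lra.
Qed.

Section Weights.
Variables (w : I -> R) (rv rt : R) (vf tf : option R).
Definition weight (j : unknown I) : R :=
  match j with UY i | UD i => w i | Uv => rv | Ut => rt end.
Hypothesis w_ge0 : forall i, 0 <= w i.
Hypothesis rv_ge0 : 0 <= rv.
Hypothesis rt_ge0 : 0 <= rt.
Hypothesis w_nb : forall i j, nb i j -> w j * theta <= w i.
Hypothesis w_site : forall i j, site i -> nb i j -> w j <= w i.
Hypothesis w_None : forall i, pr i = None \/ nx i = None -> 400 * k * rv <= w i.
Hypothesis w_t : forall i, 10 ^+ 3 * rad (UY i) * rt <= w i.
Hypothesis w_fold : vf = None -> 3 * rt + k * (w L0 + 4 * w R0) <= 4 / 10 * rv.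
Hypothesis w_value : tf = None -> rv / 100 + k * (w L0 + 4 * w R0) <= 4 / 10 * rt.

Definition nbw o := if o is Some j then w j else rv.

Lemma nbw_ge0 o : 0 <= nbw o.
Proof. by case: o => /=. Qed.

Lemma nbw_le i o : o = pr i \/ o = nx i -> `|islope R (site i)| * (k * nbw o) <= w i / 50.
Proof.
move=> ho; have k0 := k_gt0; have ks := k_small; have w0 := w_ge0 i.
have il := islope_norm R (site i).
case: o ho => [j|] ho /=.
  have hn : nb i j by case: ho => ho; [left|right].
  have wj := w_ge0 j; case si: (site i) il => il; rewrite /islope.
    have := w_site si hn; rewrite normrN ger0_norm //; nra.
  have := w_nb hn; rewrite normr1; lra.
have := w_None (i := i); case: ho => <- h; have {}h := h ltac:(by tauto).
  all: have rk : 0 <= k * rv by rewrite mulr_ge0 // ltW.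
  all: have := ler_wpM2r rk il; lra.
Qed.

(** Neighbours act through the factor [k], so near the saddle weights may grow by [1 / theta] per
    step; at the site 1, where [islope] has absolute value 4, a neighbour must not weigh more than
    the site. [t] acts on an equation through the distance to the site or through [UD], both bounded
    by [rad], which explains [w_t]. *)
Lemma sysT_halves : halves cen rad (T vf tf) weight.
Proof.
move=> D u u' D0 bu bu' hD.
have k0 := k_gt0; have ks := k_small; have k2 := k2_le.
have bt := box_t bu; have bv := box_v bu; have bt' := box_t bu'; have bv' := box_v bu'.
have t1 : `|u Ut| <= 1 by apply: le_trans bt _; lra.
have hY i : `|u (UY i) - u' (UY i)| <= D * w i := hD (UY i).
have hDl i : `|u (UD i) - u' (UD i)| <= D * w i := hD (UD i).
have hv : `|u Uv - u' Uv| <= D * rv := hD Uv.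
have ht : `|u Ut - u' Ut| <= D * rt := hD Ut.
have nY o : `|nbY u o - nbY u' o| <= D * nbw o.
  case: o => [j|] /=; first exact: hY.
  by have -> : 2 + u Uv - (2 + u' Uv) = u Uv - u' Uv by ring.
have nD o : `|nbD u o - nbD u' o| <= D * nbw o.
  case: o => [j|] /=; first exact: hDl.
  by rewrite subrr normr0 mulr_ge0.
have nk i o : o = pr i \/ o = nx i -> `|islope R (site i)| * (k * (D * nbw o)) <= D * (w i / 50).
  move=> /nbw_le h; have := ler_wpM2l D0 h; lra.
have kn (c : R) : 0 <= c -> kap * c <= k * c by move=> c0; apply: ler_wpM2r.
have Y3 v i : box cen rad v -> `|v (UY i)| <= 3.
  by move=> bx; apply: le_trans (box_Y3 bx i) _; lra.
case=> [i|i||].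
- have w0 : 0 <= D * w i by rewrite mulr_ge0.
  have h1 := residual_lipschitz bt bt' (box_Y4 bu i) (box_Y4 bu' i).
  have h2 : 2 * `|u' (UY i) - sitev R (site i)| * `|u Ut - u' Ut| <= D * w i / 500.
    have := w_t i; have a1 : `|u' (UY i) - sitev R (site i)| <= rad (UY i) := bu' (UY i).
    have a2 := ler_pM (normr_ge0 _) (normr_ge0 _) a1 ht; move=> a3.
    have := ler_wpM2l D0 a3; lra.
  have p1 := nk i _ (or_introl erefl); have p2 := nk i _ (or_intror erefl).
  have h3 : `|islope R (site i) * (kap * ((nbY u (pr i) - nbY u' (pr i))
       - (psi b e (nbY u (nx i)) - psi b e (nbY u' (nx i)))))| <= D * w i / 10.
    have a1 := psi_lipschitz4 e_ge0 e_small b_ge2 b_le3 (box_nbY3 bu (nx i)) (box_nbY3 bu' (nx i)).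
    have a2 := ler_normB (nbY u (pr i) - nbY u' (pr i))
       (psi b e (nbY u (nx i)) - psi b e (nbY u' (nx i))).
    have a3 : `|(nbY u (pr i) - nbY u' (pr i)) - (psi b e (nbY u (nx i)) - psi b e (nbY u' (nx i)))|
       <= D * nbw (pr i) + 32 / 10 * (D * nbw (nx i)).
      by have := nY (pr i); have := nY (nx i); lra.
    have := ler_wpM2l (normr_ge0 (islope R (site i))) (kap_mul_le a3); rewrite -normrM.
    move: p1 p2 w0; lra.
  rewrite /weight /sysT; have -> : u (UY i) - islope R (site i) * resY kap b e u i -
      (u' (UY i) - islope R (site i) * resY kap b e u' i) =
     ((u (UY i) - islope R (site i) * Bp (u Ut) (u (UY i)))
      - (u' (UY i) - islope R (site i) * Bp (u' Ut) (u' (UY i))))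
     + islope R (site i) * (kap * ((nbY u (pr i) - nbY u' (pr i))
       - (psi b e (nbY u (nx i)) - psi b e (nbY u' (nx i))))).
    by rewrite /resY; ring.
  apply: le_trans (ler_normD _ _) _; have := hY i; move: h1 h2 h3 w0; lra.
- have w0 : 0 <= D * w i by rewrite mulr_ge0.
  have h1 := norm_mul_le (islope_dBp bt (box_Y4 bu i)) (hDl i).
  have h2 : `|islope R (site i) * (u' (UD i) * (dBp (u Ut) (u (UY i)) - dBp (u' Ut) (u' (UY i))))|
      <= D * w i / 10.
    have a1 := dBp_lipschitz2 (u' Ut) t1 (Y3 u i bu) (Y3 u' i bu').
    have a2 := box_D bu' i; have a2' := box_D100 bu' i.
    have a3 : `|dBp (u Ut) (u (UY i)) - dBp (u' Ut) (u' (UY i))| <= 60 * (D * w i) + 9 * (D * rt).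
      by apply: le_trans a1 _; have := hY i; lra.
    have := norm_mul_le (islope_norm R (site i)) (norm_mul_le (lexx `|u' (UD i)|) a3).
    have c1 := ler_wpM2r w0 a2'.
    have Drt : 0 <= D * rt by rewrite mulr_ge0.
    have c2 := ler_wpM2r Drt a2.
    have c3 := ler_wpM2l D0 (w_t i).
    have c4 : 100 * k * (D * w i) <= 10^-1 ^+ 4 * (D * w i) by apply: ler_wpM2r => //; lra.
    move: c1 c2 c3 c4 w0; lra.
  have p1 := nk i _ (or_introl erefl); have p2 := nk i _ (or_intror erefl).
  pose P := wp i * (nbD u (pr i) - nbD u' (pr i)).
  pose Q := wn i * (dpsi b e (nbY u (nx i)) * (nbD u (nx i) - nbD u' (nx i))
      + nbD u' (nx i) * (dpsi b e (nbY u (nx i)) - dpsi b e (nbY u' (nx i)))).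
  have h3 : `|islope R (site i) * (kap * (P - Q))| <= D * w i / 5.
    have a1 := norm_mul_le (dpsi_norm e_ge0 e_small b_ge2 b_le3 (box_nbY3 bu (nx i))) (nD (nx i)).
    have a2 := dpsi_lipschitz e_ge0 e_small b_ge2 b_le3 (box_nbY3 bu (nx i)) (box_nbY3 bu' (nx i)).
    have a3 := norm_mul_le (box_nbD bu' (nx i)) a2.
    have a4 := ler_normD (dpsi b e (nbY u (nx i)) * (nbD u (nx i) - nbD u' (nx i)))
       (nbD u' (nx i) * (dpsi b e (nbY u (nx i)) - dpsi b e (nbY u' (nx i)))).
    have a5 : `|dpsi b e (nbY u (nx i)) * (nbD u (nx i) - nbD u' (nx i)) +
       nbD u' (nx i) * (dpsi b e (nbY u (nx i)) - dpsi b e (nbY u' (nx i)))| <= 4 * (D * nbw (nx i)).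
      have q0 : 0 <= D * nbw (nx i) by rewrite mulr_ge0 // nbw_ge0.
      by have := nY (nx i); lra.
    have a6 := norm_mul_le (wn_bd i) a5; rewrite -/Q in a6.
    have a7 := norm_mul_le (wp_bd i) (nD (pr i)); rewrite -/P in a7.
    have a8 : `|P - Q| <= 2 * (D * nbw (pr i)) + 8 * (D * nbw (nx i)).
      by apply: le_trans (ler_normB _ _) _; lra.
    have := ler_wpM2l (normr_ge0 (islope R (site i))) (kap_mul_le a8); rewrite -normrM.
    move: p1 p2 w0; lra.
  rewrite /weight /sysT; have -> : u (UD i) - islope R (site i) * resD kap b e u i -
      (u' (UD i) - islope R (site i) * resD kap b e u' i) =
     (1 - islope R (site i) * dBp (u Ut) (u (UY i))) * (u (UD i) - u' (UD i))
     - islope R (site i) * (u' (UD i) * (dBp (u Ut) (u (UY i)) - dBp (u' Ut) (u' (UY i))))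
     + islope R (site i) * (kap * (P - Q)).
    by rewrite /resD /P /Q; ring.
  apply: le_trans (ler_normD _ _) _; have := ler_normB
    ((1 - islope R (site i) * dBp (u Ut) (u (UY i))) * (u (UD i) - u' (UD i)))
    (islope R (site i) * (u' (UD i) * (dBp (u Ut) (u (UY i)) - dBp (u' Ut) (u' (UY i))))).
  move: h1 h2 h3 w0; lra.
- case: vf w_fold => [v0 _|wf] /=; first by rewrite subrr normr0 !mulr_ge0 //; lra.
  have h1 := fold_slope_lipschitz bt bt' bv bv'.
  have h2 := norm_mul_le (dpsi_norm e_ge0 e_small b_ge2 b_le3 (Y3 u R0 bu)) (hDl R0).
  have h3 := norm_mul_le (box_D100 bu' R0)
     (dpsi_lipschitz e_ge0 e_small b_ge2 b_le3 (Y3 u R0 bu) (Y3 u' R0 bu')).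
  pose P := (u (UD L0) - u' (UD L0)) - (dpsi b e (u (UY R0)) * (u (UD R0) - u' (UD R0))
       + u' (UD R0) * (dpsi b e (u (UY R0)) - dpsi b e (u' (UY R0)))).
  have h4 : `|P| <= D * w L0 + 4 * (D * w R0).
    have wR : 0 <= D * w R0 by rewrite mulr_ge0.
    have c4 : 100 * k * (10^-1 ^+ 2 * `|u (UY R0) - u' (UY R0)|) <= D * w R0 / 2.
      have := hY R0; have := normr_ge0 (u (UY R0) - u' (UY R0)); nra.
    have a1 := ler_normD (dpsi b e (u (UY R0)) * (u (UD R0) - u' (UD R0)))
        (u' (UD R0) * (dpsi b e (u (UY R0)) - dpsi b e (u' (UY R0)))).
    apply: le_trans (ler_normB _ _) _; have := hDl L0; lra.
  have h5 := kap_mul_le h4; have wv := ler_wpM2l D0 (wf erefl).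
  have -> : u Uv + resH kap b e u - (u' Uv + resH kap b e u') =
    ((u Uv + dBp (u Ut) (2 + u Uv)) - (u' Uv + dBp (u' Ut) (2 + u' Uv))) - kap * P.
    by rewrite /resH /P; ring.
  apply: le_trans (ler_normB _ _) _; move: h1 h5 wv hv ht; lra.
- case: tf w_value => [t0 _|wf] /=; first by rewrite subrr normr0 !mulr_ge0 //; lra.
  have h1 := fold_value_lipschitz bt bt' bv bv'.
  have h2 := psi_lipschitz4 e_ge0 e_small b_ge2 b_le3 (Y3 u R0 bu) (Y3 u' R0 bu').
  pose P := (u (UY L0) - u' (UY L0)) - (psi b e (u (UY R0)) - psi b e (u' (UY R0))).
  have h4 : `|P| <= D * w L0 + 4 * (D * w R0).
    have wR : 0 <= D * w R0 by rewrite mulr_ge0.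
    by apply: le_trans (ler_normB _ _) _; have := hY L0; have := hY R0; lra.
  have h5 := kap_mul_le h4; have wv := ler_wpM2l D0 (wf erefl).
  have -> : u Ut + resG kap b e u - (u' Ut + resG kap b e u') =
    ((u Ut + Bp (u Ut) (2 + u Uv)) - (u' Ut + Bp (u' Ut) (2 + u' Uv))) - kap * P.
    by rewrite /resG /P; ring.
  apply: le_trans (ler_normB _ _) _; move: h1 h5 wv hv ht; lra.
Qed.

End Weights.

Lemma rad_halves vf tf : halves cen rad (T vf tf) rad.
Proof.
have k0 := k_gt0; have ks := k_small; have k2 := k2_le.
have k2' := sqr_ge0 k.
pose w i := rad (UY i).
have -> : rad = weight w (rad Uv) (rad Ut) by apply/funext => -[].
have w1 i : phi i = 0%N -> w i = 100 * k by move=> h; rewrite /w /= h expr0 mulr1.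
apply: sysT_halves => //.
- by move=> i; apply: rad_ge0.
- exact: rad_ge0.
- exact: rad_ge0.
- by move=> i j; apply: rad_nb.
- by move=> i j /phi_site/w1 -> _; apply: rad_le100k.
- move=> i h; have [p0|/phi_pos [h1 h2 _]] := posnP (phi i); last by case: h.
  have rv : rad Uv <= 10^-1 by rewrite /=; lra.
  by rewrite w1 //; have := ler_wpM2l (ltW k0) rv; lra.
- move=> i; rewrite -/(w i).
  have w0 : 0 <= w i by apply: rad_ge0.
  have rt : 10 ^+ 3 * rad Ut <= 1 by rewrite /=; lra.
  by have := ler_wpM2l w0 rt; lra.
- move=> _; have hL := ler_wpM2l (ltW k0) (rad_le100k L0).
  by have hR := ler_wpM2l (ltW k0) (rad_le100k R0); rewrite -!/(w _) in hL hR; rewrite /=; lra.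
- move=> _; have hL := ler_wpM2l (ltW k0) (rad_le100k L0).
  by have hR := ler_wpM2l (ltW k0) (rad_le100k R0); rewrite -!/(w _) in hL hR; rewrite /=; lra.
Qed.

Lemma sysT_solution vf tf : `|odflt 0 vf| <= rad Uv / 2 -> `|odflt 0 tf| <= rad Ut / 2 ->
  exists u, [/\ box cen rad u, forall j, `|u j - cen j| <= rad j / 2 &
                forall j, T vf tf u j = u j].
Proof.
move=> hv ht.
have hs u : box cen rad u -> box cen rad (T vf tf u).
  by move=> bu j; apply: le_trans (sysT_half bu hv ht j) _; have := rad_ge0 j; lra.
have [u bu fu] := banach_box rad_ge0 hs (rad_halves vf tf).
by exists u; split => // j; rewrite -fu; apply: sysT_half.
Qed.

(** The constants [kap] and [b] multiply only neighbouring values. These are bounded at depth 0 and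
    at most [rad / theta] deeper, so the effect of a change decays like the radii. *)
Lemma sysT_param kap' b' d vf tf u : 0 < kap' -> kap' <= k -> 2 <= b' -> b' <= 3 -> 0 <= d ->
  `|kap - kap'| <= k * d -> `|b - b'| <= d -> box cen rad u ->
  forall j, `|T vf tf u j - sysT kap' b' e vf tf u j| <= d * rad j.
Proof.
move=> kp0 kpk b2 b3 d0 hk hb bu.
have k0 := k_gt0; have ks := k_small; have kk := sqr_ge0 k.
have kp : `|kap'| <= k by rewrite ger0_norm // ltW.
have psib y : psi b e y - psi b' e y = (b - b') * Qp e y by rewrite /psi /Xp; ring.
have dpsib y : dpsi b e y - dpsi b' e y = (b - b') * dQp e y by rewrite /dpsi /dXp; ring.
have Y3 i : `|u (UY i)| <= 3 by apply: le_trans (box_Y3 bu i) _; lra.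
case=> [i|i||].
- rewrite /sysT; set x := nbY u (pr i); set z := nbY u (nx i).
  have -> : u (UY i) - islope R (site i) * resY kap b e u i -
    (u (UY i) - islope R (site i) * resY kap' b' e u i) =
    islope R (site i) * ((kap - kap') * (x - psi b e z) - kap' * ((b - b') * Qp e z)).
    by rewrite -psib /resY -/x -/z; ring.
  have z3 : `|z| <= 3 := box_nbY3 bu (nx i).
  have a1 : `|x - psi b e z| <= `|x| + 32 / 10 * `|z|.
    by apply: le_trans (ler_normB _ _) _; have := psi_norm e_ge0 e_small b_ge2 b_le3 z3; lra.
  have a2 := norm_mul_le hk a1; have a3 := norm_mul_le kp (norm_mul_le hb (Qp_norm e_ge0 e_small z3)).
  have a4 := ler_normB ((kap - kap') * (x - psi b e z)) (kap' * ((b - b') * Qp e z)).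
  have a5 : `|(kap - kap') * (x - psi b e z) - kap' * ((b - b') * Qp e z)| <=
    d * (k * (`|x| + 43 / 10 * `|z|)) by lra.
  have [p0|p0] := posnP (phi i).
    rewrite /= p0 expr0 mulr1.
    have hx : `|x| <= 21 / 10 := box_nbY bu (pr i); have hz : `|z| <= 21 / 10 := box_nbY bu (nx i).
    have a6 : k * (`|x| + 43 / 10 * `|z|) <= k * 25.
      by apply: ler_wpM2l; [exact: ltW|lra].
    have := norm_mul_le (islope_norm R (site i)) (le_trans a5 (ler_wpM2l d0 a6)).
    lra.
  have ns : site i = false by apply/negP => /phi_site ei; rewrite ei in p0.
  rewrite ns mul1r; apply: le_trans a5 _; apply: ler_wpM2l => //.
  have hx : `|x| * theta <= rad (UY i) := box_nbY_pos bu p0 (or_introl erefl).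
  have hz : `|z| * theta <= rad (UY i) := box_nbY_pos bu p0 (or_intror erefl).
  by have := rad_ge0 (UY i); lra.
- rewrite /sysT; set x := nbD u (pr i); set y := nbD u (nx i); set z := nbY u (nx i).
  have -> : u (UD i) - islope R (site i) * resD kap b e u i -
    (u (UD i) - islope R (site i) * resD kap' b' e u i) =
    islope R (site i) * ((kap - kap') * (wp i * x - dpsi b e z * (wn i * y))
      - kap' * (((b - b') * dQp e z) * (wn i * y))).
    by rewrite -dpsib /resD -/x -/y -/z; ring.
  have z3 : `|z| <= 3 := box_nbY3 bu (nx i).
  have c1 := norm_mul_le (wp_bd i) (lexx `|x|); have c2 := norm_mul_le (wn_bd i) (lexx `|y|).
  have a1 : `|wp i * x - dpsi b e z * (wn i * y)| <= 2 * `|x| + 64 / 10 * `|y|.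
    apply: le_trans (ler_normB _ _) _.
    by have := norm_mul_le (dpsi_norm e_ge0 e_small b_ge2 b_le3 z3) c2; lra.
  have a2 := norm_mul_le hk a1.
  have a3 := norm_mul_le kp (norm_mul_le (norm_mul_le hb (dQp_norm e_ge0 e_small z3)) c2).
  have a4 := ler_normB ((kap - kap') * (wp i * x - dpsi b e z * (wn i * y)))
     (kap' * (((b - b') * dQp e z) * (wn i * y))).
  have a5 : `|(kap - kap') * (wp i * x - dpsi b e z * (wn i * y))
      - kap' * (((b - b') * dQp e z) * (wn i * y))| <= d * (k * (2 * `|x| + 9 * `|y|)).
    have : 0 <= k * (d * `|y|) by rewrite !mulr_ge0 // ltW.
    lra.
  have [p0|p0] := posnP (phi i).
    rewrite /= p0 expr0 mulr1.
    have hx : `|x| <= 1 := box_nbD bu (pr i); have hz : `|y| <= 1 := box_nbD bu (nx i).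
    have a6 : k * (2 * `|x| + 9 * `|y|) <= k * 25.
      by apply: ler_wpM2l; [exact: ltW|lra].
    have := norm_mul_le (islope_norm R (site i)) (le_trans a5 (ler_wpM2l d0 a6)).
    lra.
  have ns : site i = false by apply/negP => /phi_site ei; rewrite ei in p0.
  rewrite ns mul1r; apply: le_trans a5 _; apply: ler_wpM2l => //.
  have hx : `|x| * theta <= rad (UY i) := box_nbD_pos bu p0 (or_introl erefl).
  have hz : `|y| * theta <= rad (UY i) := box_nbD_pos bu p0 (or_intror erefl).
  by have := rad_ge0 (UY i); rewrite /=; move: hx hz; rewrite /=; lra.
- case: vf => [v0|] /=; first by rewrite subrr normr0; apply: mulr_ge0 (rad_ge0 Uv).
  have -> : u Uv + resH kap b e u - (u Uv + resH kap' b' e u) =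
     - ((kap - kap') * (u (UD L0) - dpsi b e (u (UY R0)) * u (UD R0))
       - kap' * (((b - b') * dQp e (u (UY R0))) * u (UD R0))).
    by rewrite -dpsib /resH; ring.
  rewrite normrN; apply: le_trans (ler_normB _ _) _.
  have a1 : `|u (UD L0) - dpsi b e (u (UY R0)) * u (UD R0)| <= 420 * k.
    apply: le_trans (ler_normB _ _) _; have := box_D100 bu L0.
    by have := norm_mul_le (dpsi_norm e_ge0 e_small b_ge2 b_le3 (Y3 R0)) (box_D100 bu R0); lra.
  have a2 := norm_mul_le hk a1.
  have a3 := norm_mul_le kp (norm_mul_le (norm_mul_le hb (dQp_norm e_ge0 e_small (Y3 R0)))
     (box_D100 bu R0)).
  have : 0 <= d * k ^+ 2 by rewrite mulr_ge0.
  move: a2 a3; lra.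
- case: tf => [t0|] /=; first by rewrite subrr normr0; apply: mulr_ge0 (rad_ge0 Ut).
  have -> : u Ut + resG kap b e u - (u Ut + resG kap' b' e u) =
     - ((kap - kap') * (u (UY L0) - psi b e (u (UY R0)))
       - kap' * ((b - b') * Qp e (u (UY R0)))).
    by rewrite -psib /resG; ring.
  rewrite normrN; apply: le_trans (ler_normB _ _) _.
  have hR := box_Y bu R0; have hL := box_Y bu L0; rewrite siteL0 siteR0 /sitev /= !subr0 in hR hL.
  have a1 : `|u (UY L0) - psi b e (u (UY R0))| <= 420 * k.
    apply: le_trans (ler_normB _ _) _.
    by have := psi_norm e_ge0 e_small b_ge2 b_le3 (Y3 R0); lra.
  have a2 := norm_mul_le hk a1.
  have a4 : `|Qp e (u (UY R0))| <= 110 * k by have := Qp_norm e_ge0 e_small (Y3 R0); lra.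
  have a3 := norm_mul_le kp (norm_mul_le hb a4).
  have : 0 <= d * k ^+ 2 by rewrite mulr_ge0.
  move: a2 a3; lra.
Qed.

End System.

(** * Response of a nearly constant three-term recurrence to its far end *)

Section ThreeTerm.
Variable R : realType.

Lemma prod_near1 (x e : nat -> R) n : (forall j, (j < n)%N -> `|x j - 1| <= e j) ->
  \sum_(j < n) e j <= 4^-1 -> 1 / 2 <= \prod_(j < n) x j <= 2.
Proof.
move=> hx hs.
have ge0 j : (j < n)%N -> 0 <= e j by move=> /hx; apply: le_trans.
have sum0 m : (m <= n)%N -> 0 <= \sum_(j < m) e j.
  by move=> hm; apply: sumr_ge0 => i _; apply: ge0; apply: leq_trans hm.
have mono m : (m <= n)%N -> \sum_(j < m) e j <= 4^-1.
  move=> hm; apply: le_trans hs.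
  rewrite -(subnKC hm) big_split_ord /= lerDl; apply: sumr_ge0 => i _.
  by apply: ge0; rewrite -{2}(subnKC hm) ltn_add2l.
suff main m : (m <= n)%N -> 1 - \sum_(j < m) e j <= \prod_(j < m) x j <= 1 + 2 * \sum_(j < m) e j.
  by have := main n (leqnn n); move: hs; lra.
elim: m => [|m IH] hm; first by rewrite !big_ord0; lra.
have := IH (ltnW hm); have := sum0 m (ltnW hm); have := mono _ hm.
rewrite !big_ord_recr /=; have := ge0 _ hm; have := hx _ hm; rewrite ler_norml.
move: (\sum_(j < m) _) (\prod_(j < m) _) (e m) (x m) => S P d y h1 h2 h3 h4 /andP[h5 h6].
apply/andP; split; nra.
Qed.

Variables (a al be D : nat -> R) (al0 be0 rs : R) (e : nat -> R) (n : nat).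
Hypothesis rsE : rs * (1 - al0 * rs) = be0.
Hypothesis rs0 : rs != 0.
Hypothesis e_le : forall j, (j < n)%N -> 0 <= e j <= 16^-1.
Hypothesis a_near : forall j, (j < n)%N -> `|a j - 1| <= e j.
Hypothesis al_near : forall j, (j < n)%N -> `|al j - al0| <= `|al0| * e j.
Hypothesis be_near : forall j, (j < n)%N -> `|be j - be0| <= `|be0| * e j.
Hypothesis small : `|al0 * rs| <= 10^-1 ^+ 3.
Hypothesis small0 : (0 < n)%N -> `|al0 * rs| <= e 0%N / 100.
Hypothesis smallS : forall j, (j.+1 < n)%N -> `|al0 * rs| * e j <= e j.+1 / 100.
Hypothesis eq0 : (0 < n)%N -> a 0%N * D 0%N = be 0%N * D 1%N.
Hypothesis eqS : forall j, (j.+1 < n)%N -> a j.+1 * D j.+1 = al j.+1 * D j + be j.+1 * D j.+2.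

(** [rs] is the ratio [D j / D j.+1] of the recurrence with constant coefficients. Once the
    preceding ratio is known up to a small error, eliminating the preceding term leaves an equation
    of this form, with the error collected in [r]. *)
Lemma ratio_step j (r : R) : (j < n)%N -> `|r| <= 5 / 4 * e j ->
  (1 - al0 * rs + r) * D j = be j * D j.+1 ->
  exists2 x, `|x - 1| <= 4 * e j & D j = rs * x * D j.+1.
Proof.
move=> hj hr h; have hb := be_near hj; have /andP[e0 e1] := e_le hj.
set q := 1 - al0 * rs in h.
have q1 : 999 / 1000 <= q <= 1001 / 1000.
  by move: small; rewrite /q ler_norml => /andP[? ?]; apply/andP; split; lra.
have rs0' : 0 < `|rs| by rewrite normr_gt0.
have den : 9 / 10 <= q + r by move: hr; rewrite ler_norml; lra.
have den0 : q + r != 0 by apply: lt0r_neq0; lra.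
exists (be j / (rs * (q + r))).
  have -> : be j / (rs * (q + r)) - 1 = (be j - be0 - r * rs) / (rs * (q + r)).
    by rewrite -rsE -/q; field; rewrite den0 rs0.
  have be0E : `|be0| <= `|rs| * (1001 / 1000).
    by rewrite -rsE -/q; apply: norm_mul_le => //; rewrite ger0_norm; lra.
  have h1 : `|be j - be0 - r * rs| <= 27 / 10 * e j * `|rs|.
    apply: le_trans (ler_normB _ _) _; rewrite normrM.
    have : 0 <= e j * `|rs| by rewrite mulr_ge0 // ltW.
    have := ler_wpM2r (ltW rs0') hr; have := ler_wpM2r e0 be0E; lra.
  rewrite normrM normfV normrM ler_pdivrMr; last by rewrite mulr_gt0 // ger0_norm; lra.
  apply: le_trans h1 _; rewrite (ger0_norm (x := q + r)); last by lra.
  have : 0 <= e j * `|rs| by rewrite mulr_ge0 // ltW.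
  nra.
apply: (mulfI den0); rewrite h; field; by rewrite den0 rs0.
Qed.

Lemma ratio_exists j : (j < n)%N -> exists2 x, `|x - 1| <= 4 * e j & D j = rs * x * D j.+1.
Proof.
elim: j => [|j IH] hj.
  (* No term precedes index 0, so the whole of [al0 * rs] counts as an error here; this is the role
     of [small0]. *)
  apply: (@ratio_step 0%N (a 0%N - 1 + al0 * rs)) => //.
    apply: le_trans (ler_normD _ _) _; have := small0 hj; have := a_near hj.
    by have /andP[] := e_le hj; lra.
  by rewrite -eq0 //; ring.
have [x hx Dx] := IH (ltnW hj).
apply: (@ratio_step j.+1 ((a j.+1 - 1) - (al j.+1 - al0) * (rs * x) - al0 * rs * (x - 1))) => //.
  have := a_near hj; have := smallS hj; have h1 := al_near hj.
  have /andP[e0 e1] := e_le hj; have /andP[e0' e1'] := e_le (ltnW hj).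
  have x2 : `|x| <= 2 by move: hx; rewrite !ler_norml; lra.
  have h2 : `|(al j.+1 - al0) * (rs * x)| <= `|al0 * rs| * e j.+1 * 2.
    have := norm_mul_le h1 (norm_mul_le (lexx `|rs|) x2); rewrite !normrM; lra.
  have h3 : `|al0 * rs * (x - 1)| <= `|al0 * rs| * (4 * e j) by apply: norm_mul_le.
  have h4 := ler_wpM2r e0 small.
  have := ler_normB ((a j.+1 - 1) - (al j.+1 - al0) * (rs * x)) (al0 * rs * (x - 1)).
  have := ler_normB (a j.+1 - 1) ((al j.+1 - al0) * (rs * x)).
  lra.
have := eqS hj; rewrite Dx => h.
have -> : be j.+1 * D j.+2 = a j.+1 * D j.+1 - al j.+1 * (rs * x * D j.+1) by rewrite h; ring.
ring.
Qed.

(** The relative errors of the ratios are summable, so that their product stays between 1/2 and 2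
    whatever the length [n]. *)
Lemma far_end_response : \sum_(j < n) 4 * e j <= 4^-1 ->
  exists2 P, 1 / 2 <= P <= 2 & D 0%N = P * rs ^+ n * D n.
Proof.
move=> hs.
have [x hx] : exists x : nat -> R, forall j, (j < n)%N ->
    `|x j - 1| <= 4 * e j /\ D j = rs * x j * D j.+1.
  have h j : exists y, (j < n)%N -> `|y - 1| <= 4 * e j /\ D j = rs * y * D j.+1.
    case: (ltnP j n) => hj; last by exists 0.
    by have [y ? ?] := ratio_exists hj; exists y.
  by exists (fun j => projT1 (cid (h j))) => j; case: (cid (h j)).
exists (\prod_(j < n) x j).
  by apply: (@prod_near1 x (fun j => 4 * e j)) => // j /hx[].
have main m : (m <= n)%N -> D 0%N = (\prod_(j < m) x j) * rs ^+ m * D m.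
  elim: m => [|m IH] hm; first by rewrite big_ord0 expr0 !mul1r.
  rewrite IH ?(ltnW hm) // big_ord_recr /= exprSr.
  have [_ ->] := hx _ hm; ring.
exact: main.
Qed.

End ThreeTerm.

(** * The homoclinic tangency and the cycles shadowing it *)

Definition idx := (bool * nat)%type.

(* Positions on the two half-orbits issued from the fold point: [(true, j)] is [j.+1] steps
   in its past, [(false, j)] is [j.+1] steps in its future. *)
Definition hpr (i : idx) : option idx :=
  if i.1 then (if i.2 is j.+1 then Some (true, j) else None) else Some (false, i.2.+1).
Definition hnx (i : idx) : option idx :=
  if i.1 then Some (true, i.2.+1) else (if i.2 is j.+1 then Some (false, j) else None).
Definition hphi (i : idx) : nat := i.2.

(* The cycle visiting the fold, [m] times the saddle, once the site 1, and [n] times the saddle;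
   the site 1 sits at [(true, n)] and the indices beyond it are irrelevant. *)
Definition cpr (n m : nat) (i : idx) : option idx :=
  if i.1 then (if i.2 is j.+1 then Some (true, j) else None)
  else if i.2.+1 == m then Some (true, n) else Some (false, i.2.+1).
Definition cnx (n m : nat) (i : idx) : option idx :=
  if i.1 then (if i.2 == n then Some (false, m.-1) else Some (true, i.2.+1))
  else (if i.2 is j.+1 then Some (false, j) else None).
Definition csite (n : nat) (i : idx) : bool := i.1 && (i.2 == n).
(** Distance to the nearer end of a passage close to the saddle. Truncated subtraction gives 0 at
    the site [(true, n)], as [cphi_site] requires. *)
Definition cphi (n m : nat) (i : idx) : nat := minn i.2 ((if i.1 then n else m).-1 - i.2).

Section Family.
Variable R : realType.

(** It serves both as the bound on [kapf] and as the coefficient of the quartic terms. *)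
Definition kk : R := 10^-1 ^+ 6.
Definition zeta : R := kk / 2.
(* With this choice the saddle has the exact multipliers [zeta^-1] and [- b * zeta]. *)
Definition kapf (b : R) : R := zeta / (1 - b * zeta ^+ 2).

(* The variation along the future half-orbit is rescaled by the eigenvalue 2. *)
Definition cwp (m : nat) (i : idx) : R := if ~~ i.1 && (i.2.+1 == m) then 2 else 1.
Definition cwn (n : nat) (i : idx) : R := if csite n i then 1 / 2 else 1.

Lemma kk_gt0 : 0 < kk.
Proof. by rewrite exprn_gt0 // invr_gt0. Qed.

Lemma kk_small : kk <= 10^-1 ^+ 6.
Proof. exact: lexx. Qed.

Lemma zeta_gt0 : 0 < zeta.
Proof. by rewrite divr_gt0 ?kk_gt0. Qed.

Lemma kapf_den b : 2 <= b -> b <= 3 -> 99 / 100 <= 1 - b * zeta ^+ 2 < 1.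
Proof.
move=> b2 b3; have z0 := zeta_gt0; have z1 : zeta <= 100^-1.
  by rewrite /zeta; have := kk_small; lra.
have h1 : 0 < zeta ^+ 2 by rewrite exprn_gt0.
have h2 : zeta ^+ 2 <= zeta / 100 by rewrite expr2 ler_wpM2l // ltW.
apply/andP; split; nra.
Qed.

Lemma kapfE b : 2 <= b -> b <= 3 -> kapf b * (1 - b * zeta ^+ 2) = zeta.
Proof.
move=> b2 b3; have := kapf_den b2 b3 => h; rewrite /kapf divfK //.
by apply: lt0r_neq0; lra.
Qed.

Lemma kapf_bounds b : 2 <= b -> b <= 3 -> zeta <= kapf b <= 102 / 100 * zeta.
Proof.
move=> b2 b3; have z0 := zeta_gt0; have /andP[h1 h2] := kapf_den b2 b3.
have d0 : 0 < 1 - b * zeta ^+ 2 by lra.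
rewrite /kapf ler_pdivlMr // ler_pdivrMr //.
move: (1 - b * zeta ^+ 2) h1 h2 {d0} => d h1 h2; apply/andP; split; nra.
Qed.

Lemma kapf_gt0 b : 2 <= b -> b <= 3 -> 0 < kapf b.
Proof. by move=> b2 b3; have := kapf_bounds b2 b3; have := zeta_gt0; lra. Qed.

Lemma kapf_le b : 2 <= b -> b <= 3 -> kapf b <= kk.
Proof. by move=> b2 b3; have := kapf_bounds b2 b3; have := kk_gt0; rewrite /zeta; lra. Qed.

Lemma kapf_lipschitz b b' : 2 <= b -> b <= 3 -> 2 <= b' -> b' <= 3 ->
  `|kapf b - kapf b'| <= kk * `|b - b'|.
Proof.
move=> b2 b3 b2' b3'; have k0 := kk_gt0; have z0 := zeta_gt0.
have e1 := kapfE b2 b3; have e2 := kapfE b2' b3'.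
have -> : kapf b - kapf b' = (kapf b * kapf b' * zeta) * (b - b').
  apply: (mulfI (lt0r_neq0 z0)).
  have -> : zeta * (kapf b - kapf b') = kapf b * (kapf b' * (1 - b' * zeta ^+ 2))
     - kapf b' * (kapf b * (1 - b * zeta ^+ 2)) by rewrite e1 e2; ring.
  ring.
rewrite normrM; apply: ler_wpM2r => //.
have p1 := kapf_gt0 b2 b3; have p2 := kapf_gt0 b2' b3'.
have q1 := kapf_le b2 b3; have q2 := kapf_le b2' b3'.
have z1 : zeta <= 1 by rewrite /zeta; have := kk_small; lra.
have := kk_small => ks; rewrite ger0_norm; last by apply/ltW/mulr_gt0 => //; apply: mulr_gt0.
have : kapf b * kapf b' <= kk * 1 by apply: ler_pM; lra.
have : 0 < kapf b * kapf b' by rewrite mulr_gt0.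
nra.
Qed.

(** [g = 1] gives the tangency system; [g = 0] switches off the coupling of the tangent equations,
    when only positions with a prescribed [v] are sought. *)
Definition homT (b g : R) := sysT hpr hnx (fun=> g) (fun=> g) (fun=> false)
  (false, 0%N) (true, 0%N) (kapf b) b kk.
Definition cycT n m (b : R) := sysT (cpr n m) (cnx n m) (cwp m) (cwn n) (csite n)
  (false, 0%N) (true, 0%N) (kapf b) b kk.

Local Notation hbox := (box (cen R (fun _ : idx => false)) (rad kk hphi)).
Local Notation cbox n m := (box (cen R (csite n)) (rad kk (cphi n m))).

Lemma hphi_nb i j : nb hpr hnx i j -> (hphi i <= (hphi j).+1)%N.
Proof.
case: i => [[] [|i]] [] //= -[<-] //=; by rewrite /hphi /= ?leqnSn // (leq_trans (leqnSn _)).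
Qed.

Lemma hphi_pos i : (0 < hphi i)%N ->
  [/\ hpr i <> None, hnx i <> None & forall j, nb hpr hnx i j -> ~~ false].
Proof. by case: i => [[] [|i]]. Qed.

Lemma cphi_nb n m i j : nb (cpr n m) (cnx n m) i j -> (cphi n m i <= (cphi n m j).+1)%N.
Proof.
case: i => [[] i]; rewrite /nb /cpr /cnx /cphi /=.
  case=> [|]; first by case: i => //= i [<-] /=; lia.
  by case: eqP => [-> _|_ [<-]] /=; lia.
case; first by case: eqP => [<- _|_ [<-]] /=; lia.
by case: i => //= i [<-] /=; lia.
Qed.

Lemma cphi_pos n m i : (0 < cphi n m i)%N ->
  [/\ cpr n m i <> None, cnx n m i <> None &
      forall j, nb (cpr n m) (cnx n m) i j -> ~~ csite n j].
Proof.
case: i => [[] i]; rewrite /cphi /= => h; have i0 : (0 < i)%N by lia.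
  split; first by case: i h i0.
    by rewrite /cnx /=; case: eqP.
  move=> j [] /=; rewrite /cpr /cnx /=.
    by case: i h i0 => //= i h _ [<-]; rewrite /csite /=; apply/eqP; lia.
  by case: eqP => [ei|_ [<-]]; [lia|rewrite /csite /=; apply/eqP; lia].
split; first by rewrite /cpr /=; case: eqP.
  by case: i h i0.
move=> j [] /=; rewrite /cpr /cnx /=.
  by case: eqP => [ei|_ [<-]] //; lia.
by case: i h i0 => //= i h _ [<-].
Qed.

Lemma cphi_site n m i : csite n i -> cphi n m i = 0%N.
Proof. by case: i => [[] i] //; rewrite /csite /cphi /= => /eqP ->; lia. Qed.

Lemma cwp_bd m i : `|cwp m i| <= 2.
Proof. by rewrite /cwp; case: ifP => _; rewrite ger0_norm; lra. Qed.

Lemma cwn_bd n i : `|cwn n i| <= 2.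
Proof. by rewrite /cwn; case: ifP => _; rewrite ger0_norm; lra. Qed.

End Family.

(** * Homoclinic and cyclic solutions and their dependence on [b] *)

Section Tangency.
Variable R : realType.
Local Notation kk := (kk R).
Local Notation zeta := (zeta R).
Local Notation hbox := (box (cen R (fun _ : idx => false)) (rad kk hphi)).
Local Notation hrad := (rad kk hphi).
Local Notation cbox n m := (box (cen R (csite n)) (rad kk (cphi n m))).
Local Notation crad n m := (rad kk (cphi n m)).

Lemma kk_ge0 : 0 <= kk. Proof. exact: ltW (kk_gt0 R). Qed.

Lemma hom_solution (b g : R) vf tf : 2 <= b -> b <= 3 -> `|g| <= 2 ->
  `|odflt 0 vf| <= hrad Uv / 2 -> `|odflt 0 tf| <= hrad Ut / 2 ->
  exists u, [/\ hbox u, forall j, `|u j| <= hrad j / 2 & forall j, homT b g vf tf u j = u j].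
Proof.
move=> b2 b3 hg hv ht.
have [u [bu hu fu]] := sysT_solution (kk_gt0 R) (kk_small R) hphi_nb hphi_pos
  (fun i (h : false) => False_ind _ (notF h)) (L0 := (false, 0%N)) (R0 := (true, 0%N)) erefl erefl
  (fun=> hg) (fun=> hg) (kapf_gt0 b2 b3) (kapf_le b2 b3) kk_ge0 (kk_small R) b2 b3 hv ht.
exists u; split => // j; have := hu j; case: j => [i|i||] /=; by rewrite /sitev /= subr0.
Qed.

Lemma hom_halves (b g : R) vf tf : 2 <= b -> b <= 3 -> `|g| <= 2 ->
  halves (cen R (fun=> false)) hrad (homT b g vf tf) hrad.
Proof.
move=> b2 b3 hg; rewrite /homT; apply: rad_halves => //.
- exact: kk_gt0.
- exact: hphi_nb.
- exact: hphi_pos.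
- exact: kapf_gt0.
- exact: kapf_le.
- exact: kk_ge0.
Qed.

Lemma cyc_solution n m (b : R) tf : (0 < n)%N -> 2 <= b -> b <= 3 ->
  `|odflt 0 tf| <= crad n m Ut / 2 ->
  exists u, [/\ cbox n m u, forall j, `|u j - cen R (csite n) j| <= crad n m j / 2
              & forall j, cycT n m b None tf u j = u j].
Proof.
move=> n0 b2 b3 ht.
have s0 : csite n (true, 0%N) = false by rewrite /csite /=; apply/eqP => h; rewrite -h in n0.
have hv : `|odflt 0 None : R| <= crad n m Uv / 2.
  by rewrite /= normr0 divr_ge0 // (rad_ge0 (kk_gt0 R) (cphi n m) Uv).
exact: (sysT_solution (kk_gt0 R) (kk_small R) (@cphi_nb n m) (@cphi_pos n m) (@cphi_site n m)
  (L0 := (false, 0%N)) (R0 := (true, 0%N)) erefl s0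
  (@cwp_bd R m) (@cwn_bd R n) (kapf_gt0 b2 b3) (kapf_le b2 b3) kk_ge0 (kk_small R) b2 b3 hv ht).
Qed.

Lemma cyc_halves n m (b : R) vf tf : 2 <= b -> b <= 3 ->
  halves (cen R (csite n)) (crad n m) (cycT n m b vf tf) (crad n m).
Proof.
move=> b2 b3; rewrite /cycT; apply: rad_halves => //.
- exact: kk_gt0.
- exact: cphi_nb.
- exact: cphi_pos.
- exact: cphi_site.
- exact: cwp_bd.
- exact: cwn_bd.
- exact: kapf_gt0.
- exact: kapf_le.
- exact: kk_ge0.
Qed.

(** Made total by a default value, so that [tau] is a function on all of [R]; [homS_spec] gives it
    its meaning for [b] between 2 and 3. *)
Definition homS (b : R) : unknown idx -> R := xget (fun=> 0)
  [set u | [/\ hbox u, forall j, `|u j| <= hrad j / 2 & forall j, homT b 1 None None u j = u j]].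
Definition tau b := homS b Ut.

(** [t] is frozen on the tangency curve while [v] adapts to the prescribed eigenvalue; the value
    equation at the fold is the only one left open. *)
Definition cycS n m (b : R) : unknown idx -> R := xget (fun=> 0)
  [set u | [/\ cbox n m u, forall j, `|u j - cen R (csite n) j| <= crad n m j / 2
             & forall j, cycT n m b None (Some (tau b)) u j = u j]].

(* Vanishes exactly when the shadowing orbit closes up at the parameters [(b, tau b)]. *)
Definition defect n m (b : R) := resG (false, 0%N) (true, 0%N) (kapf b) b kk (cycS n m b).

Lemma homS_spec b : 2 <= b -> b <= 3 ->
  [/\ hbox (homS b), forall j, `|homS b j| <= hrad j / 2 &
      forall j, homT b 1 None None (homS b) j = homS b j].
Proof.
move=> b2 b3.
have z2 j : `|odflt 0 None : R| <= hrad j / 2.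
  by rewrite /= normr0 divr_ge0 // (rad_ge0 (kk_gt0 R) hphi j).
have [u hu] := @hom_solution b 1 None None b2 b3 ltac:(by rewrite normr1; lra) (z2 Uv) (z2 Ut).
rewrite /homS; set S := [set u | _].
by have : S (xget (fun=> 0) S) by apply: xgetPex; exists u.
Qed.

Lemma cycS_spec n m b : (0 < n)%N -> 2 <= b -> b <= 3 ->
  [/\ cbox n m (cycS n m b), forall j, `|cycS n m b j - cen R (csite n) j| <= crad n m j / 2 &
      forall j, cycT n m b None (Some (tau b)) (cycS n m b) j = cycS n m b j].
Proof.
move=> n0 b2 b3; have [_ ht _] := homS_spec b2 b3.
have [u hu] := @cyc_solution n m b (Some (tau b)) n0 b2 b3 (ht Ut).
rewrite /cycS; set S := [set u | _].
by have : S (xget (fun=> 0) S) by apply: xgetPex; exists u.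
Qed.

Lemma box_diam (J : Type) (c r : J -> R) (u u' : J -> R) : box c r u -> box c r u' ->
  forall j, `|u j - u' j| <= 2 * r j.
Proof.
move=> h h' j; have -> : u j - u' j = (u j - c j) - (u' j - c j) by ring.
by apply: le_trans (ler_normB _ _) _; have := h j; have := h' j; lra.
Qed.

Lemma homS_lipschitz b b' : 2 <= b -> b <= 3 -> 2 <= b' -> b' <= 3 ->
  forall j, `|homS b j - homS b' j| <= 2 * `|b - b'| * hrad j.
Proof.
move=> b2 b3 b2' b3'; have [bu hu fu] := homS_spec b2 b3; have [bu' hu' fu'] := homS_spec b2' b3'.
have n1 : `|1 : R| <= 2 by rewrite normr1; lra.
apply: (box_stable (T := homT b 1 None None) (D0 := 2) (hom_halves _ _ b2 b3 n1)) => //.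
- by move=> j; apply: rad_ge0 (kk_gt0 R) _ _.
- exact: box_diam.
- move=> j; rewrite -[X in _ - X]fu'.
  apply: (sysT_param (kk_gt0 R) (kk_small R) hphi_nb hphi_pos) => //.
  + exact: kk_ge0.
  + exact: kapf_gt0.
  + exact: kapf_le.
  + exact: kapf_lipschitz.
Qed.

Lemma cycS_lipschitz n m b b' : (0 < n)%N -> 2 <= b -> b <= 3 -> 2 <= b' -> b' <= 3 ->
  forall j, `|cycS n m b j - cycS n m b' j| <= 4 * `|b - b'| * crad n m j.
Proof.
move=> n0 b2 b3 b2' b3'.
have [bu hu fu] := cycS_spec m n0 b2 b3; have [bu' hu' fu'] := cycS_spec m n0 b2' b3'.
have s0 : csite n (true, 0%N) = false by rewrite /csite /=; apply/eqP => h; rewrite -h in n0.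
move=> j; have -> : 4 * `|b - b'| = 2 * (2 * `|b - b'|) by ring.
apply: (box_stable (T := cycT n m b None (Some (tau b))) (D0 := 2) (cyc_halves _ _ b2 b3)) => //.
- by move=> i; apply: rad_ge0 (kk_gt0 R) _ _.
- exact: box_diam.
- move=> i; rewrite -[X in _ - X]fu'.
  have r0 := rad_ge0 (kk_gt0 R) (cphi n m) i.
  have h : `|cycT n m b None (Some (tau b)) (cycS n m b') i
      - cycT n m b' None (Some (tau b)) (cycS n m b') i| <= `|b - b'| * crad n m i.
    apply: (sysT_param (kk_gt0 R) (kk_small R) (@cphi_nb n m) (@cphi_pos n m) (@cphi_site n m)) => //.
    + exact: cwp_bd.
    + exact: cwn_bd.
    + exact: kk_ge0.
    + exact: kapf_gt0.
    + exact: kapf_le.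
    + exact: kapf_lipschitz.
  case: i r0 h => [i|i||] r0 h; try by apply: le_trans h _;
     apply: ler_wpM2r => //; rewrite ler_peMl //; lra.
  (* The coordinate [Ut] of the operator is the constant [tau b], so its change with [b] is that of
     [tau]. *)
  exact: (homS_lipschitz b2 b3 b2' b3' Ut).
Qed.

(** The defect is the [Ut] coordinate of the unfrozen operator minus [Ut] itself. Contraction
    contributes 2, the change of parameter 1 and [Ut] 4, which makes 7. *)
Lemma defect_lipschitz n m b b' : (0 < n)%N -> 2 <= b -> b <= 3 -> 2 <= b' -> b' <= 3 ->
  `|defect n m b - defect n m b'| <= 7 * `|b - b'| * crad n m Ut.
Proof.
move=> n0 b2 b3 b2' b3'.
have [bu hu fu] := cycS_spec m n0 b2 b3; have [bu' hu' fu'] := cycS_spec m n0 b2' b3'.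
have s0 : csite n (true, 0%N) = false by rewrite /csite /=; apply/eqP => h; rewrite -h in n0.
have h1 := cycS_lipschitz m n0 b2 b3 b2' b3'.
have q0 : 0 <= 4 * `|b - b'| by rewrite mulr_ge0.
have h2 := cyc_halves None None b2 b3 q0 bu bu' h1 Ut.
have h3 : `|cycT n m b None None (cycS n m b') Ut
      - cycT n m b' None None (cycS n m b') Ut| <= `|b - b'| * crad n m Ut.
  apply: (sysT_param (kk_gt0 R) (kk_small R) (@cphi_nb n m) (@cphi_pos n m) (@cphi_site n m)) => //.
  + exact: cwp_bd.
  + exact: cwn_bd.
  + exact: kk_ge0.
  + exact: kapf_gt0.
  + exact: kapf_le.
  + exact: kapf_lipschitz.
have -> : defect n m b - defect n m b' =
  ((cycT n m b None None (cycS n m b) Ut - cycT n m b None None (cycS n m b') Ut)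
  + (cycT n m b None None (cycS n m b') Ut - cycT n m b' None None (cycS n m b') Ut))
  - (cycS n m b Ut - cycS n m b' Ut).
  by rewrite /cycT /sysT /defect; ring.
have := ler_normB ((cycT n m b None None (cycS n m b) Ut - cycT n m b None None (cycS n m b') Ut)
  + (cycT n m b None None (cycS n m b') Ut - cycT n m b' None None (cycS n m b') Ut))
  (cycS n m b Ut - cycS n m b' Ut).
have := ler_normD (cycT n m b None None (cycS n m b) Ut - cycT n m b None None (cycS n m b') Ut)
  (cycT n m b None None (cycS n m b') Ut - cycT n m b' None None (cycS n m b') Ut).
have := h1 Ut; move: h2 h3; lra.
Qed.

End Tangency.

Lemma subn_predS n j : (j.+1 < n)%N -> (n.-1 - j = (n.-1 - j.+1).+1)%N.
Proof. lia. Qed.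

Lemma subn_pred_eq0 n j : (n <= j.+1)%N -> (n.-1 - j = 0)%N.
Proof. lia. Qed.

(** * The cycle against the homoclinic orbit, and the quadratic error at the fold *)

Section Comparison.
Variable R : realType.
Local Notation kk := (kk R).
Local Notation theta := (50 * kk).
Local Notation hbox := (box (cen R (fun _ : idx => false)) (rad kk hphi)).
Local Notation hrad := (rad kk hphi).
Local Notation cbox n m := (box (cen R (csite n)) (rad kk (cphi n m))).
Local Notation crad n m := (rad kk (cphi n m)).
Local Notation flat := (fun _ : idx => 0%N).
Local Notation frad := (rad kk flat).

Lemma theta_gt0 : 0 < theta. Proof. by have := kk_gt0 R; lra. Qed.
Lemma theta_le1 : theta <= 1. Proof. by have := kk_small R; lra. Qed.

Lemma rad_le_flat phi j : rad kk phi j <= frad j.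
Proof.
have k0 : 0 <= 100 * kk by have := kk_gt0 R; lra.
by case: j => [i|i||] //=; rewrite expr0 mulr1 ler_piMr //; apply: theta_pow_le1;
  rewrite ?kk_gt0 ?kk_small.
Qed.

Lemma frad_small j : frad j <= 100 * kk.
Proof.
have k0 := kk_gt0 R; have k2 := k2_le (kk_gt0 R) (kk_small R).
case: j => [i|i||] /=; rewrite ?expr0 ?mulr1 //; lra.
Qed.

Lemma hnb_le i j : nb hpr hnx i j -> (j.2 <= i.2.+1)%N.
Proof. by case: i => [[] [|i]] [] //= -[<-] /=; lia. Qed.

(** A competitor that satisfies the homoclinic system near the fold, with its residual concentrated
    where the two orbits are joined. *)
Definition splice N (u u' : unknown idx -> R) (j : unknown idx) : R :=
  match j with
  | UY i => if (i.2 < N)%N then u' (UY i) else u (UY i)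
  | UD i => if (i.2 < N)%N then u' (UD i) else u (UD i)
  | Uv => u' Uv
  | Ut => u' Ut
  end.

Lemma splice_aux n m j : (j.+1 < minn n m)%N -> (j.-1 < minn n m)%N /\
  [/\ (j.+1 < minn n m)%N = true, (j < minn n m)%N = true, (j.+1 == m) = false & (j == n) = false].
Proof. by move=> h; split; [lia|split; lia]. Qed.

Lemma splice_nbY_pr n m u u' s j : (j.+1 < minn n m)%N ->
  nbY (splice (minn n m) u u') (hpr (s, j)) = nbY u' (cpr n m (s, j)).
Proof.
move=> h; have [h0 [h1 h2 h3 h4]] := splice_aux h.
by case: s; case: j h h0 h1 h2 h3 h4 => [|j] h h0 h1 h2 h3 h4;
  rewrite /nbY /hpr /cpr /= ?h1 ?h2 ?h3 ?h4 //= ?h0 ?h1.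
Qed.

Lemma splice_nbY_nx n m u u' s j : (j.+1 < minn n m)%N ->
  nbY (splice (minn n m) u u') (hnx (s, j)) = nbY u' (cnx n m (s, j)).
Proof.
move=> h; have [h0 [h1 h2 h3 h4]] := splice_aux h.
by case: s; case: j h h0 h1 h2 h3 h4 => [|j] h h0 h1 h2 h3 h4;
  rewrite /nbY /hnx /cnx /= ?h1 ?h2 ?h3 ?h4 //= ?h0 ?h1.
Qed.

Lemma splice_nbD_pr n m u u' s j : (j.+1 < minn n m)%N ->
  nbD (splice (minn n m) u u') (hpr (s, j)) = nbD u' (cpr n m (s, j)).
Proof.
move=> h; have [h0 [h1 h2 h3 h4]] := splice_aux h.
by case: s; case: j h h0 h1 h2 h3 h4 => [|j] h h0 h1 h2 h3 h4;
  rewrite /nbD /hpr /cpr /= ?h1 ?h2 ?h3 ?h4 //= ?h0 ?h1.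
Qed.

Lemma splice_nbD_nx n m u u' s j : (j.+1 < minn n m)%N ->
  nbD (splice (minn n m) u u') (hnx (s, j)) = nbD u' (cnx n m (s, j)).
Proof.
move=> h; have [h0 [h1 h2 h3 h4]] := splice_aux h.
by case: s; case: j h h0 h1 h2 h3 h4 => [|j] h h0 h1 h2 h3 h4;
  rewrite /nbD /hnx /cnx /= ?h1 ?h2 ?h3 ?h4 //= ?h0 ?h1.
Qed.

(** The splice solves the homoclinic system except about [N] steps away from the fold. With weights
    growing by [1 / theta] per step away from the fold, that bounded residual becomes an error of
    order [theta ^+ N.-1] at the fold. *)
Lemma fold_shift n m b : (0 < n)%N -> (0 < m)%N -> 2 <= b -> b <= 3 ->
  `|homS b Uv - cycS n m b Uv| <= 2 * (200 * kk) * theta ^+ (minn n m).-1.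
Proof.
move=> n0 m0 b2 b3; have k0 := kk_gt0 R; have ks := kk_small R.
have [bu hu fu] := homS_spec b2 b3; have [bu' hu' fu'] := cycS_spec m n0 b2 b3.
set u := homS b in bu hu fu *; set u' := cycS n m b in bu' hu' fu' *.
set N := minn n m; have N0 : (0 < N)%N by rewrite /N; lia.
have [Nn Nm] : (N <= n)%N /\ (N <= m)%N by rewrite /N; split; lia.
have th0 := theta_gt0; have th1 := theta_le1.
(* This growth is the fastest that [sysT_halves] admits. *)
pose w (i : idx) : R := theta ^+ (N.-1 - i.2).
have w0 i : 0 < w i by rewrite exprn_gt0.
have w1 i : w i <= 1 by apply: theta_pow_le1.
pose rho := weight w (theta ^+ N.-1) 0.
pose T := homT b 1 None (Some (tau b)).
have n1 : `|1 : R| <= 2 by rewrite normr1; lra.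
(* Radii without decay: the cycle comes back to size [100 * kk] at the far end of a passage, where
   the homoclinic radii are already tiny. *)
have fb : box (cen R (fun=> false)) frad u.
  by move=> j; apply: le_trans (bu j) (rad_le_flat _ _).
have ut' : u' Ut = tau b by rewrite -fu'.
pose u2 := splice N u u'.
have fb2 : box (cen R (fun=> false)) frad u2.
  case=> [[s j]|[s j]||]; rewrite /u2 /splice /=.
  - case: ifP => hj; last exact: (fb (UY (s, j))).
    apply: le_trans (rad_le_flat (cphi n m) (UY (s, j))).
    have := bu' (UY (s, j)); rewrite /= /csite /=.
    by rewrite (_ : (j == n) = false) ?andbF //; apply/eqP; lia.
  - case: ifP => hj; last exact: (fb (UD (s, j))).
    exact: le_trans (bu' (UD (s, j))) (rad_le_flat (cphi n m) (UD (s, j))).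
  - exact: (bu' Uv).
  - exact: (bu' Ut).
have Th : halves (cen R (fun=> false)) frad T rho.
  apply: sysT_halves => //.
  - exact: kapf_gt0.
  - exact: kapf_le.
  - exact: kk_ge0.
  - by move=> i; apply/ltW/w0.
  - by apply/ltW/exprn_gt0.
  - move=> [s i] [s' j] h; rewrite /w /= -exprSr; apply: ler_wiXn2l => //; first exact: ltW.
    by have := hnb_le h; rewrite /=; lia.
  - move=> [s i] h; have -> : i = 0%N by case: s h => -[]; case: i.
    rewrite /w /= subn0; have := exprn_gt0 N.-1 th0; nra.
  - by move=> i; rewrite mulr0; apply/ltW/w0.
  - by move=> _; rewrite /w /= subn0 mulr0; have := exprn_gt0 N.-1 th0; nra.
have Tu j : T u j = u j.
  by case: j => [i|i||] //; [exact: (fu (UY i))|exact: (fu (UD i))|exact: (fu Uv)].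
have Tb j : `|T u2 j - cen R (fun=> false) j| <= frad j / 2.
  apply: sysT_half => //.
  - exact: kapf_gt0.
  - exact: kapf_le.
  - exact: kk_ge0.
  - by rewrite /= normr0 divr_ge0 // (rad_ge0 (kk_gt0 R) flat Uv).
  - exact: (hu Ut).
have rho0 j : 0 <= rho j.
  by case: j => [i|i||] //=; [exact: ltW|exact: ltW|exact/ltW/exprn_gt0].
have res j : `|T u2 j - u2 j| <= 200 * kk * rho j.
  have far : `|T u2 j - u2 j| <= 200 * kk.
    have := Tb j; have := fb2 j; have := frad_small j; move: (T u2 j) (u2 j) (cen _ _ j) (frad j).
    move=> x y c r hr h1 h2; have -> : x - y = (x - c) - (y - c) by ring.
    by apply: le_trans (ler_normB _ _) _; lra.
  have near0 : T u2 j = u2 j -> `|T u2 j - u2 j| <= 200 * kk * rho j.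
    by move=> ->; rewrite subrr normr0 mulr_ge0 // mulr_ge0 // ltW.
  case: j far near0 => [[s j]|[s j]||] far near0.
  - have [hj|hj] := ltnP j.+1 N.
      apply: near0; rewrite /T /homT /sysT /resY splice_nbY_pr // splice_nbY_nx //.
      rewrite /u2 /splice /= (ltnW hj) /=; rewrite -[RHS]fu' /cycT /sysT /resY /csite /=.
      have [_ [_ _ _ ->]] := splice_aux hj.
      by rewrite andbF ut'.
    by rewrite /rho /= /w /= subn_pred_eq0 // expr0 mulr1.
  - have [hj|hj] := ltnP j.+1 N.
      apply: near0; rewrite /T /homT /sysT /resD splice_nbY_nx // splice_nbD_pr // splice_nbD_nx //.
      rewrite /u2 /splice /= (ltnW hj) /=; rewrite -[RHS]fu' /cycT /sysT /resD /cwp /cwn /csite /=.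
      have [_ [_ _ -> ->]] := splice_aux hj.
      by rewrite !andbF ut'.
    by rewrite /rho /= /w /= subn_pred_eq0 // expr0 mulr1.
  - by apply: near0; rewrite /T /homT /sysT /u2 /splice /resH /= N0 /= -[RHS]fu'.
  - by apply: near0; rewrite /T /homT /sysT /u2 /splice /= ut'.
(* A crude a priori bound: [box_stable] accepts any finite [D0] and forgets it. *)
have dom j : `|u j - u2 j| <= (theta ^+ N.-1)^-1 * rho j.
  have d1 : `|u j - u2 j| <= 1.
    by have := box_diam fb fb2 j; have := frad_small j; lra.
  have p0 : 0 < theta ^+ N.-1 by rewrite exprn_gt0.
  have dw i : 1 <= (theta ^+ N.-1)^-1 * w i.
    rewrite mulrC ler_pdivlMr // mul1r /w; apply: ler_wiXn2l => //; [exact: ltW|exact: leq_subr].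
  case: j d1 => [i|i||] d1; rewrite /rho /=.
  - exact: le_trans d1 (dw i).
  - exact: le_trans d1 (dw i).
  - by rewrite mulVf // lt0r_neq0.
  - by rewrite /u2 /splice ut' subrr normr0 mulr0.
have := box_stable Th (e := 200 * kk) (D0 := (theta ^+ N.-1)^-1) _ _ fb fb2 rho0 Tu dom res Uv.
apply; first by rewrite mulr_ge0 // ltW.
by rewrite invr_ge0 ltW // exprn_gt0.
Qed.

(* At the tangency the value [resG] is critical with respect to the position [v] in the fold. *)
Lemma hom_remainder b v uf : 2 <= b -> b <= 3 -> `|v| <= hrad Uv / 2 -> hbox uf ->
  (forall j, homT b 0 (Some v) (Some (tau b)) uf j = uf j) ->
  `|resG (false, 0%N) (true, 0%N) (kapf b) b kk uf| <= 62 * (v - homS b Uv) ^+ 2.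
Proof.
move=> b2 b3 hv bf ff; have k0 := kk_gt0 R; have ks := kk_small R; have kg := kk_ge0 R.
have [bu hu fu] := homS_spec b2 b3; set u := homS b in bu hu fu *.
have [rY rD rH rG] := sysT_fixed fu.
have kp0 := kapf_gt0 b2 b3; have kp1 := kapf_le b2 b3.
set d := v - u Uv.
have rv0 : hrad Uv <= 4^-1.
  by apply: le_trans (rad_le_flat hphi Uv) _; have := frad_small Uv; lra.
have hd : `|d| <= 4^-1.
  by apply: le_trans (ler_normB _ _) _; have := hu Uv; lra.
have d20 : 0 <= d ^+ 2 by apply: sqr_ge0.
(* First-order guess: the homoclinic solution moved along its tangent vector by the displacement [d]
   of the fold point. *)
pose us (j : unknown idx) : R := match j with
  | UY i => u (UY i) + u (UD i) * d | UD i => 0 | Uv => v | Ut => u Ut end.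
have bs : hbox us.
  case=> [i|i||]; rewrite /us /=.
  - rewrite /sitev subr0; have := norm_mul_le (box_D bu i) hd => /= h1.
    apply: le_trans (ler_normD _ _) _; have := hu (UY i); have := rad_ge0 (kk_gt0 R) hphi (UY i).
    by move: h1; rewrite /=; lra.
  - by rewrite subrr normr0; apply: (rad_ge0 (kk_gt0 R) hphi (UY i)).
  - by rewrite subr0; apply: le_trans hv _; have := rad_ge0 (kk_gt0 R) hphi Uv; rewrite /=; lra.
  - exact: bu Ut.
have nbs o : nbY us o = nbY u o + nbD u o * d.
  by case: o => //=; rewrite /us mul1r /d; ring.
have t1 : `|u Ut| <= 1 by apply: le_trans (box_t k0 ks bu) _; lra.
have Y3 x i : hbox x -> `|x (UY i)| <= 3.
  by move=> hx; apply: le_trans (box_Y3 k0 ks hx i) _; lra.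
have psiT o : `|psi b kk (nbY us o) - psi b kk (nbY u o) - dpsi b kk (nbY u o) * (nbD u o * d)|
    <= 10^-1 ^+ 2 * (`|nbD u o| * d ^+ 2).
  have h := psi_taylor kg ks b2 b3 (box_nbY3 k0 ks bs o) (box_nbY3 k0 ks bu o).
  have e1 : nbY us o - nbY u o = nbD u o * d by rewrite nbs; ring.
  rewrite e1 in h; apply: le_trans h _; apply: ler_wpM2l; first by rewrite exprn_ge0 //; lra.
  rewrite exprMn; apply: ler_wpM2r => //.
  rewrite -real_normK ?num_real //; have := box_nbD k0 ks bu o; have := normr_ge0 (nbD u o); nra.
have BT x y : `|x| <= 3 -> `|y| <= 3 -> `|Bp (u Ut) x - Bp (u Ut) y - dBp (u Ut) y * (x - y)|
   <= 60 * (x - y) ^+ 2 by exact: Bp_taylor.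
(* [resY] and [resD] vanish at [u], so only second-order Taylor terms remain in the residual of the
   guess. *)
have Ts j : `|homT b 0 (Some v) (Some (tau b)) us j - us j| <= d ^+ 2 * hrad j.
  case: j => [i|i||].
  - have -> : homT b 0 (Some v) (Some (tau b)) us (UY i) - us (UY i) =
      - ((Bp (u Ut) (us (UY i)) - Bp (u Ut) (u (UY i)) - dBp (u Ut) (u (UY i)) * (us (UY i) - u (UY i)))
       + kapf b * (psi b kk (nbY us (hnx i)) - psi b kk (nbY u (hnx i))
           - dpsi b kk (nbY u (hnx i)) * (nbD u (hnx i) * d))
       + (resY hpr hnx (kapf b) b kk u i + d * resD hpr hnx (fun=> 1) (fun=> 1) (kapf b) b kk u i)).
      rewrite /homT /sysT /resY /resD /islope !nbs /us; ring.
    rewrite rY rD mulr0 !addr0 normrN.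
    have h1 := BT _ _ (Y3 us i bs) (Y3 u i bu).
    have e1 : us (UY i) - u (UY i) = u (UD i) * d by rewrite /us; ring.
    rewrite e1 in h1 *; have h2 := norm_mul_le (lexx `|kapf b|) (psiT (hnx i)).
    rewrite (gtr0_norm kp0) in h2.
    have r0 : 0 <= hrad (UY i) := rad_ge0 k0 hphi (UY i).
    have h3 : 60 * (u (UD i) * d) ^+ 2 <= d ^+ 2 * (hrad (UY i) / 2).
      have q1 := box_D bu i; have q2 := box_D100 k0 ks bu i.
      have : u (UD i) ^+ 2 <= hrad (UY i) * (100 * kk).
        by rewrite -real_normK ?num_real // expr2; apply: ler_pM.
      rewrite exprMn; nra.
    have h4 : kapf b * `|nbD u (hnx i)| <= hrad (UY i).
      have [p0|p0] := posnP (hphi i).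
        have e0 : hrad (UY i) = 100 * kk by rewrite /= p0 expr0 mulr1.
        rewrite e0; have := box_nbD k0 ks bu (hnx i).
        have := normr_ge0 (nbD u (hnx i)); nra.
      have := box_nbD_pos k0 ks hphi_nb hphi_pos bu p0 (or_intror erefl).
      have := normr_ge0 (nbD u (hnx i)); nra.
    apply: le_trans (ler_normD _ _) _.
    have h5 : kapf b * (10^-1 ^+ 2 * (`|nbD u (hnx i)| * d ^+ 2)) <= d ^+ 2 * (hrad (UY i) / 2).
      have := ler_wpM2r d20 h4; have := mulr_ge0 r0 d20; lra.
    by move: h1 h2 h3 h5; lra.
  - have -> : homT b 0 (Some v) (Some (tau b)) us (UD i) - us (UD i) = 0.
      rewrite /homT /sysT /resD /us /=; ring.
    by rewrite normr0 mulr_ge0 //; apply: (rad_ge0 (kk_gt0 R) hphi (UY i)).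
  - by rewrite /= /us subrr normr0 mulr_ge0 //; apply: (rad_ge0 (kk_gt0 R) hphi Uv).
  - by rewrite /= /us /tau subrr normr0 mulr_ge0 //; apply: (rad_ge0 (kk_gt0 R) hphi Ut).
have z2 : `|0 : R| <= 2 by rewrite normr0; lra.
have near j : `|uf j - us j| <= 2 * d ^+ 2 * hrad j.
  apply: (box_stable (hom_halves (Some v) (Some (tau b)) b2 b3 z2) (D0 := 2)) => //.
  - by move=> i; apply: rad_ge0.
  - exact: box_diam.
have fv : uf Uv = v by rewrite -ff.
have ft : uf Ut = u Ut by rewrite -ff.
have hYn i : hrad (UY i) <= 100 * kk by apply: rad_le100k.
pose L0 : idx := (false, 0%N); pose R0 : idx := (true, 0%N).
have p1 : `|psi b kk (uf (UY R0)) - psi b kk (us (UY R0))| <= 640 * kk * d ^+ 2.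
  have := psi_lipschitz4 kg ks b2 b3 (Y3 uf R0 bf) (Y3 us R0 bs).
  have := near (UY R0); have := ler_wpM2l d20 (hYn R0); lra.
have p2 : `|uf (UY L0) - us (UY L0)| <= 200 * kk * d ^+ 2.
  by have := near (UY L0); have := ler_wpM2l d20 (hYn L0); lra.
have e1 : (2 + v) - (2 + u Uv) = d by rewrite /d; ring.
have u3 : `|2 + u Uv| <= 3 := box_nbY3 k0 ks bu None.
have v3 : `|2 + v| <= 3 := box_nbY3 k0 ks bs None.
have h1 := BT _ _ v3 u3; rewrite e1 in h1.
have h2 := psiT (Some R0); have q1 : `|nbD u (Some R0)| <= 1 := box_nbD k0 ks bu (Some R0).
(* The value is split into quadratic remainders and [resG u + d * resH u]; the second factor
   vanishing is the tangency. *)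
rewrite /resG fv ft; have -> : Bp (u Ut) (2 + v) - kapf b * (uf (UY L0) - psi b kk (uf (UY R0))) =
  (Bp (u Ut) (2 + v) - Bp (u Ut) (2 + u Uv) - dBp (u Ut) (2 + u Uv) * d)
  - kapf b * ((uf (UY L0) - us (UY L0)) - (psi b kk (uf (UY R0)) - psi b kk (us (UY R0)))
     - (psi b kk (nbY us (Some R0)) - psi b kk (nbY u (Some R0))
           - dpsi b kk (nbY u (Some R0)) * (nbD u (Some R0) * d)))
  + (resG L0 R0 (kapf b) b kk u + d * resH L0 R0 (kapf b) b kk u).
  rewrite /resG /resH /nbY /nbD /us; ring.
rewrite rG rH mulr0 !addr0.
have h3 : 10^-1 ^+ 2 * (`|nbD u (Some R0)| * d ^+ 2) <= d ^+ 2 / 100.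
  by have := ler_wpM2r d20 q1; lra.
set A := (uf (UY L0) - us (UY L0)) - _; set B := _ - _ - _ * (nbD _ _ * d).
have hAB : `|A - B| <= d ^+ 2.
  have : `|A| <= 840 * kk * d ^+ 2 by apply: le_trans (ler_normB _ _) _; lra.
  have := ler_wpM2r d20 ks; have := le_trans h2 h3; rewrite -/B.
  have := ler_normB A B; lra.
have h4 := norm_mul_le (lexx `|kapf b|) hAB; rewrite (gtr0_norm kp0) in h4.
apply: le_trans (ler_normB _ _) _.
have : kapf b * d ^+ 2 <= d ^+ 2 by apply: ler_piMl => //; lra.
move: h1 h4; lra.
Qed.

End Comparison.

(** * Propagation of the site 1 through the two passages near the saddle *)

Section SignOfDefect.
Variable R : realType.
Local Notation kk := (kk R).
Local Notation zeta := (zeta R).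
Local Notation theta := (50 * kk).
Local Notation hbox := (box (cen R (fun _ : idx => false)) (rad kk hphi)).
Local Notation hrad := (rad kk hphi).
Local Notation cbox n m := (box (cen R (csite n)) (rad kk (cphi n m))).
Local Notation crad n m := (rad kk (cphi n m)).

(** Bound for the deviation of the slopes from those at the saddle, after [j] of [n] steps; both
    ends of the passage contribute. The divisor 33 gives both the bound 1/16 and the sum 1/4
    required by [far_end_response]. *)
Definition tol n j : R := (theta ^+ j + theta ^+ (n.-1 - j)) / 33.

Lemma theta_pow_gt0 j : 0 < theta ^+ j.
Proof. by rewrite exprn_gt0 // theta_gt0. Qed.

Lemma theta_powS_le j : theta * theta ^+ j <= theta ^+ j / 10 ^+ 3.
Proof. by have := theta_pow_gt0 j; have := kk_small R; nra. Qed.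

Lemma tol_le n j : 0 <= tol n j <= 16^-1.
Proof.
have h1 := theta_pow_gt0 j; have h2 := theta_pow_gt0 (n.-1 - j).
have h3 := theta_pow_le1 (kk_gt0 R) (kk_small R) j.
have h4 := theta_pow_le1 (kk_gt0 R) (kk_small R) (n.-1 - j).
rewrite /tol; lra.
Qed.

Lemma tol_sum n : \sum_(j < n) 4 * tol n j <= 4^-1.
Proof.
have geo p : \sum_(j < p) theta ^+ j <= 501 / 500 - 501 / 500 * theta ^+ p.
  elim: p => [|p IH]; first by rewrite big_ord0 expr0; lra.
  rewrite big_ord_recr /= exprS; have := theta_powS_le p; have := theta_pow_gt0 p; lra.
have rv : \sum_(j < n) theta ^+ (n.-1 - j) = \sum_(j < n) theta ^+ j.
  rewrite (reindex_inj rev_ord_inj) /=; apply: eq_bigr => i _; congr (_ ^+ _).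
  by have := ltn_ord i; lia.
rewrite -mulr_sumr -mulr_suml big_split /= rv.
have := geo n; have := theta_pow_gt0 n; lra.
Qed.

Lemma tolS n j : (j.+1 < n)%N -> theta * tol n j <= tol n j.+1.
Proof.
move=> hj; rewrite /tol exprS (subn_predS hj).
rewrite exprS; have := theta_powS_le (n.-1 - j.+1).
have := theta_pow_gt0 (n.-1 - j.+1); have := ltW (theta_gt0 R).
have := theta_le1 R => h1 h2 h3 h4; nra.
Qed.

Lemma Bp_slope (t x y : R) : `|t| <= 1 -> `|x| <= 3 -> `|y| <= 3 ->
  exists2 a, `|a - 1| <= 120 * (`|x| + `|y|) & Bp t x - Bp t y = a * (x - y).
Proof.
move=> ht hx hy; have [->|xy] := eqVneq x y.
  by exists 1; rewrite ?subrr ?normr0 ?mulr0 // mulr_ge0 // addr_ge0.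
have xy0 : x - y != 0 by rewrite subr_eq0.
exists ((Bp t x - Bp t y) / (x - y)); last by rewrite divfK.
have z3 : `|0 : R| <= 3 by rewrite normr0; lra.
have h1 := Bp_taylor ht hx hy; have h2 := dBp_lipschitz ht hy z3.
have d0 : dBp t 0 = 1 by rewrite /dBp; field.
rewrite d0 subr0 in h2.
have -> : (Bp t x - Bp t y) / (x - y) - 1 =
  ((Bp t x - Bp t y - dBp t y * (x - y)) + (dBp t y - 1) * (x - y)) / (x - y) by field.
rewrite normrM normfV ler_pdivrMr ?normr_gt0 //.
have h3 := norm_mul_le h2 (lexx `|x - y|).
have h4 : (x - y) ^+ 2 <= (`|x| + `|y|) * `|x - y|.
  rewrite -real_normK ?num_real // expr2; apply: ler_wpM2r => //; exact: ler_normB.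
apply: le_trans (ler_normD _ _) _.
have := mulr_ge0 (normr_ge0 x) (normr_ge0 (x - y)).
have := mulr_ge0 (normr_ge0 y) (normr_ge0 (x - y)); lra.
Qed.

Lemma psi_slope (b x y : R) : 2 <= b -> b <= 3 -> `|x| <= 3 -> `|y| <= 3 ->
  exists2 s, `|s - b| <= (`|x| + 2 * `|y|) / 100 & psi b kk x - psi b kk y = s * (x - y).
Proof.
move=> b2 b3 hx hy; have kg := kk_ge0 R; have ks := kk_small R.
have [->|xy] := eqVneq x y.
  by exists b; rewrite ?subrr ?normr0 ?mulr0 // divr_ge0 // addr_ge0 // mulr_ge0.
have xy0 : x - y != 0 by rewrite subr_eq0.
exists ((psi b kk x - psi b kk y) / (x - y)); last by rewrite divfK.
have h1 := psi_taylor kg ks b2 b3 hx hy; have h2 := dpsi_bound kg ks b2 b3 hy.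
have -> : (psi b kk x - psi b kk y) / (x - y) - b =
  ((psi b kk x - psi b kk y - dpsi b kk y * (x - y)) + (dpsi b kk y - b) * (x - y)) / (x - y) by field.
rewrite normrM normfV ler_pdivrMr ?normr_gt0 //.
have h3 := norm_mul_le h2 (lexx `|x - y|).
have h4 : (x - y) ^+ 2 <= (`|x| + `|y|) * `|x - y|.
  rewrite -real_normK ?num_real // expr2; apply: ler_wpM2r => //; exact: ler_normB.
apply: le_trans (ler_normD _ _) _.
have := mulr_ge0 (normr_ge0 x) (normr_ge0 (x - y)).
have := mulr_ge0 (normr_ge0 y) (normr_ge0 (x - y)); lra.
Qed.

Variables (n m : nat) (b : R) (u' uf : unknown idx -> R).
Hypothesis n_gt0 : (0 < n)%N.
Hypothesis m_gt0 : (0 < m)%N.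
Hypothesis b2 : 2 <= b.
Hypothesis b3 : b <= 3.
Hypothesis bu' : cbox n m u'.
Hypothesis bf : hbox uf.
Hypothesis rc : forall i, resY (cpr n m) (cnx n m) (kapf b) b kk u' i = 0.
Hypothesis rf : forall i, resY hpr hnx (kapf b) b kk uf i = 0.
Hypothesis same_v : u' Uv = uf Uv.
Hypothesis same_t : u' Ut = uf Ut.

Lemma zone_hom i : `|uf (UY i)| <= 2 * (theta * theta ^+ i.2).
Proof. by have := bf (UY i); rewrite /= /sitev subr0 /hphi; lra. Qed.

Lemma zone_cyc s j : (j < if s then n else m)%N ->
  `|u' (UY (s, j))| <= 2 * (theta * theta ^+ j)
      + 2 * (theta * theta ^+ ((if s then n else m).-1 - j)).
Proof.
move=> hj; have := bu' (UY (s, j)); rewrite /= /cphi /sitev /csite /=.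
have -> : s && (j == n) = false.
  by case: s hj => //= hj; apply/eqP; lia.
rewrite /= subr0; set p := (_ - j)%N => h.
have := ltW (theta_pow_gt0 j); have := ltW (theta_pow_gt0 p); have := ltW (theta_gt0 R).
by move: h; rewrite /minn; case: ifP => _; nra.
Qed.

Lemma cyc3 i : `|u' (UY i)| <= 11 / 10.
Proof. by have := box_Y3 (kk_gt0 R) (kk_small R) bu' i. Qed.

Lemma hom3 i : `|uf (UY i)| <= 11 / 10.
Proof. by have := box_Y3 (kk_gt0 R) (kk_small R) bf i. Qed.

Lemma cyc_le3 i : `|u' (UY i)| <= 3. Proof. by apply: le_trans (cyc3 i) _; lra. Qed.
Lemma hom_le3 i : `|uf (UY i)| <= 3. Proof. by apply: le_trans (hom3 i) _; lra. Qed.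

(** With difference quotients in place of derivatives, the difference of the two orbits obeys an
    exactly linear recurrence, whose coefficients are close to those at the saddle. *)
Lemma step_slopes (i : idx) : exists a : R,
  (`|a - 1| <= 120 * (`|u' (UY i)| + `|uf (UY i)|)) /\
  a * (u' (UY i) - uf (UY i)) = kapf b * ((nbY u' (cpr n m i) - nbY uf (hpr i))
   - (psi b kk (nbY u' (cnx n m i)) - psi b kk (nbY uf (hnx i)))).
Proof.
have t1 : `|uf Ut| <= 1.
  by apply: le_trans (box_t (kk_gt0 R) (kk_small R) bf) _; lra.
have [a ha ea] := @Bp_slope (uf Ut) (u' (UY i)) (uf (UY i)) t1
   (cyc_le3 i) (hom_le3 i).
exists a; split => //; rewrite -ea; have := rc i; have := rf i; rewrite /resY same_t; lra.
Qed.

Lemma rs_small : kapf b * (b * zeta) <= 2 * kk ^+ 2.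
Proof.
have k0 := kk_gt0 R; have kp0 := kapf_gt0 b2 b3; have := b2 => b2'; have := b3 => b3'.
have z0 := zeta_gt0 R; have bz : b * zeta <= 3 * zeta by rewrite ler_wpM2r // ltW.
have bz0 : 0 <= b * zeta by rewrite mulr_ge0 ?ltW //; lra.
have := ler_pM (ltW kp0) bz0 (kapf_le b2 b3) bz; have := sqr_ge0 kk; rewrite /zeta; lra.
Qed.

Lemma tol_a s j a : (j < if s then n else m)%N ->
  `|a - 1| <= 120 * (`|u' (UY (s, j))| + `|uf (UY (s, j))|) ->
  `|a - 1| <= tol (if s then n else m) j.
Proof.
move=> hj h; apply: le_trans h _; have := zone_cyc hj; have := zone_hom (s, j); rewrite /tol /=.
set p := (_ - j)%N; have := theta_pow_gt0 j; have := theta_pow_gt0 p; have := kk_small R; nra.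
Qed.

Lemma tiny2 : kapf b * (b * zeta) <= theta / 10 ^+ 5.
Proof. by have := rs_small; have := k2_le (kk_gt0 R) (kk_small R); have := kk_gt0 R; lra. Qed.

Definition Dr j : R := u' (UY (true, j)) - uf (UY (true, j)).
(** At [j = m] the passage ends on the site 1, which the cycle stores at [(true, n)]. *)
Definition Dl j : R :=
  (if j == m then u' (UY (true, n)) else u' (UY (false, j))) - uf (UY (false, j)).

(** The orbits agree at the fold, so their difference in the past is driven by its far end alone,
    where the cycle is at the site 1. Each step towards the fold goes forward in time and
    contributes the contracting multiplier [- (b * zeta)]. *)
Lemma right_response : exists2 P : R, 1 / 2 <= P <= 2 & Dr 0 = P * (- (b * zeta)) ^+ n * Dr n.
Proof.
have k0 := kk_gt0 R; have ks := kk_small R; have b2' := b2; have b3' := b3.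
have kp0 := kapf_gt0 b2 b3; have z0 := zeta_gt0 R.
have [a [s has]] : exists a s : nat -> R, forall j, (j < n)%N ->
  [/\ `|a j - 1| <= tol n j, `|s j - b| <= 2 * tol n j &
   a j * Dr j = kapf b * ((if j is i.+1 then Dr i else 0) - s j * Dr j.+1)].
  have h j : exists as_ : R * R, (j < n)%N ->
    [/\ `|as_.1 - 1| <= tol n j, `|as_.2 - b| <= 2 * tol n j &
     as_.1 * Dr j = kapf b * ((if j is i.+1 then Dr i else 0) - as_.2 * Dr j.+1)].
    case: (ltnP j n) => hj; last by exists (0, 0).
    have [a [ha ea]] := step_slopes (true, j).
    have [s hs es] := @psi_slope b (u' (UY (true, j.+1))) (uf (UY (true, j.+1))) b2 b3
       (cyc_le3 _) (hom_le3 _).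
    exists (a, s) => _; split=> /=.
    - exact: (@tol_a true).
    - apply: le_trans hs _; have := zone_hom (true, j.+1); rewrite /= exprS => q1.
      have q2 := theta_powS_le j; have p0 := theta_pow_gt0 j.
      have q3 := theta_powS_le j.+1; rewrite exprS in q3.
      have [hj1|hj1] := ltnP j.+1 n.
        have := @zone_cyc true j.+1 hj1; rewrite /tol /=.
        rewrite (subn_predS hj1).
        have tq : 0 < theta * theta ^+ (n.-1 - j.+1) by rewrite -exprS theta_pow_gt0.
        rewrite !exprS; move: tq q1 q2 q3 p0; lra.
      have jn : j.+1 = n by apply/eqP; rewrite eqn_leq hj hj1.
      rewrite jn; have := cyc3 (true, n); rewrite /tol (subn_pred_eq0 hj1) expr0 -jn.
      by move: q1 q2 q3 p0; lra.
    - rewrite /Dr; move: ea; rewrite /cpr /hpr /cnx /hnx /=.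
      rewrite (ltn_eqF hj).
      rewrite /= es => ->; case: j {hj ha hs es} => [|j] //=; rewrite same_v; ring.
  exists (fun j => (projT1 (cid (h j))).1), (fun j => (projT1 (cid (h j))).2) => j hj.
  by case: (cid (h j)) => -[x y] /= /(_ hj).
have pz : 0 <= kapf b * (b * zeta).
  by apply: mulr_ge0; [exact: ltW | apply: mulr_ge0; [lra | exact: ltW]].
have nrs : `|kapf b * - (b * zeta)| = kapf b * (b * zeta).
  by rewrite mulrN normrN ger0_norm.
apply: (@far_end_response R a (fun=> kapf b) (fun j => - (kapf b * s j)) Dr (kapf b)
   (- (kapf b * b)) (- (b * zeta)) (tol n) n).
(* The characteristic equation of the recurrence is the relation that defines [kapf]. *)
- have E : zeta + kapf b * b * zeta ^+ 2 = kapf b by have := kapfE b2 b3; lra.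
  have -> : - (b * zeta) * (1 - kapf b * - (b * zeta)) = - (b * (zeta + kapf b * b * zeta ^+ 2)).
    by ring.
  by rewrite E; ring.
- by rewrite oppr_eq0 mulf_neq0 ?lt0r_neq0 //; lra.
- by move=> j _; apply: tol_le.
- by move=> j /has[].
- by move=> j _; rewrite subrr normr0 mulr_ge0 //; have /andP[] := tol_le n j.
- move=> j /has[_ h _]; have -> : - (kapf b * s j) - - (kapf b * b) = - (kapf b * (s j - b)) by ring.
  rewrite !normrN normrM [ `|kapf b * b|]normrM -mulrA; apply: ler_wpM2l => //.
  rewrite [ `|b|]ger0_norm; last by lra.
  by apply: le_trans h _; apply: ler_wpM2r => //; have /andP[] := tol_le n j.
- by rewrite nrs; have := tiny2; lra.
- move=> _; rewrite nrs /tol expr0; have := theta_pow_gt0 (n.-1 - 0); have := tiny2; lra.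
- move=> j hj; rewrite nrs; have := tolS hj; have /andP[h0 _] := tol_le n j.
  by have /andP[] := tol_le n j.+1; have := ler_wpM2r h0 tiny2; lra.
- by move=> /has[_ _ ->]; ring.
- by move=> j /has[_ _ ->]; ring.
- exact: tol_sum.
Qed.

(** In the future the difference grows by [1 / zeta] per step away from the fold, so read from the
    far end it carries [zeta ^+ m]. Compared with the past, the coefficients of the two neighbours
    are exchanged. *)
Lemma left_response : exists2 P : R, 1 / 2 <= P <= 2 & Dl 0 = P * zeta ^+ m * Dl m.
Proof.
have k0 := kk_gt0 R; have ks := kk_small R; have b2' := b2; have b3' := b3.
have kp0 := kapf_gt0 b2 b3; have z0 := zeta_gt0 R.
have [a [s has]] : exists a s : nat -> R, forall j, (j < m)%N ->
  [/\ `|a j - 1| <= tol m j, `|s j - b| <= 2 * tol m j &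
   a j * Dl j = kapf b * (Dl j.+1 - s j * (if j is i.+1 then Dl i else 0))].
  have h j : exists as_ : R * R, (j < m)%N ->
    [/\ `|as_.1 - 1| <= tol m j, `|as_.2 - b| <= 2 * tol m j &
     as_.1 * Dl j = kapf b * (Dl j.+1 - as_.2 * (if j is i.+1 then Dl i else 0))].
    case: (ltnP j m) => hj; last by exists (0, 0).
    have [a [ha ea]] := step_slopes (false, j).
    have [s hs es] := @psi_slope b (u' (UY (false, j.-1))) (uf (UY (false, j.-1))) b2 b3
       (cyc_le3 _) (hom_le3 _).
    exists (a, if j is 0%N then b else s) => _; split=> /=.
    - exact: (@tol_a false).
    - case: j hj {ha ea es} hs => [|j] hj /= hs.
        by rewrite subrr normr0 mulr_ge0 //; have /andP[] := tol_le m 0.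
      apply: le_trans hs _; have := zone_hom (false, j); rewrite /= => q1.
      have := @zone_cyc false j (ltnW hj); rewrite /tol /=.
      rewrite (subn_predS hj).
      rewrite !exprS; have := theta_pow_gt0 (m.-1 - j.+1); have := theta_powS_le (m.-1 - j.+1).
      have := theta_pow_gt0 j => p0 p1 p2 q2; have th := theta_gt0 R; have th1 := theta_le1 R.
      have : theta * (theta * theta ^+ (m.-1 - j.+1)) <= theta ^+ (m.-1 - j.+1) by nra.
      have : 0 <= theta * theta ^+ j by rewrite mulr_ge0 // ltW.
      lra.
    - rewrite {1}/Dl (ltn_eqF hj).
      rewrite ea; rewrite /cpr /hpr /cnx /hnx /=.
      have -> : nbY u' (if j.+1 == m then Some (true, n) else Some (false, j.+1)) -
         uf (UY (false, j.+1)) = Dl j.+1 by rewrite /Dl; case: ifP.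
      case: j hj {ha ea hs} es => [|j] hj /= es; first by rewrite same_v; ring.
      by rewrite es /Dl (ltn_eqF (ltnW hj)).
  exists (fun j => (projT1 (cid (h j))).1), (fun j => (projT1 (cid (h j))).2) => j hj.
  by case: (cid (h j)) => -[x y] /= /(_ hj).
have pz : 0 <= kapf b * (b * zeta).
  by apply: mulr_ge0; [exact: ltW | apply: mulr_ge0; [lra | exact: ltW]].
have nrs : `|- (kapf b * b) * zeta| = kapf b * (b * zeta).
  by rewrite mulNr normrN -mulrA ger0_norm.
apply: (@far_end_response R a (fun j => - (kapf b * s j)) (fun=> kapf b) Dl (- (kapf b * b))
   (kapf b) zeta (tol m) m).
- have E : zeta + kapf b * b * zeta ^+ 2 = kapf b by have := kapfE b2 b3; lra.
  by rewrite -[RHS]E; ring.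
- exact: lt0r_neq0.
- by move=> j _; apply: tol_le.
- by move=> j /has[].
- move=> j /has[_ h _]; have -> : - (kapf b * s j) - - (kapf b * b) = - (kapf b * (s j - b)) by ring.
  rewrite !normrN normrM [ `|kapf b * b|]normrM -mulrA; apply: ler_wpM2l => //.
  rewrite [ `|b|]ger0_norm; last by lra.
  by apply: le_trans h _; apply: ler_wpM2r => //; have /andP[] := tol_le m j.
- by move=> j _; rewrite subrr normr0 mulr_ge0 //; have /andP[] := tol_le m j.
- by rewrite nrs; have := tiny2; lra.
- move=> _; rewrite nrs /tol expr0; have := theta_pow_gt0 (m.-1 - 0); have := tiny2; lra.
- move=> j hj; rewrite nrs; have := tolS hj; have /andP[h0 _] := tol_le m j.
  by have /andP[] := tol_le m j.+1; have := ler_wpM2r h0 tiny2; lra.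
- by move=> /has[_ _ ->]; ring.
- by move=> j /has[_ _ ->]; ring.
- exact: tol_sum.
Qed.

End SignOfDefect.

(** * Main terms and remainder of the defect *)

Section Closing.
Variable R : realType.
Local Notation kk := (kk R).
Local Notation zeta := (zeta R).
Local Notation theta := (50 * kk).
Local Notation hbox := (box (cen R (fun _ : idx => false)) (rad kk hphi)).
Local Notation hrad := (rad kk hphi).
Local Notation cbox n m := (box (cen R (csite n)) (rad kk (cphi n m))).
Local Notation crad n m := (rad kk (cphi n m)).

(** The cycle is compared with a homoclinic solution [uf] having the same [v] and [t]. The
    difference of the two values is given by the responses of both branches; the value of [uf] is
    quadratic in the shift of the fold point. An even [n] makes the power of the negative multiplier
    positive. *)
Lemma defect_expansion n m (b : R) : (0 < n)%N -> (0 < m)%N -> ~~ odd n -> 2 <= b -> b <= 3 ->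
  exists P Q E : R, [/\ 2 / 5 <= P <= 3, 4 / 5 <= Q <= 8,
    `|E| <= 62 * (2 * (200 * kk) * theta ^+ (minn n m).-1) ^+ 2 &
    defect n m b = kapf b * (Q * (b * zeta) ^+ n - P * zeta ^+ m) + E].
Proof.
move=> n0 m0 odn b2 b3; have k0 := kk_gt0 R; have ks := kk_small R; have kg := kk_ge0 R.
have z0 := zeta_gt0 R.
have [bu' hu' fu'] := cycS_spec m n0 b2 b3; set u' := cycS n m b in bu' hu' fu' *.
have [rc _ _ t'] := sysT_fixed fu'; rewrite -/(cycT _ _ _) in rc.
have [bu hu fu] := homS_spec b2 b3.
have hv : `|odflt 0 (Some (u' Uv))| <= hrad Uv / 2.
  by have := hu' Uv; rewrite /= subr0.
have z2 : `|0 : R| <= 2 by rewrite normr0; lra.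
have [uf [bf hf ff]] := hom_solution (tf := Some (tau b)) b2 b3 z2 hv (hu Ut).
have [rf _ vf tf] := sysT_fixed ff.
have E1 := hom_remainder b2 b3 hv bf ff.
have same_t : u' Ut = uf Ut by rewrite tf t'.
have bp0 : 0 < b * zeta by apply: mulr_gt0 => //; lra.
have [P1 hP1 eP1] := right_response n0 m0 b2 b3 bu' bf rc rf (esym vf) same_t.
have [P2 hP2 eP2] := left_response n0 m0 b2 b3 bu' bf rc rf (esym vf) same_t.
pose L0 : idx := (false, 0%N); pose R0 : idx := (true, 0%N).
have [s hs es] := psi_slope b2 b3 (cyc_le3 bu' R0) (hom_le3 bf R0).
have n0' : (0%N == m) = false by rewrite eq_sym; apply: negbTE; rewrite -lt0n.
have hN : `|u' (UY (true, n)) - 1| <= 100 * kk.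
  apply: le_trans (rad_le100k k0 ks (cphi n m) (true, n)).
  by have := bu' (UY (true, n)); rewrite /= /csite eqxx.
have hF i : `|uf (UY i)| <= 100 * kk.
  apply: le_trans (rad_le100k k0 ks hphi i).
  by have := bf (UY i); rewrite /= /sitev subr0.
have Er : `|Dr u' uf n - 1| <= 10^-1.
  by have := hF (true, n); move: hN; rewrite /Dr !ler_norml; lra.
have El : `|Dl n m u' uf m - 1| <= 10^-1.
  by have := hF (false, m); move: hN; rewrite /Dl eqxx !ler_norml; lra.
have hs' : 19 / 10 <= s <= 31 / 10.
  have c1 := cyc3 bu' R0; have c2 := hom3 bf R0.
  have : `|s - b| <= 10^-1 by apply: le_trans hs _; lra.
  by rewrite ler_norml; lra.
exists (P2 * Dl n m u' uf m), (s * P1 * Dr u' uf n), (resG L0 R0 (kapf b) b kk uf).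
move: Er El; rewrite !ler_norml => /andP[r1 r2] /andP[l1 l2].
move: hP1 hP2 hs' => /andP[a1 a2] /andP[c1 c2] /andP[s1 s2].
split.
- by apply/andP; split; nra.
- have q1 : 9 / 20 <= P1 * Dr u' uf n by nra.
  have q2 : P1 * Dr u' uf n <= 22 / 10 by nra.
  by rewrite -mulrA; apply/andP; split; nra.
- have h := sq_norm_le (fold_shift n0 m0 b2 b3); rewrite -sqrrN opprB -/u' in h.
  rewrite -ler_norml; apply: (le_trans E1); exact: (ler_wpM2l (ler0n R 62) h).
- have eR : Dr u' uf 0 = u' (UY R0) - uf (UY R0) by [].
  have eL : Dl n m u' uf 0 = u' (UY L0) - uf (UY L0) by rewrite /Dl n0'.
  have pe : (- (b * zeta)) ^+ n = (b * zeta) ^+ n.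
    by rewrite exprNn -signr_odd (negbTE odn) expr0 mul1r.
  have -> : defect n m b = resG L0 R0 (kapf b) b kk uf - kapf b * ((u' (UY L0) - uf (UY L0))
     - (psi b kk (u' (UY R0)) - psi b kk (uf (UY R0)))).
    by rewrite /defect /resG -/u' same_t vf; ring.
  rewrite es -eR -eL eP1 eP2 pe; ring.
Qed.

Lemma theta2E : theta ^+ 2 = 50 * 100 * kk * zeta.
Proof. by rewrite /zeta; field. Qed.

(** Here [400 * kk = 8 * theta], so the left side is a multiple of [(theta ^+ 2) ^+ N], and
    [theta ^+ 2] is [zeta / 200]. Five factors 1/200 absorb the constant and the additional
    [zeta / 10]. *)
Lemma remainder_small N : (5 <= N)%N ->
  62 * (2 * (200 * kk) * theta ^+ N.-1) ^+ 2 <= zeta / 10 * zeta ^+ N.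
Proof.
move=> hN; have z0 := zeta_gt0 R; have k0 := kk_gt0 R.
have -> : 62 * (2 * (200 * kk) * theta ^+ N.-1) ^+ 2 = 62 * 64 * (50 * 100 * kk * zeta) ^+ N.
  have -> : 2 * (200 * kk) * theta ^+ N.-1 = 8 * (theta * theta ^+ N.-1) by ring.
  rewrite -exprS prednK; last exact: (ltn_trans _ hN).
  by rewrite -theta2E [in RHS]exprAC exprMn; ring.
rewrite exprMn mulrA; apply: ler_wpM2r; first by rewrite exprn_ge0 // ltW.
have -> : 50 * 100 * kk = 2^-1 * 10^-1 ^+ 2 :> R by rewrite /kk; field.
have h : (2^-1 * 10^-1 ^+ 2 : R) ^+ N <= (2^-1 * 10^-1 ^+ 2) ^+ 5.
  by apply: ler_wiXn2l => //; lra.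
by apply: le_trans (ler_wpM2l _ h) _; rewrite ?/zeta ?/kk; lra.
Qed.

Lemma zeta_le : zeta <= 10^-1 ^+ 6.
Proof. by rewrite /zeta /kk; lra. Qed.

Lemma defect_lt0 n m (b : R) : (5 <= n)%N -> (5 <= m)%N -> ~~ odd n -> 2 <= b -> b <= 3 ->
  100 * (b * zeta) ^+ n <= zeta ^+ m -> defect n m b < 0.
Proof.
move=> n5 m5 odn b2 b3 h; have z0 := zeta_gt0 R.
have [P [Q [E [hP hQ hE ->]]]] := defect_expansion (leq_trans (isT : (0 < 5)%N) n5) (leq_trans (isT : (0 < 5)%N) m5) odn b2 b3.
have zm0 : 0 < zeta ^+ m by rewrite exprn_gt0.
have zn0 : 0 < zeta ^+ n by rewrite exprn_gt0.
have bn : zeta ^+ n <= (b * zeta) ^+ n.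
  by apply: lerXn2r; rewrite ?nnegrE; [exact: ltW|nra|nra].
(* [n < m] would contradict the hypothesis, so the remainder is measured against [zeta ^+ m], the
   dominant term. *)
have mn : (m <= n)%N.
  rewrite leqNgt; apply/negP => lt; have := zeta_le => zs.
  have : zeta ^+ m <= zeta ^+ n by apply: ler_wiXn2l; [exact: ltW|lra|exact: ltnW].
  lra.
move: hE; rewrite (minn_idPr mn) => hE.
have := le_trans hE (remainder_small m5); rewrite ler_norml => /andP[_ hE'].
have kp := kapf_bounds b2 b3.
have hb : Q * (b * zeta) ^+ n - P * zeta ^+ m <= - (3 / 10) * zeta ^+ m.
  move: hP hQ => /andP[? ?] /andP[? ?]; have : 0 < (b * zeta) ^+ n by lra.
  nra.
have : kapf b * (Q * (b * zeta) ^+ n - P * zeta ^+ m) <= zeta * (- (3 / 10) * zeta ^+ m).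
  have : 0 <= (kapf b - zeta) * zeta ^+ m by apply: mulr_ge0; [lra|exact: ltW].
  have : 0 < kapf b by lra.
  nra.
have : 0 < zeta * zeta ^+ m by rewrite mulr_gt0.
lra.
Qed.

Lemma defect_gt0 n m (b : R) : (5 <= n)%N -> (5 <= m)%N -> ~~ odd n -> 2 <= b -> b <= 3 ->
  100 * zeta ^+ m <= (b * zeta) ^+ n -> 0 < defect n m b.
Proof.
move=> n5 m5 odn b2 b3 h; have z0 := zeta_gt0 R.
have [P [Q [E [hP hQ hE ->]]]] := defect_expansion (leq_trans (isT : (0 < 5)%N) n5) (leq_trans (isT : (0 < 5)%N) m5) odn b2 b3.
have zm0 : 0 < zeta ^+ m by rewrite exprn_gt0.
have zn0 : 0 < zeta ^+ n by rewrite exprn_gt0.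
have bn : zeta ^+ n <= (b * zeta) ^+ n.
  by apply: lerXn2r; rewrite ?nnegrE; [exact: ltW|nra|nra].
have hmin : zeta ^+ minn n m <= (b * zeta) ^+ n.
  by rewrite /minn; case: ifP => _ //; lra.
have m5' : (5 <= minn n m)%N by rewrite leq_min n5.
have := le_trans hE (remainder_small m5'); rewrite ler_norml => /andP[hE' _].
have kp := kapf_bounds b2 b3.
have hb : 7 / 10 * (b * zeta) ^+ n <= Q * (b * zeta) ^+ n - P * zeta ^+ m.
  move: hP hQ => /andP[? ?] /andP[? ?]; have : 0 < (b * zeta) ^+ n by lra.
  nra.
have : zeta * (7 / 10 * (b * zeta) ^+ n) <= kapf b * (Q * (b * zeta) ^+ n - P * zeta ^+ m).
  by apply: ler_pM => //; [exact: ltW|lra|lra].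
have : zeta / 10 * zeta ^+ minn n m <= zeta / 10 * (b * zeta) ^+ n.
  by apply: ler_wpM2l => //; lra.
have : 0 < zeta * (b * zeta) ^+ n by apply: mulr_gt0 => //; lra.
lra.
Qed.

End Closing.

(** * Density of the parameters at which a cycle closes *)

Section ClosingParameters.
Variable R : realType.
Local Notation kk := (kk R).
Local Notation zeta := (zeta R).

Lemma pow_unbounded (r C : R) : 1 < r -> exists n0, forall n, (n0 <= n)%N -> C <= r ^+ n.
Proof.
move=> r1.
have bern n : 1 + n%:R * (r - 1) <= r ^+ n.
  elim: n => [|n IH]; first by rewrite expr0 mul0r addr0.
  have p0 : 1 <= r ^+ n by apply: exprn_ege1; apply: ltW.
  rewrite exprS -natr1; nra.
have r0 : 0 < r - 1 by lra.
exists (Num.bound (`|C| / (r - 1))) => n hn.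
have h : `|C| / (r - 1) < (Num.bound (`|C| / (r - 1)))%:R.
  by apply: archi_boundP; rewrite divr_ge0 // ltW.
have h2 : (Num.bound (`|C| / (r - 1)))%:R <= n%:R :> R by rewrite ler_nat.
have := lt_le_trans h h2; rewrite ltr_pdivrMr // => h3.
by have := bern n; have := ler_norm C; lra.
Qed.

Lemma lipschitz_IVT (g : R -> R) (a b C : R) : a < b -> 0 <= C ->
  (forall x y, a <= x -> x <= b -> a <= y -> y <= b -> `|g x - g y| <= C * `|x - y|) ->
  g a < 0 -> 0 < g b -> exists c, [/\ a < c, c < b & g c = 0].
Proof.
move=> ab C0 gL ga gb; pose S := [set x | a <= x /\ x <= b /\ g x <= 0].
have Sa : S a by split => //; split; lra.
have ubS : ubound S b by move=> x [_ []].
have hS : has_sup S by split; [exists a|exists b].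
pose c := sup S.
have ac : a <= c by apply: ub_le_sup Sa; exists b.
have cb : c <= b by apply: ge_sup => //; exists a.
have gc : g c = 0.
  apply/eqP; rewrite eq_le; apply/andP; split; rewrite leNgt; apply/negP => h.
    have d0 : 0 < g c / (C + 1) by rewrite divr_gt0 //; lra.
    have [x [ax [xb gx]] hx] := sup_adherent d0 hS.
    have xc : x <= c by apply: ub_le_sup => //; exists b.
    have := gL c x ac cb ax xb; rewrite !ger0_norm; last 2 first.
    - lra.
    - lra.
    move=> hh; have : c - x < g c / (C + 1) by rewrite -/c in hx; lra.
    by rewrite ltr_pdivlMr; [nra|lra].
  have cb' : c < b by rewrite lt_neqAle cb andbT; apply/eqP => e; rewrite e in h; lra.
  have d0 : 0 < - g c / (C + 1) by rewrite divr_gt0 //; lra.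
  pose y := Num.min b (c + - g c / (C + 1)).
  have yb : y <= b by rewrite /y ge_min lexx.
  have cy : c < y by rewrite /y lt_min cb' /=; lra.
  have yc : y - c <= - g c / (C + 1).
    have : y <= c + - g c / (C + 1) by rewrite /y ge_min lexx orbT.
    by lra.
  have ay : a <= y by lra.
  have := gL y c ay yb ac cb; rewrite [ `|y - c|]gtr0_norm; last by lra.
  rewrite ler_norml => /andP[_ hh].
  have q : (y - c) * (C + 1) <= - g c by rewrite -ler_pdivlMr //; lra.
  have Sy : S y by split => //; split => //; nra.
  have : y <= c by apply: ub_le_sup => //; exists b.
  lra.
exists c; split => //.
  by rewrite lt_neqAle ac andbT; apply/eqP => e; rewrite -e in gc; lra.
by rewrite lt_neqAle cb andbT; apply/eqP => e; rewrite e in gc; lra.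
Qed.

(** For large [n] the ratio of [(b2 * zeta) ^+ n] to [(b1 * zeta) ^+ n] exceeds [10^4 / zeta^2], so
    an even power of [zeta] fits between them with a factor 100 to spare on both sides; [q] is half
    the first even exponent far enough below the upper end. *)
Lemma balanced_exponents (b1 b2 : R) K : 2 <= b1 -> b1 < b2 -> b2 <= 3 ->
  exists n m, [/\ (K <= n)%N, (K <= m)%N, ~~ odd n & ~~ odd m] /\
    (100 * (b1 * zeta) ^+ n <= zeta ^+ m /\ 100 * zeta ^+ m <= (b2 * zeta) ^+ n).
Proof.
move=> b12 b1b2 b23; have z0 := zeta_gt0 R; have zs := zeta_le R.
have z20 : 0 < zeta ^+ 2 by rewrite exprn_gt0.
have r1 : 1 < b2 / b1 by rewrite ltr_pdivlMr; lra.
have [n0 hn0] := pow_unbounded (10 ^+ 4 / zeta ^+ 2) r1.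
pose n := (n0 + K).*2.
have nK : (n0 + K <= n)%N by rewrite /n -addnn leq_addr.
have rn : 10 ^+ 4 / zeta ^+ 2 <= (b2 / b1) ^+ n by apply/hn0/(leq_trans _ nK)/leq_addr.
pose A := (b2 * zeta) ^+ n.
have A0 : 0 < A by rewrite exprn_gt0 // mulr_gt0 //; lra.
have b1n : 0 < b1 ^+ n by rewrite exprn_gt0 //; lra.
have hA : 10 ^+ 4 * (b1 * zeta) ^+ n <= A * zeta ^+ 2.
  have e : (b2 / b1) ^+ n * b1 ^+ n = b2 ^+ n.
    by rewrite expr_div_n divfK // lt0r_neq0.
  move: rn; rewrite ler_pdivrMr // => h.
  have bz : 0 <= b1 ^+ n * zeta ^+ n by apply: mulr_ge0; [exact: ltW|exact/exprn_ge0/ltW].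
  have em (b : R) : (b * zeta) ^+ n = b ^+ n * zeta ^+ n by apply: exprMn.
  rewrite /A !em -e; have := ler_wpM2r bz h.
  by move: ((b2 / b1) ^+ n) (b1 ^+ n) (zeta ^+ n) => x y z; lra.
have ex : exists q, (100 * (zeta ^+ 2) ^+ q <= A).
  have z2i : 1 < (zeta ^+ 2)^-1.
    rewrite invf_gt1 // expr2; nra.
  have [q hq] := pow_unbounded (100 / A) z2i; exists q.
  have := hq q (leqnn q); rewrite exprVn ler_pdivrMr // mulrC ler_pdivlMr // exprn_gt0 //.
have [q hq minq] := ex_minnP ex.
have A1 : A <= 1.
  have h3 : b2 * zeta <= 1 by nra.
  by apply: exprn_ile1 => //; apply: mulr_ge0; [lra|exact: ltW].
have q0 : (0 < q)%N.
  by rewrite lt0n; apply/eqP => e; move: hq; rewrite e expr0; lra.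
exists n, q.*2; split; first split.
- exact: leq_trans (leq_addl _ _) nK.
- rewrite leqNgt; apply/negP => lt.
  have h1 : zeta ^+ K <= zeta ^+ q.*2 by apply: ler_wiXn2l; [exact: ltW|lra|exact: ltnW].
  have h2 : A <= zeta ^+ K.
    have h3 : (b2 * zeta) ^+ 2 <= zeta.
      have : b2 * zeta <= 3 * zeta by rewrite ler_wpM2r // ltW.
      have : 0 <= b2 * zeta by apply: mulr_ge0; [lra|exact: ltW].
      nra.
    have s0 : 0 <= (b2 * zeta) ^+ 2 by apply: sqr_ge0.
    rewrite /A /n -muln2 mulnC exprM.
    apply: (@le_trans _ _ (((b2 * zeta) ^+ 2) ^+ K)).
      by apply: ler_wiXn2l => //; [lra|exact: leq_addl].
    by apply: lerXn2r => //; rewrite nnegrE // ltW.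
  move: hq; rewrite -exprM mul2n => hq.
  have : 0 < zeta ^+ q.*2 by rewrite exprn_gt0.
  lra.
- by rewrite /n odd_double.
- by rewrite odd_double.
have lt : A < 100 * (zeta ^+ 2) ^+ q.-1.
  by rewrite ltNge; apply/negP => /minq; rewrite -ltnS prednK // ltnn.
have e2 : zeta ^+ q.*2 = zeta ^+ 2 * (zeta ^+ 2) ^+ q.-1.
  by rewrite -exprS prednK // -exprM mul2n.
split; last by rewrite -mul2n exprM.
rewrite e2; have := ler_wpM2r (ltW z20) (ltW lt); move: hA; lra.
Qed.

Lemma closing_parameters (b1 b2 : R) K : (5 <= K)%N -> 2 <= b1 -> b1 < b2 -> b2 <= 3 ->
  exists n m b, [/\ (K <= n)%N, (K <= m)%N, ~~ odd n & ~~ odd m] /\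
    [/\ b1 < b, b < b2 & defect n m b = 0].
Proof.
move=> K5 b12 b1b2 b23.
have [n [m [[Kn Km on om] [h1 h2]]]] := balanced_exponents K b12 b1b2 b23.
have n5 := leq_trans K5 Kn; have m5 := leq_trans K5 Km.
have b12' : b1 <= 3 by lra.
have b22 : 2 <= b2 by lra.
have g1 := defect_lt0 n5 m5 on b12 b12' h1.
have g2 := defect_gt0 n5 m5 on b22 b23 h2.
have C0 : 0 <= 7 * rad kk (cphi n m) Ut.
  by apply: mulr_ge0 => //; apply: (rad_ge0 (kk_gt0 R) (cphi n m) Ut).
have [x y ? ? ? ?|b [hb1 hb2 hb]] := lipschitz_IVT b1b2 C0 _ g1 g2; last by exists n, m, b.
rewrite mulrAC; apply: defect_lipschitz; try lra; exact: (leq_trans (isT : (0 < 5)%N) n5).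
Qed.

End ClosingParameters.

(** * Strict differentiability of the iterates, jointly in the parameter *)

Section StrictDifferentiability.
Variables (R : realType) (K : fieldType) (nrm : K -> R) (iota : {rmorphism R -> K}).
Hypothesis nrmD : forall x y, nrm (x + y) <= nrm x + nrm y.
Hypothesis nrmM : forall x y, nrm (x * y) = nrm x * nrm y.
Hypothesis nrm_iota : forall x, nrm (iota x) = `|x|.

Lemma nrm0 : nrm 0 = 0.
Proof. by rewrite -(rmorph0 iota) nrm_iota normr0. Qed.

Lemma nrmN x : nrm (- x) = nrm x.
Proof.
rewrite -mulN1r nrmM; have -> : (-1 : K) = iota (-1) by rewrite rmorphN1.
by rewrite nrm_iota normrN1 mul1r.
Qed.

Lemma nrm_ge0 x : 0 <= nrm x.
Proof. by have := nrmD x (- x); rewrite subrr nrm0 nrmN; lra. Qed.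

Lemma nrmB x y : nrm (x - y) <= nrm x + nrm y.
Proof. by rewrite -(nrmN y). Qed.

Lemma nrm_nat n : nrm n%:R = n%:R.
Proof. by rewrite -(rmorph_nat iota) nrm_iota normr_nat. Qed.

Definition n2 (x : K * K) : R := Num.max (nrm x.1) (nrm x.2).

Lemma n2_le x c : (n2 x <= c) = (nrm x.1 <= c) && (nrm x.2 <= c).
Proof. by rewrite ge_max. Qed.

Lemma nrm1_le x : nrm x.1 <= n2 x.
Proof. by rewrite le_max lexx. Qed.

Lemma nrm2_le x : nrm x.2 <= n2 x.
Proof. by rewrite le_max lexx orbT. Qed.

Lemma n2_ge0 x : 0 <= n2 x.
Proof. exact: le_trans (nrm_ge0 _) (nrm1_le x). Qed.

Lemma n2D x y : n2 (x + y) <= n2 x + n2 y.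
Proof.
have := nrm1_le x; have := nrm2_le x; have := nrm1_le y; have := nrm2_le y.
have /= := nrmD x.1 y.1; have /= := nrmD x.2 y.2.
by rewrite n2_le /= => *; apply/andP; split; lra.
Qed.

Definition scal2 (c : K) (x : K * K) : K * K := (c * x.1, c * x.2).

Definition lin2 (M : K * K -> K * K) := [/\ forall x y, M (x + y) = M x + M y,
  forall c x, M (scal2 c x) = scal2 c (M x) & exists2 C : R, 0 <= C & forall x, n2 (M x) <= C * n2 x].

Lemma lin2B M x y : lin2 M -> M (x - y) = M x - M y.
Proof.
move=> [hD hZ _]; rewrite hD; congr (_ + _).
have e z : - z = scal2 (-1) z :> K * K by case: z => p q; rewrite /scal2 /= !mulN1r.
by rewrite e hZ -e.
Qed.

Lemma lin2_comp M M' : lin2 M -> lin2 M' -> lin2 (M' \o M).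
Proof.
move=> [hD hZ [C C0 hC]] [hD' hZ' [C' C'0 hC']]; split => [x y|c x|] /=.
- by rewrite hD hD'.
- by rewrite hZ hZ'.
- exists (C' * C); first exact: mulr_ge0.
  by move=> x; apply: le_trans (hC' _) _; rewrite -mulrA; apply: ler_wpM2l.
Qed.

(** The derivative concerns [x] only; the dependence on [b] is merely Lipschitz, which is all that
    is established for [tau]. An abstract normed field gives one proof for the real plane, where
    fixed points are continued, and for the complex plane, where expansion is needed. *)
Definition SD (F : R -> K * K -> K * K) (b0 : R) (x0 y0 : K * K) (M : K * K -> K * K) :=
  exists C r : R, [/\ 0 <= C, 0 < r <= 1 & forall b x y, `|b - b0| <= r -> n2 (x - x0) <= r ->
    n2 (y - x0) <= r ->
    n2 (F b x - F b y - M (x - y)) <= C * (`|b - b0| + n2 (x - x0) + n2 (y - x0)) * n2 (x - y) /\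
    n2 (F b x - y0) <= C * (`|b - b0| + n2 (x - x0))].

Lemma SD_id b0 x0 : SD (fun _ x => x) b0 x0 x0 id.
Proof.
exists 1, 1; split => //; first by lra.
move=> b x y _ _ _; split; last by rewrite mul1r lerDr.
have -> : n2 (x - y - id (x - y)) = 0 by rewrite /= subrr /n2 /= nrm0 maxxx.
by rewrite mul1r; apply: mulr_ge0; rewrite ?addr_ge0 ?n2_ge0.
Qed.

Lemma SD_comp F G b0 x0 y0 z0 M M' : lin2 M -> lin2 M' ->
  SD F b0 x0 y0 M -> SD G b0 y0 z0 M' -> SD (fun b x => G b (F b x)) b0 x0 z0 (M' \o M).
Proof.
move=> lM lM' [C [r [C0 /andP[r0 r1] hF]]] [C' [r' [C'0 /andP[r'0 r'1] hG]]].
have [_ _ [Cm Cm0 hM]] := lM; have [_ _ [Cn Cn0 hN]] := lM'.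
pose rr := Num.min r (r' / (2 * C + 1)).
have d0 : 0 < 2 * C + 1 by lra.
have rr0 : 0 < rr by rewrite lt_min r0 divr_gt0.
have rr1 : rr <= r by rewrite ge_min lexx.
have rrC : rr * (2 * C + 1) <= r' by rewrite -ler_pdivlMr // ge_min lexx orbT.
clearbody rr; pose L := 3 * C + Cm.
have L0 : 0 <= L by rewrite /L; lra.
exists (C' * (1 + 2 * C) * L + Cn * C + C' * (1 + C)), (Num.min rr r'); split.
- by rewrite !addr_ge0 ?mulr_ge0 ?addr_ge0 ?mulr_ge0.
- by rewrite lt_min rr0 r'0 /= ge_min (le_trans rr1 r1).
move=> b x y; rewrite !le_min => /andP[hb1 hb2] /andP[hx1 hx2] /andP[hy1 hy2].
have [f1 f2] := hF b x y (le_trans hb1 rr1) (le_trans hx1 rr1) (le_trans hy1 rr1).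
have [_ f3] := hF b y x (le_trans hb1 rr1) (le_trans hy1 rr1) (le_trans hx1 rr1).
set X := F b x in f1 f2 *; set Y := F b y in f1 f3 *.
set s := `|b - b0| in f1 f2 f3 hb1 hb2 *; have s0 : 0 <= s by exact: normr_ge0.
have nx0 := n2_ge0 (x - x0); have ny0 := n2_ge0 (y - x0); have nxy := n2_ge0 (x - y).
have hX : n2 (X - y0) <= r' by apply: le_trans f2 _; nra.
have hY : n2 (Y - y0) <= r' by apply: le_trans f3 _; nra.
have [g1 g2] := hG b X Y hb2 hX hY; rewrite -/s in g1 g2.
have XY : n2 (X - Y) <= L * n2 (x - y).
  have -> : X - Y = (X - Y - M (x - y)) + M (x - y) by rewrite subrK.
  apply: le_trans (n2D _ _) _; have := hM (x - y).
  have q : s + n2 (x - x0) + n2 (y - x0) <= 3 by lra.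
  have : C * (s + n2 (x - x0) + n2 (y - x0)) * n2 (x - y) <= C * 3 * n2 (x - y).
    by apply: ler_wpM2r => //; apply: ler_wpM2l.
  by rewrite /L; lra.
set S := s + n2 (x - x0) + n2 (y - x0) in f1 *.
have S0 : 0 <= S by rewrite /S; lra.
split.
- have -> : G b X - G b Y - (M' \o M) (x - y) =
    (G b X - G b Y - M' (X - Y)) + M' (X - Y - M (x - y)).
    by rewrite (lin2B (X - Y) (M (x - y)) lM') /= addrA subrK.
  apply: le_trans (n2D _ _) _.
  have h1 : n2 (M' (X - Y - M (x - y))) <= Cn * (C * S * n2 (x - y)).
    by apply: le_trans (hN _) _; apply: ler_wpM2l.
  have h2 : s + n2 (X - y0) + n2 (Y - y0) <= (1 + 2 * C) * S by rewrite /S; nra.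
  have h3 : C' * (s + n2 (X - y0) + n2 (Y - y0)) * n2 (X - Y) <=
     C' * ((1 + 2 * C) * S) * (L * n2 (x - y)).
    apply: ler_pM => //; first by apply: mulr_ge0 => //; rewrite !addr_ge0 // n2_ge0.
      exact: n2_ge0.
    exact: ler_wpM2l.
  have h4 : 0 <= C' * (1 + C) * S * n2 (x - y).
    by rewrite !mulr_ge0 //; lra.
  move: g1 h1 h3 h4; lra.
- apply: le_trans g2 _.
  have h2 : s + n2 (X - y0) <= (1 + C) * (s + n2 (x - x0)) by nra.
  apply: le_trans (ler_wpM2l C'0 h2) _; rewrite mulrA; apply: ler_wpM2r; first by lra.
  by rewrite lerDr !addr_ge0 ?mulr_ge0 ?addr_ge0 ?mulr_ge0.
Qed.

Section LipschitzAt.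
Variables (P : Type) (dom : P -> Prop) (d : P -> R) (p0 : P).
Hypothesis d_ge0 : forall p, 0 <= d p.
Hypothesis d_le1 : forall p, dom p -> d p <= 3.

(** Lipschitz at the base point only. This is the form in which the coefficients of difference
    quotients are controlled, and it is stable under sums and products. *)
Definition lipat (G : P -> K) :=
  exists2 C : R, 0 <= C & forall p, dom p -> nrm (G p - G p0) <= C * d p.

Lemma lipat_cst c : lipat (fun=> c).
Proof. by exists 0 => // p _; rewrite subrr nrm0 mul0r. Qed.

Lemma lipat_add G H : lipat G -> lipat H -> lipat (fun p => G p + H p).
Proof.
move=> [C C0 hC] [D D0 hD]; exists (C + D); first exact: addr_ge0.
move=> p hp; have -> : G p + H p - (G p0 + H p0) = (G p - G p0) + (H p - H p0) by ring.
by apply: le_trans (nrmD _ _) _; rewrite mulrDl lerD ?hC ?hD.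
Qed.

Lemma lipat_opp G : lipat G -> lipat (fun p => - G p).
Proof. by move=> [C C0 hC]; exists C => // p hp; rewrite -opprD nrmN hC. Qed.

Lemma lipat_mul G H : lipat G -> lipat H -> lipat (fun p => G p * H p).
Proof.
move=> [C C0 hC] [D D0 hD]; have g0 := nrm_ge0 (G p0); have h0 := nrm_ge0 (H p0).
exists (C * (3 * D + nrm (H p0)) + nrm (G p0) * D).
  by rewrite addr_ge0 ?mulr_ge0 ?addr_ge0 ?mulr_ge0.
move=> p hp; have -> : G p * H p - G p0 * H p0 =
  (G p - G p0) * ((H p - H p0) + H p0) + G p0 * (H p - H p0) by ring.
apply: le_trans (nrmD _ _) _; rewrite !nrmM.
have h1 := nrmD (H p - H p0) (H p0); have q1 := hC p hp; have q2 := hD p hp.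
have h2 : nrm (H p - H p0 + H p0) <= 3 * D + nrm (H p0).
  by have := ler_wpM2l D0 (d_le1 hp); lra.
have h3 := ler_pM (nrm_ge0 _) (nrm_ge0 _) q1 h2; have h4 := ler_wpM2l g0 q2.
lra.
Qed.

Lemma lipat_exp G n : lipat G -> lipat (fun p => G p ^+ n).
Proof.
move=> h; elim: n => [|n IH]; first exact: lipat_cst.
have [C C0 hC] := lipat_mul h IH; exists C => // p hp; rewrite !exprS; exact: hC.
Qed.

End LipschitzAt.

End StrictDifferentiability.

(** * The affine family, its derivative and its iterates *)

Section FamilyMap.
Variables (R : realType) (K : fieldType) (nrm : K -> R) (iota : {rmorphism R -> K}).
Hypothesis nrmD : forall x y, nrm (x + y) <= nrm x + nrm y.
Hypothesis nrmM : forall x y, nrm (x * y) = nrm x * nrm y.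
Hypothesis nrm_iota : forall x, nrm (iota x) = `|x|.
Local Notation kk := (kk R).
Local Notation zeta := (zeta R).
Local Notation n2 := (n2 nrm).
Local Notation lin2 := (lin2 nrm).
Local Notation SD := (SD nrm).

Definition fK (b : R) (x : K * K) : K * K :=
  (iota (kapf b)^-1 * Bp (iota (tau b)) x.1 + Xp (iota b) (iota kk) x.2, Qp (iota kk) x.1).
Definition DK (b : R) (x v : K * K) : K * K :=
  (iota (kapf b)^-1 * dBp (iota (tau b)) x.1 * v.1 + dXp (iota b) (iota kk) x.2 * v.2,
   dQp (iota kk) x.1 * v.1).
Definition det2 (x y : K * K) : K := x.1 * y.2 - x.2 * y.1.

Lemma four_neq0 : (4 : K) != 0.
Proof. by rewrite -(rmorph_nat iota) fmorph_eq0 pnatr_eq0. Qed.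

Lemma DK_det b x v v' : det2 (DK b x v) (DK b x v') =
  - (dXp (iota b) (iota kk) x.2 * dQp (iota kk) x.1) * det2 v v'.
Proof. by rewrite /det2 /DK /=; ring. Qed.

Lemma DK_lin2 b x : lin2 (DK b x).
Proof.
split=> [u v|c u|].
- by rewrite /DK /=; congr (_, _) => /=; ring.
- by rewrite /DK /scal2 /=; congr (_, _); ring.
set a := iota (kapf b)^-1 * dBp (iota (tau b)) x.1; set c := dXp (iota b) (iota kk) x.2.
set q := dQp (iota kk) x.1.
have ge0 := nrm_ge0 nrmD nrmM nrm_iota; have n2ge0 := n2_ge0 nrmD nrmM nrm_iota.
exists (nrm a + nrm c + nrm q); first by rewrite !addr_ge0.
move=> v; have h1 := nrm1_le nrm v; have h2 := nrm2_le nrm v.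
have a1 := ler_wpM2l (ge0 a) h1; have a2 := ler_wpM2l (ge0 c) h2; have a3 := ler_wpM2l (ge0 q) h1.
have nq : 0 <= nrm q * n2 v by exact: mulr_ge0 (ge0 _) (n2ge0 _).
have na : 0 <= nrm a * n2 v by exact: mulr_ge0 (ge0 _) (n2ge0 _).
have nc : 0 <= nrm c * n2 v by exact: mulr_ge0 (ge0 _) (n2ge0 _).
rewrite n2_le /DK /= -/a -/c -/q; apply/andP; split; last by rewrite (nrmM q); lra.
by apply: le_trans (nrmD _ _) _; rewrite (nrmM a) (nrmM c); lra.
Qed.

Lemma kapf_inv_lipschitz b b' : `|(kapf b)^-1 - (kapf b')^-1| <= `|b - b'| :> R.
Proof.
have z0 := zeta_gt0 R; have zs := zeta_le R.
have e c : (kapf c)^-1 = zeta^-1 - c * zeta :> R.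
  by rewrite /kapf invf_div mulrBl mul1r expr2 mulrA mulfK // lt0r_neq0.
rewrite !e; have -> : zeta^-1 - b * zeta - (zeta^-1 - b' * zeta) = - zeta * (b - b') by ring.
rewrite normrM normrN (gtr0_norm z0); apply: ler_piMl => //; lra.
Qed.

Lemma tau_lipschitz b b' : 2 <= b -> b <= 3 -> 2 <= b' -> b' <= 3 ->
  `|tau b - tau b'| <= `|b - b'| :> R.
Proof.
move=> h1 h2 h3 h4; apply: le_trans (homS_lipschitz h1 h2 h3 h4 Ut) _.
have := rad_le_flat R hphi Ut; have := frad_small R Ut; have := kk_small R => q1 q2 q3.
by rewrite mulrAC; apply: ler_piMl => //; lra.
Qed.

(** The divided difference of [Bp t], equal to [dBp t x] when [y = x]. [S4] is that of the quartic
    term. *)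
Definition SB (t x y : K) : K :=
  (4 - 8 * (x + y) + 5 * (x * x + x * y + y * y)
   - (x * x * x + x * x * y + x * y * y + y * y * y)
   + t * (x + y) - t * (x * x + x * y + y * y)) / 4.
Definition S4 (e x y : K) : K := e * (x * x * x + x * x * y + x * y * y + y * y * y).

(** [fK b x - fK b y] is [x - y] multiplied by divided differences. These equal the derivative at
    the base point and are Lipschitz there, which is strict differentiability. *)
Lemma SD_fK b0 x0 : 2 < b0 -> b0 < 3 -> SD fK b0 x0 (fK b0 x0) (DK b0 x0).
Proof.
move=> b02 b03; have ge0 := nrm_ge0 nrmD nrmM nrm_iota.
have n2ge0 := n2_ge0 nrmD nrmM nrm_iota.
pose r := Num.min 1 (Num.min (b0 - 2) (3 - b0)).
have r0 : 0 < r by rewrite !lt_min; apply/and3P; split; lra.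
have [r1 [r2 r3]] : r <= 1 /\ r <= b0 - 2 /\ r <= 3 - b0.
  by rewrite /r !ge_min !lexx !orbT.
clearbody r.
pose P := (R * (K * K) * (K * K))%type.
pose d (p : P) : R := `|p.1.1 - b0| + n2 (p.1.2 - x0) + n2 (p.2 - x0).
pose dom (p : P) := `|p.1.1 - b0| <= r /\ n2 (p.1.2 - x0) <= r /\ n2 (p.2 - x0) <= r.
pose p0 : P := (b0, x0, x0).
have d0 p : 0 <= d p by rewrite !addr_ge0.
have d3 p : dom p -> d p <= 3 by rewrite /d => -[? [? ?]]; lra.
have db p : dom p -> 2 <= p.1.1 /\ p.1.1 <= 3.
  by move=> [+ _]; rewrite ler_norml => /andP[? ?]; split; lra.
have Lc := lipat_cst nrm_iota dom d p0.
have La := lipat_add nrmD (dom := dom) (d := d) (p0 := p0).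
have Lo := lipat_opp nrmM nrm_iota (dom := dom) (d := d) (p0 := p0).
have Lm := lipat_mul nrmD nrmM nrm_iota d3 (p0 := p0).
pose lip := lipat nrm dom d p0.
have Lb : lip (fun p => iota p.1.1).
  exists 1 => // p hp; rewrite -rmorphB nrm_iota mul1r /d.
  by rewrite -addrA lerDl addr_ge0.
have Lt : lip (fun p => iota (tau p.1.1)).
  exists 1 => // p hp; rewrite -rmorphB nrm_iota mul1r; have [h2 h3] := db p hp.
  apply: le_trans (tau_lipschitz h2 h3 (ltW b02) (ltW b03)) _.
  by rewrite /d -addrA lerDl addr_ge0.
have Lk : lip (fun p => iota (kapf p.1.1)^-1).
  exists 1 => // p hp; rewrite -rmorphB nrm_iota mul1r.
  apply: le_trans (kapf_inv_lipschitz _ _) _.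
  by rewrite /d -addrA lerDl addr_ge0.
have cl (G : P -> K) : (forall p, nrm (G p - G p0) <= d p) -> lip G.
  by move=> h; exists 1 => // p _; rewrite mul1r.
have Lx1 : lip (fun p => p.1.2.1).
  apply: cl => p; have := nrm1_le nrm (p.1.2 - x0); rewrite /d /= => h.
  by have := n2ge0 (p.2 - x0); have := normr_ge0 (p.1.1 - b0); lra.
have Lx2 : lip (fun p => p.1.2.2).
  apply: cl => p; have := nrm2_le nrm (p.1.2 - x0); rewrite /d /= => h.
  by have := n2ge0 (p.2 - x0); have := normr_ge0 (p.1.1 - b0); lra.
have Ly1 : lip (fun p => p.2.1).
  apply: cl => p; have := nrm1_le nrm (p.2 - x0); rewrite /d /= => h.
  by have := n2ge0 (p.1.2 - x0); have := normr_ge0 (p.1.1 - b0); lra.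
have Ly2 : lip (fun p => p.2.2).
  apply: cl => p; have := nrm2_le nrm (p.2 - x0); rewrite /d /= => h.
  by have := n2ge0 (p.1.2 - x0); have := normr_ge0 (p.1.1 - b0); lra.
have LS4 x y : lip x -> lip y -> lip (fun p => S4 (iota kk) (x p) (y p)).
  by move=> lx ly; rewrite /S4; repeat first [ exact: Lc | exact: lx | exact: ly | apply: (Lm) | apply: (La) ].
have [C1 C10 H1] : lip (fun p => iota (kapf p.1.1)^-1 * SB (iota (tau p.1.1)) p.1.2.1 p.2.1).
  by apply: (Lm) => //; rewrite /SB;
     repeat first [ exact: Lc | exact: Lt | exact: Lx1 | exact: Ly1 | apply: (Lm) | apply: (La) | apply: (Lo) ].
have [C2 C20 H2] : lip (fun p => iota p.1.1 + S4 (iota kk) p.1.2.2 p.2.2).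
  by apply: La => //; apply: LS4.
have [C3 C30 H3] : lip (fun p => 1 + S4 (iota kk) p.1.2.1 p.2.1).
  by apply: La; [exact: Lc | apply: LS4].
have [C4 C40 H4] : lip (fun p => (fK p.1.1 p.1.2).1).
  rewrite /fK /Bp /Xp /=; have lexp G n := @lipat_exp R K nrm iota nrmD nrmM nrm_iota P dom d p0 d3 G n.
  by repeat first [ exact: Lc | exact: Lt | exact: Lx1 | exact: Lx2 | exact: Lk | exact: Lb | apply: (lexp) | apply: (Lm) | apply: (La) | apply: (Lo) ].
have [C5 C50 H5] : lip (fun p => (fK p.1.1 p.1.2).2).
  rewrite /fK /Qp /=; have lexp G n := @lipat_exp R K nrm iota nrmD nrmM nrm_iota P dom d p0 d3 G n.
  by repeat first [ exact: Lc | exact: Lx1 | apply: (lexp) | apply: (Lm) | apply: (La) | apply: (Lo) ].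
exists (C1 + C2 + C3 + C4 + C5), r; split; [lra|lra|] => b x y hb hx hy.
have dp : dom (b, x, y) by [].
have dq : dom (b, x, x0).
  by split => //; split => //=; rewrite subrr /n2 /= (nrm0 nrm_iota) maxxx ltW.
have S0 := d0 (b, x, y); rewrite /d /= in S0; set S := _ + _ + _ in S0 *.
have h1 := H1 _ dp; have h2 := H2 _ dp; have h3 := H3 _ dp; have dS : d (b, x, y) = S by [].
rewrite dS in h1 h2 h3.
rewrite /p0 /= in h1 h2 h3; have h4 := H4 _ dq; have h5 := H5 _ dq.
have dE : d (b, x, x0) = `|b - b0| + n2 (x - x0).
  by rewrite /d /= subrr {2}/n2 /= (nrm0 nrm_iota) maxxx addr0.
rewrite dE in h4 h5; have T0 : 0 <= `|b - b0| + n2 (x - x0) by rewrite addr_ge0.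
have f4 := four_neq0.
have v1 := nrm1_le nrm (x - y); have v2 := nrm2_le nrm (x - y); have v0 := n2ge0 (x - y).
split; last first.
  have a1 := mulr_ge0 C10 T0; have a2 := mulr_ge0 C20 T0; have a3 := mulr_ge0 C30 T0.
  have a4 := mulr_ge0 C40 T0; have a5 := mulr_ge0 C50 T0.
  by rewrite n2_le; apply/andP; split; [move: h4|move: h5]; rewrite /p0 /=; lra.
have q i : 0 <= i -> 0 <= i * S * n2 (x - y) by move=> i0; rewrite !mulr_ge0.
have q1 := q _ C10; have q2 := q _ C20; have q3 := q _ C30; have q4 := q _ C40; have q5 := q _ C50.
rewrite n2_le; apply/andP; split.
- have -> : (fK b x - fK b y - DK b0 x0 (x - y)).1 =
    (iota (kapf b)^-1 * SB (iota (tau b)) x.1 y.1 - iota (kapf b0)^-1 * SB (iota (tau b0)) x0.1 x0.1)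
       * (x - y).1
    + ((iota b + S4 (iota kk) x.2 y.2) - (iota b0 + S4 (iota kk) x0.2 x0.2)) * (x - y).2.
    by rewrite /fK /DK /SB /S4 /Bp /dBp /Xp /dXp /=;
      move: (iota (kapf b)^-1) (iota (kapf b0)^-1) => ? ?; field.
  apply: le_trans (nrmD _ _) _; rewrite !nrmM.
  have m1 := ler_pM (ge0 _) (ge0 _) h1 v1; have m2 := ler_pM (ge0 _) (ge0 _) h2 v2.
  move: m1 m2; lra.
- have -> : (fK b x - fK b y - DK b0 x0 (x - y)).2 =
    ((1 + S4 (iota kk) x.1 y.1) - (1 + S4 (iota kk) x0.1 x0.1)) * (x - y).1.
    by rewrite /fK /DK /S4 /Qp /dQp /=; ring.
  by rewrite nrmM; have m1 := ler_pM (ge0 _) (ge0 _) h3 v1; move: m1; lra.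
Qed.

Section Iterates.
Variables (b0 : R) (pts : nat -> K * K).
Hypothesis b02 : 2 < b0.
Hypothesis b03 : b0 < 3.
Hypothesis pts_orbit : forall k, fK b0 (pts k) = pts k.+1.

Fixpoint Mk (k : nat) : K * K -> K * K := if k is k'.+1 then DK b0 (pts k') \o Mk k' else id.

Lemma Mk_lin2 k : lin2 (Mk k).
Proof.
elim: k => [|k IH]; last by apply: lin2_comp IH _; apply: DK_lin2.
by split => //; exists 1 => // x; rewrite mul1r.
Qed.

Lemma Mk_det k x y : det2 (Mk k x) (Mk k y) =
  (\prod_(j < k) - (dXp (iota b0) (iota kk) (pts j).2 * dQp (iota kk) (pts j).1)) * det2 x y.
Proof.
elim: k => [|k IH]; first by rewrite big_ord0 mul1r.
by rewrite /= DK_det IH big_ord_recr /=; ring.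
Qed.

Lemma SD_iter k : SD (fun b => iter k (fK b)) b0 (pts 0%N) (pts k) (Mk k).
Proof.
elim: k => [|k IH]; first exact: (SD_id nrmD nrmM nrm_iota).
apply: (SD_comp nrmD nrmM nrm_iota (Mk_lin2 k) (DK_lin2 b0 (pts k)) IH).
by rewrite -pts_orbit; apply: SD_fK.
Qed.

End Iterates.

End FamilyMap.

(** * The closed orbit and its eigenvector *)

Section CyclePositions.
Variables n m : nat.
Hypothesis n_gt0 : (0 < n)%N.
Hypothesis m_gt0 : (0 < m)%N.

Definition onx (o : option idx) := if o is Some i then cnx n m i else Some (true, 0%N).
Definition opr (o : option idx) := if o is Some i then cpr n m i else Some (false, 0%N).
Definition pvalid (o : option idx) : bool :=
  if o is Some i then (if i.1 then (i.2 <= n)%N else (i.2 < m)%N) else true.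
(** Forward in time from the fold: the [m] positions [(false, _)], then [(true, n)] down to
    [(true, 0)], and the fold again. *)
Definition pos k := iter k opr None.
Definition clen := (n + m).+2.

Lemma opr_valid o : pvalid o -> pvalid (opr o) /\ onx (opr o) = o.
Proof.
case: o => [[[] j]|] //=; rewrite /cpr /cnx /=.
  by case: j => [|j] h //=; split; [exact: ltnW | rewrite /cnx /= ltn_eqF].
case: eqP => [e|ne] h /=; last by split => //; rewrite ltn_neqAle h andbT; apply/eqP.
by rewrite leqnn /cnx /= eqxx -e.
Qed.

Lemma pos_valid k : pvalid (pos k).
Proof. by elim: k => //= k /opr_valid[]. Qed.

Lemma pos_left k : (k < m)%N -> pos k.+1 = Some (false, k).
Proof.
elim: k => [|k IH] hk //; rewrite /pos iterS -/(pos k.+1) IH ?(ltnW hk) //= /cpr /=.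
by rewrite ltn_eqF.
Qed.

Lemma pos_right j : (j <= n)%N -> pos (m + j).+1 = Some (true, (n - j)%N).
Proof.
elim: j => [|j IH] hj.
  have e : pos m = Some (false, m.-1) by have := @pos_left m.-1; rewrite prednK //; apply.
  by rewrite addn0 subn0 /pos iterS -/(pos m) e /= /cpr /= prednK // eqxx.
rewrite addnS /pos iterS -/(pos (m + j).+1) IH ?(ltnW hj) //= /cpr /=.
by rewrite -subSS subSn.
Qed.

Lemma pos_clen : pos clen = None.
Proof.
by rewrite /clen addnC /pos iterS -/(pos (m + n).+1) pos_right // subnn.
Qed.

Lemma pos_neq_None k : (0 < k < clen)%N -> pos k <> None.
Proof.
case: k => // k /andP[_]; rewrite /clen !ltnS => h.
have [hk|hk] := ltnP k m; first by rewrite pos_left.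
by rewrite -(subnKC hk) pos_right // leq_subLR addnC.
Qed.

End CyclePositions.

Section CycleOrbit.
Variables (R : realType) (n m : nat) (b : R).
Hypothesis n_gt0 : (0 < n)%N.
Hypothesis m_gt0 : (0 < m)%N.
Hypothesis b2 : 2 <= b.
Hypothesis b3 : b <= 3.
Hypothesis closed : defect n m b = 0.
Local Notation kk := (kk R).
Local Notation u := (cycS n m b).
Local Notation opr := (opr n m).
Local Notation onx := (onx n m).

Definition pointz o : R := nbY u o.
Definition pointw o : R := Qp kk (nbY u (onx o)).

(* Along [(true, _)] the variation is read after one turn, hence doubled. *)
Definition vscale (o : option idx) : R := if o is Some (true, _) then 2 else 1.
Definition vecz o : R := vscale o * nbD u o.
Definition vecw o : R := dQp kk (nbY u (onx o)) *
  (if o is None then nbD u (onx o) else vscale (onx o) * nbD u (onx o)).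
(** The eigenvalue is charged entirely to the step that returns to the fold. *)
Definition turn o : R := if opr o is None then 2 else 1.

Lemma cyc_equations : [/\ box (cen R (csite n)) (rad kk (cphi n m)) u,
  forall i, resY (cpr n m) (cnx n m) (kapf b) b kk u i = 0,
  forall i, resD (cpr n m) (cnx n m) (cwp R m) (cwn R n) (kapf b) b kk u i = 0,
  resH (false, 0%N) (true, 0%N) (kapf b) b kk u = 0 & u Ut = tau b].
Proof.
have [bu _ fu] := cycS_spec m n_gt0 b2 b3.
by have [h1 h2 h3 h4] := sysT_fixed fu; split.
Qed.

(** Only at the fold is the vanishing of the defect used; elsewhere the equation is part of the
    system solved by [cycS]. *)
Lemma orbit_z o : pvalid n m o ->
  (kapf b)^-1 * Bp (tau b) (pointz o) + Xp b kk (pointw o) = pointz (opr o).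
Proof.
have [_ rY _ _ et] := cyc_equations; have k0 := kapf_gt0 b2 b3.
have kn : kapf b != 0 by apply: lt0r_neq0.
move=> vo; have e : Bp (tau b) (pointz o) = kapf b * (pointz (opr o) - Xp b kk (pointw o)).
  case: o vo => [i|] vo; last by have := closed; rewrite /defect /resG et /pointz /pointw /psi /=; lra.
  by have := rY i; rewrite /resY et /pointz /pointw /psi /=; lra.
by rewrite e mulKf // subrK.
Qed.

Lemma orbit_w o : pvalid n m o -> Qp kk (pointz o) = pointw (opr o).
Proof. by move=> vo; have [_ e] := opr_valid m_gt0 vo; rewrite /pointw e. Qed.

Lemma tangent_z o : pvalid n m o ->
  (kapf b)^-1 * dBp (tau b) (pointz o) * vecz o + dXp b kk (pointw o) * vecw o =
  turn o * vecz (opr o).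
Proof.
have [_ _ rD rH et] := cyc_equations; have k0 := kapf_gt0 b2 b3.
have kn : kapf b != 0 by apply: lt0r_neq0.
have main (x y c d : R) : x * y = kapf b * (c - d) -> (kapf b)^-1 * x * y + d = c.
  by move=> h; rewrite -mulrA h mulKf // subrK.
move=> vo; apply: main; case: o vo => [[[] j]|] vo; last first.
- rewrite /pointz /pointw /vecz /vecw /turn /vscale /=; have := rH.
  by rewrite /resH et /dpsi /=; lra.
- have := rD (false, j); rewrite /resD et /dpsi /pointz /pointw /vecz /vecw /turn /=.
  rewrite /cwp /cwn /csite /cpr /cnx /vscale /=.
  case: eqP => hj /=; case: j vo hj => [|j] vo hj /=; lra.
- have := rD (true, j); rewrite /resD et /dpsi /pointz /pointw /vecz /vecw /turn /=.
  rewrite /cwp /cwn /csite /cpr /cnx /vscale /=.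
  case: eqP => hj /=; case: j vo hj => [|j] vo hj /=; lra.
Qed.

Lemma tangent_w o : pvalid n m o -> dQp kk (pointz o) * vecz o = turn o * vecw (opr o).
Proof.
move=> vo; have [_ e] := opr_valid m_gt0 vo; rewrite /vecw e /turn /pointz /vecz.
case eo: (opr o) e => [i|] e; first by rewrite mul1r.
by rewrite -e /=; ring.
Qed.

Lemma pointz_bound o : `|pointz o| <= 21 / 10.
Proof.
have [bu _ _ _ _] := cyc_equations; exact: (box_nbY (kk_gt0 R) (kk_small R) bu o).
Qed.

Lemma pointw_bound o : `|pointw o| <= 24 / 10.
Proof.
have h3 : `|nbY u (onx o)| <= 3 by apply: le_trans (pointz_bound (onx o)) _; lra.
apply: le_trans (Qp_norm (kk_ge0 R) (kk_small R) h3) _.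
by have := pointz_bound (onx o); rewrite /pointz; lra.
Qed.

Lemma pointz_fold : `|pointz None - 2| <= 10^-1.
Proof.
have [bu _ _ _ _] := cyc_equations.
have -> : pointz None - 2 = u Uv by rewrite /pointz /=; ring.
by apply: le_trans (box_v (kk_gt0 R) (kk_small R) bu) _; lra.
Qed.

Lemma pointz_off_fold i : `|pointz (Some i)| <= 11 / 10.
Proof.
have [bu _ _ _ _] := cyc_equations; exact: (box_Y3 (kk_gt0 R) (kk_small R) bu i).
Qed.

Lemma jacobian_bound o : 19 / 10 <= dXp b kk (pointw o) * dQp kk (pointz o).
Proof.
have kg := kk_ge0 R; have ks := kk_small R.
have hz : `|pointz o| <= 3 by apply: le_trans (pointz_bound o) _; lra.
have hw : `|pointw o| <= 4 by apply: le_trans (pointw_bound o) _; lra.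
have h1 := dXp_bound kg ks b hw; have h2 := dQp_bound kg ks hz.
have a1 : 199 / 100 <= dXp b kk (pointw o) by move: h1; rewrite ler_norml; have := b2; lra.
have a2 : 99 / 100 <= dQp kk (pointz o) by move: h2; rewrite ler_norml; lra.
nra.
Qed.

End CycleOrbit.

(** * Expansion in a norm adapted to the eigenvectors *)

Section EigenFrame.
Variables (R : realType) (K : fieldType) (nrm : K -> R) (iota : {rmorphism R -> K}).
Hypothesis nrmD : forall x y, nrm (x + y) <= nrm x + nrm y.
Hypothesis nrmM : forall x y, nrm (x * y) = nrm x * nrm y.
Hypothesis nrm_iota : forall x, nrm (iota x) = `|x|.
Local Notation n2 := (n2 nrm).
Local Notation lin2 := (lin2 nrm).
Local Notation SD := (SD nrm).

(* [(1, w0)] is an eigenvector of eigenvalue 2 and [h] is the other eigenvalue. *)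
Definition shear (w0 : K) (x : K * K) : K := x.2 - w0 * x.1.
Definition eigframe (M : K * K -> K * K) (w0 c h : K) := forall e : K * K,
  (M e).1 = 2 * e.1 + c * shear w0 e /\ shear w0 (M e) = h * shear w0 e.

(** One eigenvector and the determinant determine the triangular form of a plane map up to the entry
    [c], so the long product of derivatives is never expanded. *)
Lemma eigframe_of_det M (w0 D : K) : lin2 M -> M (1, w0) = scal2 2 (1, w0) ->
  (forall x y, det2 (M x) (M y) = D * det2 x y) ->
  eigframe M w0 (M (0, 1)).1 (D / 2).
Proof.
move=> [hD hZ _] hu hdet e.
have two : (2 : K) != 0 by rewrite -(rmorph_nat iota) fmorph_eq0 pnatr_eq0.
have ee : e = scal2 e.1 (1, w0) + scal2 (shear w0 e) (0, 1).
  by case: e => p q; rewrite /scal2 /shear /=; congr (_, _) => /=; ring.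
split.
  by rewrite {1}ee hD !hZ hu /scal2 /=; ring.
have := hdet (1, w0) e; rewrite hu /det2 /scal2 /shear /= => h.
apply: (mulfI two); have -> : 2 * ((M e).2 - w0 * (M e).1) = 2 * 1 * (M e).2 - 2 * w0 * (M e).1 by ring.
by rewrite h; field.
Qed.

(** A large [k] makes the off-diagonal entry [c] of the frame small in this norm. *)
Definition nN (w0 : K) (k : R) (x : K * K) : R := Num.max (nrm x.1) (k * nrm (shear w0 x)).

Let ge0 := nrm_ge0 nrmD nrmM nrm_iota.
Let n2ge0 := n2_ge0 nrmD nrmM nrm_iota.

Lemma nrm_shear w0 x : nrm (shear w0 x) <= (1 + nrm w0) * n2 x.
Proof.
apply: le_trans (nrmB nrmD nrmM nrm_iota _ _) _; rewrite nrmM.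
have := nrm2_le nrm x; have := ler_wpM2l (ge0 w0) (nrm1_le nrm x); lra.
Qed.

Lemma nN_le_n2 w0 k x : 0 <= k -> nN w0 k x <= (1 + k * (1 + nrm w0)) * n2 x.
Proof.
move=> k0; have h1 := nrm1_le nrm x; have h2 := ler_wpM2l k0 (nrm_shear w0 x).
have q1 := n2ge0 x; have q2 : 0 <= k * (1 + nrm w0) * n2 x.
  by rewrite !mulr_ge0 ?addr_ge0.
by rewrite ge_max; apply/andP; split; lra.
Qed.

Lemma n2_le_nN w0 k x : 1 <= k -> n2 x <= (1 + nrm w0) * nN w0 k x.
Proof.
move=> k1; have h1 : nrm x.1 <= nN w0 k x by rewrite le_max lexx.
have h2 : k * nrm (shear w0 x) <= nN w0 k x by rewrite le_max lexx orbT.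
have h3 : nrm (shear w0 x) <= nN w0 k x.
  by apply: le_trans h2; rewrite ler_peMl.
have q1 := ge0 x.1; have q2 := ge0 w0.
have h4 := ler_wpM2l q2 h1.
have h5 : 0 <= nrm w0 * nN w0 k x by apply: mulr_ge0 => //; lra.
rewrite n2_le; apply/andP; split; first by lra.
have -> : x.2 = shear w0 x + w0 * x.1 by rewrite /shear subrK.
by apply: le_trans (nrmD _ _) _; rewrite nrmM; lra.
Qed.

Lemma nND w0 k x y : 0 <= k -> nN w0 k (x + y) <= nN w0 k x + nN w0 k y.
Proof.
move=> k0.
have h1 z : nrm z.1 <= nN w0 k z by rewrite le_max lexx.
have h2 z : k * nrm (shear w0 z) <= nN w0 k z by rewrite le_max lexx orbT.
rewrite {1}/nN ge_max; apply/andP; split.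
  by apply: le_trans (nrmD _ _) _; have := h1 x; have := h1 y; lra.
have -> : shear w0 (x + y) = shear w0 x + shear w0 y by rewrite /shear /=; ring.
by have := ler_wpM2l k0 (nrmD (shear w0 x) (shear w0 y)); have := h2 x; have := h2 y; lra.
Qed.

(** If the first coordinate dominates, the eigenvalue 2 loses at most 1/4 to the entry [c];
    otherwise the transverse coordinate alone grows by 4. *)
Lemma eigframe_expands M w0 c h k x : eigframe M w0 c h -> 4 <= nrm h -> 4 * nrm c + 1 <= k ->
  7 / 4 * nN w0 k x <= nN w0 k (M x).
Proof.
move=> hM h4 hk; have [e1 e2] := hM x; have c0 := ge0 c; have k0 : 0 < k by lra.
have [le|lt] := leP (k * nrm (shear w0 x)) (nrm x.1).
  rewrite {1}/nN max_l // /nN e1 le_max; apply/orP; left.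
  have h1 : 2 * nrm x.1 <= nrm (2 * x.1 + c * shear w0 x) + nrm (c * shear w0 x).
    have := nrmB nrmD nrmM nrm_iota (2 * x.1 + c * shear w0 x) (c * shear w0 x).
    by rewrite addrK nrmM (nrm_nat nrm_iota 2).
  have h2 : 4 * (nrm c * nrm (shear w0 x)) <= nrm x.1.
    by apply: le_trans le; rewrite mulrA; apply: ler_wpM2r => //; lra.
  by rewrite nrmM in h1; lra.
rewrite {1}/nN (max_r (ltW lt)) /nN e2 le_max; apply/orP; right.
rewrite nrmM; have q : 0 <= k * nrm (shear w0 x) by rewrite mulr_ge0 // ltW.
have := ler_wpM2r q h4; lra.
Qed.

Lemma SD_expands g b0 x0 M w0 c h : lin2 M -> SD g b0 x0 x0 M -> eigframe M w0 c h ->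
  4 <= nrm h -> exists k r : R, [/\ 1 <= k, 0 < r & forall b x y, `|b - b0| <= r ->
    n2 (x - x0) <= r -> n2 (y - x0) <= r ->
    3 / 2 * nN w0 k (x - y) <= nN w0 k (g b x - g b y)].
Proof.
move=> lM [C [r [C0 /andP[r0 r1] hS]]] hM h4.
pose k : R := 4 * nrm c + 1; have k1 : 1 <= k by have := ge0 c; rewrite /k; lra.
have k0 : 0 <= k by lra.
pose A := (1 + k * (1 + nrm w0)) * (3 * C) * (1 + nrm w0).
have w00 := ge0 w0.
have W0 : 0 <= 1 + nrm w0 by rewrite addr_ge0.
have A0 : 0 <= A by rewrite /A !mulr_ge0 // addr_ge0 // mulr_ge0.
(* At this radius the nonlinear error costs at most 1/4 of the factor 7/4. *)
pose s := Num.min r (4^-1 / (A + 1)).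
have s0 : 0 < s by rewrite lt_min r0 divr_gt0 //; lra.
have sr : s <= r by rewrite ge_min lexx.
have sA : s * (A + 1) <= 4^-1 by rewrite -ler_pdivlMr ?ge_min ?lexx ?orbT //; lra.
clearbody s; exists k, s; split => // b x y hb hx hy.
have [h1 _] := hS b x y (le_trans hb sr) (le_trans hx sr) (le_trans hy sr).
set E := g b x - g b y - M (x - y) in h1.
have h2 := eigframe_expands (x - y) hM h4 (lexx k).
have h3 : nN w0 k (M (x - y)) <= nN w0 k (g b x - g b y) + nN w0 k E.
  have -> : M (x - y) = (g b x - g b y) + - E by rewrite /E opprB addrCA subrr addr0.
  have -> : nN w0 k E = nN w0 k (- E).
    rewrite /nN /= (nrmN nrmM nrm_iota); congr (Num.max _ (_ * _)).
    by rewrite -(nrmN nrmM nrm_iota); congr nrm; rewrite /shear /=; ring.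
  exact: nND.
have h5 := nN_le_n2 w0 E k0.
have h6 := n2_le_nN w0 (x - y) k1.
have nn : 0 <= nN w0 k (x - y) by rewrite le_max ge0.
have q3 : `|b - b0| + n2 (x - x0) + n2 (y - x0) <= 3 * s by lra.
have h7 : n2 E <= 3 * C * s * ((1 + nrm w0) * nN w0 k (x - y)).
  apply: le_trans h1 _; apply: ler_pM => //.
    by rewrite mulr_ge0 ?addr_ge0.
  by have := ler_wpM2l C0 q3; lra.
have h8 : nN w0 k E <= A * s * nN w0 k (x - y).
  apply: le_trans h5 _.
  have t0 : 0 <= 1 + k * (1 + nrm w0) by rewrite addr_ge0 // mulr_ge0.
  have := ler_wpM2l t0 h7; rewrite /A; lra.
have h9 : A * s * nN w0 k (x - y) <= 4^-1 * nN w0 k (x - y).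
  by apply: ler_wpM2r => //; lra.
lra.
Qed.

End EigenFrame.

(** * Continuation of the fixed point in the parameter *)

Section Persistence.
Variable R : realType.
Local Notation n2 := (n2 (fun x : R => `|x|)).
Local Notation lin2 := (lin2 (fun x : R => `|x|)).
Local Notation SD := (SD (fun x : R => `|x|)).
Let nD (x y : R) : `|x + y| <= `|x| + `|y|. Proof. exact: ler_normD. Qed.
Let nM (x y : R) : `|x * y| = `|x| * `|y|. Proof. exact: normrM. Qed.
Let ni (x : R) : `|idfun x| = `|x|. Proof. by []. Qed.

(* Newton's method with the derivative frozen at [b0]. *)
Lemma SD_fixed_point g b0 (x0 : R * R) M w0 c h : lin2 M -> SD g b0 x0 x0 M ->
  eigframe M w0 c h -> 4 <= `|h| -> forall rho : R, 0 < rho ->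
  exists2 r : R, 0 < r & forall b, `|b - b0| <= r -> exists2 x, n2 (x - x0) <= rho & g b x = x.
Proof.
move=> lM [C [r [C0 /andP[r0 r1] hS]]] hM h4 rho rho0.
have h1 : 3 <= `|h - 1|.
  have := ler_normB (h - 1) (-1); rewrite opprK subrK normrN1; lra.
have hn : h - 1 != 0 by rewrite -normr_gt0; lra.
have hi : `|(h - 1)^-1| <= 1.
  by rewrite normfV invf_le1; lra.
have w00 := normr_ge0 w0; have c00 := normr_ge0 c.
pose W := 1 + `|w0|; pose B := 1 + (1 + `|c|) * W.
have W1 : 1 <= W by rewrite /W; lra.
have B1 : 1 <= B by rewrite /B; nra.
have WB : W <= B by rewrite /B; nra.
pose A := C * (2 * W + 1) * W * B.
have A0 : 0 <= A by rewrite /A; apply: mulr_ge0; [apply: mulr_ge0; [apply: mulr_ge0 => // |] |]; lra.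
pose s := Num.min (Num.min (r / W) (rho / W)) (4^-1 / (A + 1)).
have s0 : 0 < s by rewrite !lt_min !divr_gt0 //; lra.
have [s1 [s2 s3]] : s * W <= r /\ s * W <= rho /\ s * (A + 1) <= 4^-1.
  by rewrite -!ler_pdivlMr; [rewrite /s !ge_min !lexx !orbT | lra | lra | lra].
clearbody s; have s1' : W * s <= r by rewrite mulrC.
(* At the centre the error is at most [C * q], so the first Newton step stays within [s / 2]. *)
pose q := Num.min s (s / (2 * (B * C + 1))).
have BC : 0 <= B * C by apply: mulr_ge0 => //; lra.
have q0 : 0 < q by rewrite lt_min s0 divr_gt0 //; lra.
have [q1 q2] : q <= s /\ q * (2 * (B * C + 1)) <= s.
  by rewrite -ler_pdivlMr; [rewrite /q !ge_min !lexx orbT | lra].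
clearbody q; exists q => // b hb.
(* Coordinates of the frame: [u true] along the eigenvector, [u false] transverse to it. *)
pose X (u : bool -> R) : R * R := x0 + (u true, w0 * u true + u false).
pose E u := g b (X u) - X u.
(* The correction is the inverse of [M - id] applied to [E u]; in the frame [M - id] is triangular
   with diagonal entries 1 and [h - 1]. *)
pose T (u : bool -> R) (j : bool) : R :=
  if j then u true - ((E u).1 - c * (shear w0 (E u) / (h - 1)))
  else u false - shear w0 (E u) / (h - 1).
have Xn u v : X u - X v = (u true - v true, w0 * (u true - v true) + (u false - v false)).
  by rewrite /X; congr (_, _) => /=; ring.
have Xb (D : R) u v : (forall j, `|u j - v j| <= D * s) -> n2 (X u - X v) <= W * (D * s).
  move=> hj; have Ds : 0 <= D * s by apply: le_trans (hj true).
  rewrite Xn n2_le /=; apply/andP; split.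
    by apply: le_trans (hj true) _; apply: ler_peMl.
  apply: le_trans (ler_normD _ _) _; rewrite normrM.
  by have := ler_wpM2l w00 (hj true); have := hj false; rewrite /W; lra.
pose z : bool -> R := fun=> 0.
have X0 : X z = x0 by rewrite /X /z; case: (x0) => p p'; congr (_, _) => /=; ring.
have small (v : R * R) d j : n2 v <= d -> `|if j then v.1 - c * (shear w0 v / (h - 1))
    else shear w0 v / (h - 1)| <= B * d.
  move=> hv; have d0 : 0 <= d by apply: le_trans hv; apply: (n2_ge0 nD nM ni).
  have sv : `|shear w0 v / (h - 1)| <= W * d.
    rewrite -[W * d]mulr1; apply: norm_mul_le => //.
    by apply: le_trans (nrm_shear nD nM ni w0 v) _; apply: ler_wpM2l => //; lra.
  have dW : d <= W * d by apply: ler_peMl.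
  case: j; last by apply: le_trans sv _; apply: ler_wpM2r.
  apply: le_trans (ler_normB _ _) _; have := norm_mul_le (lexx `|c|) sv.
  have := le_trans (nrm1_le _ v) hv; rewrite /B; have := mulr_ge0 c00 d0; lra.
have Tdiff (D : R) u v j : 0 <= D -> (forall j, `|u j| <= s) -> (forall j, `|v j| <= s) ->
   (forall j, `|u j - v j| <= D * s) -> `|T u j - T v j| <= D / 2 * s.
  move=> D0 bu bv huv.
  have near t : (forall j, `|t j| <= s) -> n2 (X t - x0) <= W * s.
    move=> ht; rewrite -X0 -[s]mul1r; apply: Xb => i; rewrite subr0 mul1r; exact: ht.
  have hu := near u bu; have hv := near v bv.
  have qr : q <= r by apply: le_trans q1 _; apply: le_trans s1; apply: ler_peMr => //; exact: ltW.
  have [e1 _] := hS b (X u) (X v) (le_trans hb qr) (le_trans hu s1') (le_trans hv s1').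
  set F := g b (X u) - g b (X v) - M (X u - X v) in e1.
  have [m1 m2] := hM (X u - X v).
  have sX : shear w0 (X u - X v) = u false - v false by rewrite Xn /shear /=; ring.
  rewrite sX in m1 m2.
  have EE : E u - E v = F + (M (X u - X v) - (X u - X v)).
    rewrite /E /F subrKA; rewrite !opprB; case: (g b (X u)) (g b (X v)) (X u) (X v) => [? ?] [? ?] [? ?] [? ?].
    by congr (_, _) => /=; ring.
  have sE : shear w0 (E u) - shear w0 (E v) = shear w0 F + (h - 1) * (u false - v false).
    have -> : shear w0 (E u) - shear w0 (E v) = shear w0 (E u - E v) by rewrite /shear /=; ring.
    rewrite EE; have -> : shear w0 (F + (M (X u - X v) - (X u - X v))) =
       shear w0 F + (shear w0 (M (X u - X v)) - shear w0 (X u - X v)) by rewrite /shear /=; ring.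
    by rewrite m2 sX; ring.
  have fE : (E u).1 - (E v).1 = F.1 + ((u true - v true) + c * (u false - v false)).
    have -> : (E u).1 - (E v).1 = (E u - E v).1 by [].
    by rewrite EE /= -/((M (X u - X v)).1) m1 Xn /=; ring.
  have Tj : T u j - T v j = - (if j then F.1 - c * (shear w0 F / (h - 1))
     else shear w0 F / (h - 1)).
    have sd : shear w0 (E u) / (h - 1) - shear w0 (E v) / (h - 1) =
      shear w0 F / (h - 1) + (u false - v false).
      by rewrite -mulrBl sE mulrDl mulrAC mulfV // mul1r.
    case: j; rewrite /T.
      have -> : u true - ((E u).1 - c * (shear w0 (E u) / (h - 1))) -
        (v true - ((E v).1 - c * (shear w0 (E v) / (h - 1)))) =
        (u true - v true) - ((E u).1 - (E v).1)
        + c * (shear w0 (E u) / (h - 1) - shear w0 (E v) / (h - 1)) by ring.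
      by rewrite sd fE; ring.
    have -> : u false - shear w0 (E u) / (h - 1) - (v false - shear w0 (E v) / (h - 1)) =
      (u false - v false) - (shear w0 (E u) / (h - 1) - shear w0 (E v) / (h - 1)) by ring.
    by rewrite sd; ring.
  rewrite Tj normrN.
  have Ds : 0 <= D * s by rewrite mulr_ge0 // ltW.
  have nF : n2 F <= C * ((2 * W + 1) * s) * (W * (D * s)).
    apply: le_trans e1 _; apply: ler_pM => //.
    - by rewrite mulr_ge0 // !addr_ge0 // ?(n2_ge0 nD nM ni).
    - exact: (n2_ge0 nD nM ni).
    - by apply: ler_wpM2l => //; lra.
    - exact: Xb.
  apply: le_trans (small _ _ j nF) _.
  have -> : B * (C * ((2 * W + 1) * s) * (W * (D * s))) = (s * A) * (D * s) by rewrite /A; ring.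
  have -> : D / 2 * s = 2^-1 * (D * s) by ring.
  by apply: ler_wpM2r => //; lra.
have Tz j : `|T z j| <= s / 2.
  have [_ e2] := hS b x0 x0 (le_trans hb (le_trans q1 (le_trans (ler_peMr (ltW s0) W1) s1)))
     ltac:(by rewrite subrr /n2 /= normr0 maxxx; exact: ltW)
     ltac:(by rewrite subrr /n2 /= normr0 maxxx; exact: ltW).
  have nE : n2 (E z) <= C * q.
    rewrite /E X0; apply: le_trans e2 _; apply: ler_wpM2l => //.
    by rewrite subrr {1}/n2 /= normr0 maxxx addr0.
  have -> : T z j = - (if j then (E z).1 - c * (shear w0 (E z) / (h - 1))
     else shear w0 (E z) / (h - 1)) by case: j; rewrite /T /z sub0r.
  by rewrite normrN; apply: le_trans (small _ _ j nE) _; lra.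
have bxE t : box z (fun=> s) t -> forall j, `|t j| <= s.
  by move=> ht j; have := ht j; rewrite /z subr0.
have [u bu fu] : exists2 u, box z (fun=> s) u & forall j, T u j = u j.
  apply: banach_box => [_|u bu j|D u v D0 bu bv huv j]; first exact: ltW.
    rewrite /z subr0; have := Tz j.
    have : `|T u j - T z j| <= 1 / 2 * s.
      apply: Tdiff => //; first exact: bxE.
        by move=> i; rewrite /z normr0 ltW.
      by move=> i; rewrite mul1r; apply: bu.
    have := ler_normD (T u j - T z j) (T z j); rewrite subrK; lra.
  by apply: Tdiff => //; apply: bxE.
have sE0 : shear w0 (E u) = 0.
  have := fu false; rewrite /T => e; have : shear w0 (E u) / (h - 1) = 0 by lra.
  by move=> /eqP; rewrite mulf_eq0 invr_eq0 (negbTE hn) orbF => /eqP.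
have E10 : (E u).1 = 0 by have := fu true; rewrite /T sE0 mul0r mulr0 subr0; lra.
exists (X u).
  rewrite -X0; apply: le_trans (Xb 1 u z _) _; last by rewrite mul1r mulrC.
  by move=> j; rewrite mul1r; apply: bu.
have E20 : (E u).2 = 0 by move: sE0; rewrite /shear E10 mulr0 subr0.
apply/eqP; rewrite -subr_eq0; apply/eqP; rewrite -/(E u).
by move: E10 E20; case: (E u) => p p' /= -> ->.
Qed.

End Persistence.

(** * Persistent sources are dense along the tangency curve *)

Section CycleFrame.
Variables (R : realType) (K : fieldType) (nrm : K -> R) (iota : {rmorphism R -> K}).
Hypothesis nrmD : forall x y, nrm (x + y) <= nrm x + nrm y.
Hypothesis nrmM : forall x y, nrm (x * y) = nrm x * nrm y.
Hypothesis nrm_iota : forall x, nrm (iota x) = `|x|.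
Variables (n m : nat) (b : R).
Hypothesis n_gt0 : (0 < n)%N.
Hypothesis m_gt0 : (0 < m)%N.
Hypothesis n_even : ~~ odd n.
Hypothesis m_even : ~~ odd m.
Hypothesis b2 : 2 <= b.
Hypothesis b3 : b <= 3.
Hypothesis closed : defect n m b = 0.
Local Notation kk := (kk R).
Local Notation pos := (pos n m).
Local Notation L := (clen n m).

Definition lift2 (x : R * R) : K * K := (iota x.1, iota x.2).

Lemma fK_lift (c : R) x : fK iota c (lift2 x) = lift2 (fK idfun c x).
Proof.
by rewrite /fK /lift2 /= rmorphD (rmorphM iota (kapf c)^-1) Bp_morph Xp_morph Qp_morph.
Qed.

Lemma iter_fK_lift (c : R) k x : iter k (fK iota c) (lift2 x) = lift2 (iter k (fK idfun c) x).
Proof. by elim: k => //= k ->; rewrite fK_lift. Qed.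

Lemma DK_lift (c : R) x v : DK iota c (lift2 x) (lift2 v) = lift2 (DK idfun c x v).
Proof.
rewrite /DK /lift2 /= rmorphD (rmorphM iota (_ * dBp _ _)) (rmorphM iota (kapf c)^-1).
by rewrite (rmorphM iota (dXp _ _ _)) (rmorphM iota (dQp _ _)) dBp_morph dXp_morph dQp_morph.
Qed.

Definition cpt k : R * R := (pointz n m b (pos k), pointw n m b (pos k)).
Definition cvec k : R * R := (vecz n m b (pos k), vecw n m b (pos k)).

Lemma cpt_orbit k : fK iota b (lift2 (cpt k)) = lift2 (cpt k.+1).
Proof.
have v := pos_valid n m_gt0 k; rewrite fK_lift; congr lift2; congr (_, _) => /=.
  exact: orbit_z.
exact: orbit_w.
Qed.

Lemma cvec_step k : DK iota b (lift2 (cpt k)) (lift2 (cvec k)) =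
  scal2 (iota (turn R n m (pos k))) (lift2 (cvec k.+1)).
Proof.
have v := pos_valid n m_gt0 k.
rewrite DK_lift /scal2 /lift2 /= -!rmorphM; congr (_, _); congr (iota _).
  exact: tangent_z.
exact: tangent_w.
Qed.

(** The tangent vector is carried without a factor up to the last step, which contributes the
    eigenvalue 2. *)
Lemma cvec_turn : Mk iota b (fun k => lift2 (cpt k)) L (lift2 (cvec 0)) =
  scal2 2 (lift2 (cvec 0)).
Proof.
have MkS k x : Mk iota b (fun k => lift2 (cpt k)) k.+1 x =
  DK iota b (lift2 (cpt k)) (Mk iota b (fun k => lift2 (cpt k)) k x) by [].
have h k : (k < L)%N -> Mk iota b (fun k => lift2 (cpt k)) k (lift2 (cvec 0)) = lift2 (cvec k).
  elim: k => [|k IH] hk //.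
  rewrite MkS IH ?(ltnW hk) // cvec_step /turn -[opr _ _ _]/(pos k.+1).
  have := @pos_neq_None n m m_gt0 k.+1 hk.
  by case: (pos k.+1) => // i _; rewrite rmorph1 /scal2 !mul1r.
have LE : L = (n + m).+1.+1 by [].
rewrite {1}LE MkS h ?LE // cvec_step /turn -[opr _ _ _]/(pos L) pos_clen //.
by rewrite rmorph_nat /cvec -LE pos_clen.
Qed.

Lemma cvec0 : lift2 (cvec 0) = (1, iota (cvec 0).2).
Proof. by rewrite /lift2 /cvec /= /vecz /vscale /= mulr1 rmorph1. Qed.

Definition cdet : R := \prod_(j < L) - (dXp b kk (cpt j).2 * dQp kk (cpt j).1).

(** The number of factors is even, so the signs cancel; there are at least four of them, each at
    least 19/10. The second eigenvalue is half of this determinant. *)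
Lemma cdet_ge8 : 8 <= cdet.
Proof.
have -> : cdet = \prod_(j < L) (dXp b kk (cpt j).2 * dQp kk (cpt j).1).
  by rewrite /cdet prodrN card_ord /clen -signr_odd /= negbK oddD (negbTE n_even) (negbTE m_even)
     expr0 mul1r.
have h k : (19 / 10 : R) ^+ k <= \prod_(j < k) (dXp b kk (cpt j).2 * dQp kk (cpt j).1).
  elim: k => [|k IH]; first by rewrite big_ord0 expr0.
  rewrite big_ord_recr exprSr /=; apply: ler_pM => //.
  by have := jacobian_bound m n_gt0 b2 b3 (pos k).
apply: le_trans (h L); apply: (@le_trans _ _ ((19 / 10) ^+ 4)); first by lra.
apply: ler_weXn2l; first by lra.
by rewrite /clen !ltnS -(addn1 1) leq_add.
Qed.

Lemma cyc_frame : exists c : K, eigframe (Mk iota b (fun k => lift2 (cpt k)) L)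
  (iota (cvec 0).2) c (iota (cdet / 2)).
Proof.
set M := Mk _ _ _ _; have lM := Mk_lin2 nrmD nrmM nrm_iota b (fun k => lift2 (cpt k)) L.
exists (M (0, 1)).1; rewrite fmorph_div rmorph_nat.
apply: (eigframe_of_det iota lM); first by rewrite -cvec0 cvec_turn.
move=> x y; rewrite Mk_det; congr (_ * _); rewrite /cdet rmorph_prod; apply: eq_bigr => j _.
by rewrite /lift2 /= rmorphN (rmorphM iota (dXp _ _ _)) dXp_morph dQp_morph.
Qed.

End CycleFrame.

Section Sources.
Variable R : realType.
Local Notation C := R[i].
Local Notation rc := (real_complex R).
Local Notation nc := (@Normc.normc R).
Local Notation n2R := (n2 (fun x : R => `|x|)).
Local Notation n2C := (n2 nc).

Definition fR (b : R) : R * R -> R * R := fK idfun b.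
Definition fC (b : R) : C * C -> C * C := fK rc b.

Lemma ncD (x y : C) : nc (x + y) <= nc x + nc y.
Proof. exact: le_normcD. Qed.

Lemma ncM (x y : C) : nc (x * y) = nc x * nc y.
Proof. exact: Normc.normcM. Qed.

Lemma nc_real (x : R) : nc (rc x) = `|x|.
Proof. by rewrite /Normc.normc /= expr0n /= addr0 sqrtr_sqr. Qed.

Let rD (x y : R) : `|x + y| <= `|x| + `|y|. Proof. exact: ler_normD. Qed.
Let rM (x y : R) : `|x * y| = `|x| * `|y|. Proof. exact: normrM. Qed.
Let ri (x : R) : `|idfun x| = `|x|. Proof. by []. Qed.

(** The third clause says that the orbit passes the fold once per turn: it fixes [L] as the exact
    period and distinguishes cycles of different lengths. The expansion is required in the adapted
    norm, where a single turn already expands. *)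
Definition source (b : R) (L : nat) (x : C * C) (w0 : C) (k rho : R) : Prop :=
  [/\ iter L (fC b) x = x,
      forall j, (j < L)%N ->
        nc (iter j (fC b) x).1 <= 5 / 2 /\ nc (iter j (fC b) x).2 <= 5 / 2,
      forall j, (j < L)%N -> (nc ((iter j (fC b) x).1 - 2) < 1 / 2) = (j == 0%N),
      1 <= k /\ 0 < rho &
      forall y, n2C (y - x) <= rho ->
        3 / 2 * nN nc w0 k (y - x) <= nN nc w0 k (iter L (fC b) y - x)].

Lemma n2_lift (x y : R * R) : n2C (lift2 rc x - lift2 rc y) = n2R (x - y).
Proof.
have -> : lift2 rc x - lift2 rc y = lift2 rc (x - y).
  by rewrite /lift2; congr (_, _); rewrite ?rmorphB.
by rewrite /n2 !nc_real.
Qed.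

Lemma lift2_id (x : R * R) : lift2 idfun x = x.
Proof. by case: x. Qed.

Lemma orbit_near b0 (p : nat -> R * R) L : 2 < b0 -> b0 < 3 ->
  (forall k, fR b0 (p k) = p k.+1) ->
  exists2 r : R, 0 < r & forall j b x, (j < L)%N -> `|b - b0| <= r -> n2R (x - p 0%N) <= r ->
    n2R (iter j (fR b) x - p j) <= 10^-1.
Proof.
move=> b2 b3 hp; elim: L => [|L [r r0 IH]]; first by exists 1.
have [D [s [D0 /andP[s0 s1] hS]]] := SD_iter rD rM ri b2 b3 hp L.
pose t := Num.min r (Num.min s (20^-1 / (D + 1))).
have t0 : 0 < t by rewrite !lt_min r0 s0 divr_gt0 //; lra.
have [t1 [t2 t3]] : t <= r /\ t <= s /\ t * (D + 1) <= 20^-1.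
  by rewrite -ler_pdivlMr; [rewrite /t !ge_min !lexx !orbT | lra].
clearbody t; exists t => // j b x; rewrite ltnS leq_eqVlt => /orP[/eqP -> | hj] hb hx; last first.
  by apply: IH => //; [exact: le_trans hb t1 | exact: le_trans hx t1].
have [_ h] := hS b x x (le_trans hb t2) (le_trans hx t2) (le_trans hx t2).
apply: le_trans h _; nra.
Qed.

Lemma norm_le_near (a p : R) : `|a - p| <= 10^-1 -> `|p| <= 24 / 10 -> `|a| <= 5 / 2.
Proof. by have := ler_normD (a - p) p; rewrite subrK; lra. Qed.

Lemma dist_lt_near (a p : R) : `|a - p| <= 10^-1 -> `|p - 2| <= 10^-1 -> `|a - 2| < 1 / 2.
Proof. by have := ler_normD (a - p) (p - 2); rewrite addrA subrK; lra. Qed.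

Lemma dist_ge_near (a p : R) : `|a - p| <= 10^-1 -> `|p| <= 11 / 10 -> 1 / 2 <= `|a - 2|.
Proof.
rewrite !ler_norml => /andP[? ?] /andP[? ?]; rewrite ler_normr; apply/orP; right; lra.
Qed.

Lemma source_dense (b1 b2 : R) N : (5 <= N)%N -> 2 <= b1 -> b1 < b2 -> b2 <= 3 ->
  exists L c d, [/\ (N <= L)%N, b1 <= c, c < d & d <= b2] /\
    forall b, c <= b -> b <= d -> exists x w0 k rho, source b L x w0 k rho.
Proof.
move=> N5 hb1 b12 hb2.
have [n [m [b0 [[Nn Nm on om] [h1 h2 cl]]]]] := closing_parameters N5 hb1 b12 hb2.
have n0 : (0 < n)%N by apply: leq_trans Nn; apply: leq_trans N5.
have m0 : (0 < m)%N by apply: leq_trans Nm; apply: leq_trans N5.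
have b02 : 2 < b0 by lra.
have b03 : b0 < 3 by lra.
pose L := clen n m; pose p := cpt n m b0.
have cdet8 := cdet_ge8 n0 m0 on om (ltW b02) (ltW b03).
have h4 : 4 <= `|cdet n m b0 / 2| by rewrite ger0_norm; lra.
have pR k : fR b0 (p k) = p k.+1.
  by have := cpt_orbit idfun n0 m0 (ltW b02) (ltW b03) cl k; rewrite !lift2_id.
have pC k : fC b0 (lift2 rc (p k)) = lift2 rc (p k.+1).
  exact: (cpt_orbit rc n0 m0 (ltW b02) (ltW b03) cl k).
have pL : p L = p 0%N by rewrite /p /cpt /L pos_clen.
have [cR frR] := cyc_frame rD rM ri n0 m0 (ltW b02) (ltW b03).
have [cC frC] := cyc_frame ncD ncM nc_real n0 m0 (ltW b02) (ltW b03).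
have SR := SD_iter rD rM ri b02 b03 (pts := fun k => lift2 idfun (p k))
   (fun k => etrans (congr1 _ (lift2_id _)) (etrans (pR k) (esym (lift2_id _)))) L.
have SC := SD_iter ncD ncM nc_real b02 b03 pC L.
rewrite !lift2_id pL in SR; rewrite pL in SC.
have lR := Mk_lin2 rD rM ri b0 (fun k => lift2 idfun (p k)) L.
have lC := Mk_lin2 ncD ncM nc_real b0 (fun k => lift2 rc (p k)) L.
have hC : 4 <= nc (rc (cdet n m b0 / 2)) by rewrite nc_real.
have [k [r [k1 r0 hexp]]] := SD_expands ncD ncM nc_real lC SC frC hC.
have [r2 r20 hnear] := @orbit_near b0 p L b02 b03 pR.
(* Half of [r], so that the ball of radius [r / 2] about the continued point stays where the
   expansion is known. *)
pose rho := Num.min (r / 2) r2.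
have rho0 : 0 < rho by rewrite lt_min r20 divr_gt0.
have [rho1 rho2] : rho <= r / 2 /\ rho <= r2 by rewrite /rho !ge_min !lexx orbT.
clearbody rho.
have [r3 r30 hfix] := SD_fixed_point lR SR frR h4 rho0.
pose e := Num.min (Num.min r r2) (Num.min r3 (Num.min (b0 - b1) (b2 - b0))).
have e0 : 0 < e by rewrite !lt_min r0 r20 r30 /=; apply/andP; split; lra.
have [e1 [e2 [e3 [e4 e5]]]] : e <= r /\ e <= r2 /\ e <= r3 /\ e <= b0 - b1 /\ e <= b2 - b0.
  by rewrite /e !ge_min !lexx !orbT.
clearbody e; exists L, (b0 - e), (b0 + e); split.
  split; [|lra|lra|lra].
  by rewrite /L /clen; apply: leq_trans Nn _; rewrite !leqW // leq_addr.
move=> b hb hb'; have be : `|b - b0| <= e by rewrite ler_norml; lra.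
have [x hx fx] := hfix b (le_trans be e3).
exists (lift2 rc x), (rc (cvec n m b0 0).2), k, (r / 2).
have nearj j (hj : (j < L)%N) := hnear j b x hj (le_trans be e2) (le_trans hx rho2).
have itj j : iter j (fC b) (lift2 rc x) = lift2 rc (iter j (fR b) x) by apply: iter_fK_lift.
have zb j : (j < L)%N -> `|(iter j (fR b) x).1 - pointz n m b0 (pos n m j)| <= 10^-1.
  by move=> hj; apply: le_trans (nearj j hj); exact: (nrm1_le _ (iter j (fR b) x - p j)).
have wb j : (j < L)%N -> `|(iter j (fR b) x).2 - pointw n m b0 (pos n m j)| <= 10^-1.
  by move=> hj; apply: le_trans (nearj j hj); exact: (nrm2_le _ (iter j (fR b) x - p j)).
have l1 z : (lift2 rc z).1 = rc z.1 by [].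
have l2 z : (lift2 rc z).2 = rc z.2 by [].
split.
- by rewrite itj; congr lift2; exact: fx.
- move=> j hj; rewrite itj l1 l2 !nc_real.
  split; last exact: norm_le_near (wb j hj) (pointw_bound m n0 (ltW b02) (ltW b03) _).
  apply: norm_le_near (zb j hj) (le_trans (pointz_bound m n0 (ltW b02) (ltW b03) _) _); lra.
- move=> j hj; rewrite itj l1 -(rmorph_nat rc) -rmorphB nc_real.
  have z := zb j hj; case: eqP => [j0|j0].
    by rewrite j0 in z *; exact: dist_lt_near z (pointz_fold m n0 (ltW b02) (ltW b03)).
  have jp : (0 < j < clen n m)%N by rewrite hj andbT lt0n; apply/eqP.
  have := @pos_neq_None n m m0 j jp; move: z; case: (pos n m j) => // i z _.
  by apply/negbTE; rewrite -leNgt; exact: dist_ge_near z (pointz_off_fold m n0 (ltW b02) (ltW b03) i).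
- by split => //; rewrite divr_gt0.
- move=> y hy; have fxC : iter L (fC b) (lift2 rc x) = lift2 rc x by rewrite itj; congr lift2; exact: fx.
  rewrite -{2}fxC; apply: hexp.
  + exact: le_trans be e1.
  + have -> : y - lift2 rc (p 0%N) = (y - lift2 rc x) + (lift2 rc x - lift2 rc (p 0%N)).
      by rewrite addrA subrK.
    apply: le_trans (n2D ncD _ _) _; rewrite n2_lift.
    by have := le_trans hx rho1; lra.
  + by rewrite n2_lift; have := le_trans hx rho1; lra.
Qed.

End Sources.

(** * A parameter with sources of arbitrarily large period *)

Section NestedIntervals.
Variable R : realType.

Lemma infinitely_many_sources : exists b : R, 2 <= b /\ b <= 3 /\
  forall N, exists2 L, (N <= L)%N & exists x w0 k rho, source b L x w0 k rho.
Proof.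
pose good (p : R * R) := [/\ 2 <= p.1, p.1 < p.2 & p.2 <= 3].
pose holds N (p : R * R) := exists2 L, (N <= L)%N & forall b, p.1 <= b -> b <= p.2 ->
  exists x w0 k rho, source b L x w0 k rho.
have step N (p : R * R) : exists q, good p ->
    [/\ good q, p.1 <= q.1, q.2 <= p.2 & holds N q].
  have [gp|ng] := pselect (good p); last by exists p => /ng.
  have [p1 p2 p3] := gp.
  have [L [c [d [[hL h1 h2 h3] hs]]]] := source_dense (N := N + 5) (leq_addl _ _) p1 p2 p3.
  exists (c, d) => _; split => //; first by split => /=; lra.
  by exists L => //; apply: leq_trans hL; apply: leq_addr.
pose nxt N p := projT1 (cid (step N p)).
have nxtP N p : good p -> [/\ good (nxt N p), p.1 <= (nxt N p).1, (nxt N p).2 <= p.2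
    & holds N (nxt N p)] by move=> gp; rewrite /nxt; case: (cid _) => q /= /(_ gp).
pose s := fix s k : R * R := if k is k'.+1 then nxt k' (s k') else (2, 3).
have gs k : good (s k).
  elim: k => [|k IH]; first by split => /=; lra.
  by have [] := nxtP k _ IH.
have s1 k j : (s k).1 <= (s (k + j)%N).1.
  elim: j => [|j IH]; first by rewrite addn0.
  by apply: le_trans IH _; rewrite addnS /=; have [] := nxtP (k + j)%N _ (gs (k + j)%N).
have s2 k j : (s (k + j)%N).2 <= (s k).2.
  elim: j => [|j IH]; first by rewrite addn0.
  by apply: le_trans IH; rewrite addnS /=; have [] := nxtP (k + j)%N _ (gs (k + j)%N).
have s12 k j : (s j).1 <= (s k).2.
  apply: le_trans (s1 j k) _; rewrite addnC.
  by apply: le_trans (s2 k j); have [_ /ltW] := gs (k + j)%N.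
pose b := sup (range (fun k => (s k).1)).
have ne : range (fun k => (s k).1) !=set0 by exists (s 0%N).1, 0%N.
have bl k : (s k).1 <= b.
  by apply: ub_le_sup; [exists (s 0%N).2 => _ [j _ <-] | exists k].
have bu k : b <= (s k).2 by apply: ge_sup => // _ [j _ <-].
exists b; split; first exact: (bl 0%N).
split; first exact: (bu 0%N).
move=> N; have [_ _ _ [L hL hs]] := nxtP N _ (gs N).
by exists L => //; apply: hs; [exact: (bl N.+1) | exact: (bu N.+1)].
Qed.

End NestedIntervals.

(** * The topology of the projective plane *)

Section ProjectivePlane.
Variable R : realType.
Local Notation C := (Cx R).
Local Notation V := ('rV[C]_3).
Local Notation P2 := (P2 R).
Implicit Types (z : V) (p : P2).

Lemma normalized_neq0 z : normalized z -> z != 0.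
Proof.
move=> /existsP[k /andP[/eqP zk _]]; apply/eqP => z0; move: zk; rewrite z0 mxE => /eqP.
by rewrite eq_sym oner_eq0.
Qed.

Lemma val_P2_neq0 p : val p != 0.
Proof. exact: normalized_neq0 (valP p). Qed.

Lemma firstnzP z : z != 0 -> exists k : 'I_3, [/\ firstnz z = Some k, z 0 k != 0 &
  forall j : 'I_3, (j < k)%N -> z 0 j = 0].
Proof.
move=> z0; rewrite /firstnz; case: pickP => [k /andP[zk /forallP h]|none].
  by exists k; split => // j jk; apply/eqP; have := h j; rewrite jk.
have [k zk] : exists k, z 0 k != 0.
  apply: contra_notP (negP z0) => /forallNP h; apply/eqP/rowP => j; rewrite mxE.
  by apply/eqP; apply/negPn/negP/h.
case: (@arg_minnP _ k (fun k => z 0 k != 0) (fun k : 'I_3 => k : nat) zk) => i zi hi.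
have := none i; rewrite zi /= => /negbT /forallPn [j]; rewrite negb_imply => /andP[ji zj].
by have := hi j zj; rewrite leqNgt ji.
Qed.

Lemma P2of_val z : z != 0 -> exists2 l, l != 0 & val (P2of z) = l *: z.
Proof.
move=> /firstnzP[k [e zk h]]; exists (z 0 k)^-1; first by rewrite invr_eq0.
rewrite /P2of e insubdK //; apply/existsP; exists k; rewrite mxE mulVf // eqxx /=.
by apply/forallP => j; apply/implyP => /h hj; rewrite mxE hj mulr0.
Qed.

Lemma P2of_scale l z : l != 0 -> z != 0 -> P2of (l *: z) = P2of z.
Proof.
move=> l0 z0; have [k [e zk h]] := firstnzP z0.
have [k' [e' zk' h']] : exists k : 'I_3, [/\ firstnz (l *: z) = Some k, (l *: z) 0 k != 0 &
  forall j : 'I_3, (j < k)%N -> (l *: z) 0 j = 0].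
  by apply: firstnzP; rewrite scaler_eq0 negb_or l0.
have kk' : k = k'.
  apply/val_inj/eqP; rewrite eqn_leq; apply/andP; split; rewrite leqNgt; apply/negP.
    by move=> /h hk; move: zk'; rewrite mxE hk mulr0 eqxx.
  by move=> /h' /eqP; rewrite mxE mulf_eq0 (negbTE l0) (negbTE zk).
rewrite /P2of e e' -kk' mxE scalerA invfM; congr (insubd _ _).
by rewrite mulrAC mulVf // mul1r.
Qed.

Lemma P2of_valK p : P2of (val p) = p.
Proof.
have [k /andP[/eqP zk /forallP h]] := existsP (valP p).
have [k' [e zk' h']] := firstnzP (val_P2_neq0 p).
have kk' : k = k'.
  apply/val_inj/eqP; rewrite eqn_leq; apply/andP; split; rewrite leqNgt; apply/negP => lt.
    by move: zk'; have := h k'; rewrite lt /= => ->.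
  by have /eqP := h' k lt; rewrite zk oner_eq0.
by rewrite /P2of e -kk' zk invr1 scale1r valKd.
Qed.

Definition scale_inv (S : set V) := forall l z, l != 0 -> S z -> S (l *: z).

Lemma scale_invE S l z : scale_inv S -> l != 0 -> S (l *: z) = S z.
Proof.
move=> hS l0; apply/propext; split => [h|]; last exact: hS.
by have := hS l^-1 _ _ h; rewrite invr_eq0 scalerA mulVf // scale1r; apply.
Qed.

Lemma scale_inv_P2of S z : scale_inv S -> z != 0 -> S (val (P2of z)) = S z.
Proof. by move=> hS /P2of_val [l l0 ->]; apply: scale_invE. Qed.

Definition cone_set (S : set V) : set P2 := [set p | S (val p)].

Lemma cone_open S : scale_inv S -> open S -> P2open (cone_set S).
Proof.
move=> hS oS; rewrite /P2open.
have -> : [set z : V | z != 0 /\ cone_set S (P2of z)] = ~` [set 0] `&` S.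
  apply/seteqP; split => z /= [z0 h].
    by split; [exact/eqP|rewrite -scale_inv_P2of].
  by have z0' : z != 0 by [exact/eqP]; split; rewrite // /cone_set /= scale_inv_P2of.
apply: openI => //; rewrite openC; apply: accessible_closed_set1.
exact/hausdorff_accessible/norm_hausdorff.
Qed.

(* Carries the topology given by [P2open]. *)
Definition PP := P2.
HB.instance Definition _ := Choice.copy PP P2.
HB.instance Definition _ := isPointed.Build PP (P2e0 R).

Lemma P2openT : P2open [set: PP].
Proof.
have -> : [set: PP] = cone_set setT by [].
by apply: cone_open; [|exact: openT].
Qed.

Lemma P2openI (A B : set PP) : P2open A -> P2open B -> P2open (A `&` B).
Proof.
move=> oA oB; have := openI oA oB; rewrite /P2open; congr open; apply/seteqP.
by split => z /= => [[[? ?] []]|[? []]].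
Qed.

Lemma P2open_bigU (I : Type) (f : I -> set PP) : (forall i, P2open (f i)) ->
  P2open (\bigcup_i f i).
Proof.
move=> of_; have := bigcup_open (fun i (_ : setT i) => of_ i); rewrite /P2open; congr open.
apply/seteqP; split => z /= => [[i _ [z0 h]]|[z0 [i _ h]]]; first by split => //; exists i.
by exists i.
Qed.

HB.instance Definition _ := isOpenTopological.Build PP P2openT P2openI P2open_bigU.

Lemma open_P2open (U : set PP) : open U = P2open U.
Proof.
apply/propext; split => [|oU].
  rewrite openE => h; have -> : U = \bigcup_(B : {B : set PP | P2open B /\ B `<=` U}) projT1 B.
    apply/seteqP; split => [p Up|p [[B [oB sB]] _ /= Bp]]; last exact: sB.
    by have [B [oB Bp sB]] := h p Up; exists (exist _ B (conj oB sB)).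
  by apply: P2open_bigU => -[B []].
by rewrite openE => p Up; exists U; split.
Qed.

Lemma P2closure_closure (S : set PP) : P2closure S = closure S.
Proof.
apply/seteqP; split => p /= h.
  by move=> B [U [oU Up sU]]; have [q [Uq Sq]] := h U oU Up; exists q; split => //; apply: sU.
move=> U oU Up; have [|q [Sq Uq]] := h U; last by exists q.
by exists U; split.
Qed.

Lemma compact_P2compact (A : set PP) : compact A -> P2compact A.
Proof.
rewrite compact_cover => cA I U oU sA.
(* [compact_cover] takes families indexed by a choice type, whereas [P2compact] allows any type. *)
have [||D' _ hD'] := cA {classic I} setT U.
- by move=> i _; rewrite open_P2open.
- by move=> p /sA [i _ Uip]; exists i.
exists ([set` D'] : set {classic I}); split; first exact: (finite_fset D').
exact: hD'.
Qed.

Lemma P2of_continuous z : z != 0 -> {for z, continuous (@P2of R : V -> PP)}.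
Proof.
move=> z0 A [U [oU Uz sU]]; have := open_nbhs_nbhs (conj oU (conj z0 Uz)).
by apply: filterS => y [_ /sU].
Qed.

Lemma ord3P (Q : 'I_3 -> Prop) : Q 0 -> Q 1 -> Q 2%:R -> forall k, Q k.
Proof.
move=> q0 q1 q2 [[|[|[|//]]] i].
- by rewrite (_ : Ordinal i = 0) //; apply/val_inj.
- by rewrite (_ : Ordinal i = 1) //; apply/val_inj.
- by rewrite (_ : Ordinal i = 2%:R) //; apply/val_inj.
Qed.

Lemma row_continuous (T : topologicalType) (F : T -> V) :
  (forall k, continuous (fun x => F x 0 k)) -> continuous F.
Proof.
move=> hF x A [P hP sP]; have hk (k : 'I_3) : nbhs x [set y | P 0 k (F y 0 k)] := hF k x _ (hP 0 k).
have : nbhs x [set y | forall k : 'I_3, P 0 k (F y 0 k)].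
  apply: filterS (filterI (hk 0) (filterI (hk 1) (hk 2%:R))) => y [h0 [h1 h2]].
  exact: (@ord3P (fun k => P 0 k (F y 0 k))).
by apply: filterS => y h; apply: sP => i k; rewrite ord1.
Qed.

Lemma sum_cvg (I : Type) (r : seq I) (Q : pred I) (G : I -> V -> C) z :
  (forall i, Q i -> G i x @[x --> z] --> G i z) ->
  \sum_(i <- r | Q i) G i x @[x --> z] --> \sum_(i <- r | Q i) G i z.
Proof.
move=> h; elim: r => [|i r IH].
  rewrite big_nil; under eq_cvg do rewrite big_nil.
  exact: (@cvg_cst C (0 : C) V (nbhs z) _).
rewrite big_cons; under eq_cvg do rewrite big_cons.
case: ifPn => [Qi|_]; last exact: IH.
exact: (@cvgD C C V (nbhs z) _ (G i) (fun x => \sum_(j <- r | Q j) G j x) _ _ (h i Qi) IH).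
Qed.

Section Endomorphism.
Variables (d : nat) (c : 'I_3 -> 'I_d.+1 -> 'I_d.+1 -> C).
Hypothesis nd : P2nondeg c.

Lemma hlift_scale l z : hlift c (l *: z) = l ^+ d *: hlift c z.
Proof.
apply/rowP => k; rewrite !mxE /hpoly mulr_sumr; apply: eq_bigr => a _.
rewrite mulr_sumr; apply: eq_bigr => b ab; rewrite !mxE !exprMn.
have -> : l ^+ d = l ^+ a * l ^+ b * l ^+ (d - a - b).
  by rewrite -!exprD -subnDA subnKC.
ring.
Qed.

Lemma endo_P2of z : z != 0 -> endo c (P2of z) = P2of (hlift c z).
Proof.
move=> z0; rewrite /endo; have [l l0 ->] := P2of_val z0; rewrite hlift_scale P2of_scale //.
  by rewrite expf_neq0.
exact: nd.
Qed.

Lemma hlift_continuous : continuous (hlift c).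
Proof.
apply: row_continuous => k z.
have -> : (fun x : V => hlift c x 0 k) = (fun x : V => hpoly (c k) x) by apply/funext => x; rewrite mxE.
have ce (j : 'I_3) a : (x 0 j ^+ a : C) @[x --> z] --> (z 0 j ^+ a : C).
  elim: a => [|a IH]; first by rewrite expr0; exact: (@cvg_cst C (1 : C) V (nbhs z) _).
  under eq_cvg do rewrite exprS.
  rewrite exprS; apply: (@cvgM C V (nbhs z) _ (fun x => x 0 j) (fun x => x 0 j ^+ a)).
    exact: (@coord_continuous C 1 3 0 j z).
  exact: IH.
apply: sum_cvg => a _; apply: sum_cvg => b _.
apply: (@cvgM C V (nbhs z)); last exact: ce.
apply: (@cvgM C V (nbhs z)); last exact: ce.
apply: (@cvgM C V (nbhs z)); [exact: (@cvg_cst C (c k a b) V (nbhs z) _) | exact: ce].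
Qed.

Lemma endo_continuous : continuous (endo c : PP -> PP).
Proof.
apply/continuousP => U; rewrite !open_P2open => oU; rewrite /P2open.
have -> : [set z : V | z != 0 /\ (endo c @^-1` U) (P2of z)] =
  ~` [set 0] `&` (hlift c @^-1` [set z | z != 0 /\ U (P2of z)]).
  apply/seteqP; split => z /= [z0].
    by rewrite endo_P2of // => h; split; [exact/eqP|split => //; exact: nd].
  by move=> [_ h]; split; [exact/eqP|rewrite endo_P2of //; exact/eqP].
apply: openI; last by move/continuousP: hlift_continuous; apply.
rewrite openC; apply: accessible_closed_set1.
exact/hausdorff_accessible/norm_hausdorff.
Qed.

End Endomorphism.

End ProjectivePlane.

(** * Compactness and separation of the projective plane *)

Section CompactHausdorff.
Variable R : realType.
Local Notation C := (Cx R).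
Local Notation V := ('rV[C]_3).
Local Notation PP := (PP R).
Local Notation nc := (@Normc.normc R : C -> R).

Lemma ltC_real (e : C) : 0 < e -> exists2 r : R, 0 < r & e = real_complex R r.
Proof. by case: e => a b; rewrite ltcE /= => /andP[/eqP b0 a0]; exists a; rewrite //= b0. Qed.

Lemma cvgC_dist (T : topologicalType) (f : T -> C) (x : T) :
  (forall r : R, 0 < r -> \forall y \near x, nc (f x - f y) < r) -> {for x, continuous f}.
Proof.
move=> h; apply/cvgrPdist_lt => e /ltC_real [r r0 ->].
by apply: filterS (h r r0) => y; rewrite -ltcR.
Qed.

Lemma near_dist (z : C) (r : R) : 0 < r -> \forall y \near z, nc (z - y) < r.
Proof.
move=> r0; have := @cvgrPdist_lt _ _ _ (nbhs z) _ (@id C) z.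
move=> [/(_ (@cvg_id _ _))] /(_ (real_complex R r)) h _.
have /h : 0 < real_complex R r by rewrite (ltcR 0).
by apply: filterS => y; rewrite (ltcR (nc (z - y))).
Qed.

Lemma ncN (x : C) : nc (- x) = nc x.
Proof. by case: x => a b; rewrite /= !sqrrN. Qed.

Lemma nc_ge0 (x : C) : 0 <= nc x.
Proof. by case: x => a b; exact: sqrtr_ge0. Qed.

Lemma nc_gt0 (x : C) : (0 < nc x) = (x != 0).
Proof.
rewrite lt_neqAle nc_ge0 andbT eq_sym; congr (~~ _); apply/eqP/eqP => [|->]; last exact: Normc.normc0.
exact: Normc.eq0_normc.
Qed.

Lemma nc_distB (x y : C) : `|nc x - nc y| <= nc (x - y).
Proof.
have := ncD (y - x) x; have := ncD (x - y) y; rewrite !subrK -(ncN (y - x)) opprB ler_norml.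
by move=> h1 h2; apply/andP; split; lra.
Qed.

Lemma nc_continuous : continuous nc.
Proof.
move=> z; apply/(@cvgrPdist_lt _ _ _ (nbhs z) _) => e e0; apply: filterS (near_dist z e0) => y.
exact: le_lt_trans (nc_distB _ _).
Qed.

Lemma open_ltr (T : topologicalType) (f g : T -> R) : continuous f -> continuous g ->
  open [set x | f x < g x].
Proof.
move=> cf cg; have -> : [set x | f x < g x] = (fun x => g x - f x) @^-1` [set r | 0 < r].
  by apply/seteqP; split => x /=; rewrite subr_gt0.
by apply: open_comp => [x _|]; [apply: cvgB; [exact: cg | exact: cf] | exact: open_gt].
Qed.

Lemma coord_nc_continuous (j : 'I_3) : continuous (fun z : V => nc (z 0 j)).
Proof.
move=> z; apply: (@continuous_comp _ _ _ (fun z : V => z 0 j) nc); last exact: nc_continuous.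
exact: (@coord_continuous C 1 3 0 j z).
Qed.

(** A square instead of a disc, because it is the image of a product of two segments. *)
Definition csquare : set C := [set x | `|complex.Re x| <= 1 /\ `|complex.Im x| <= 1].

Lemma csquare_compact : compact csquare.
Proof.
pose h (x : R * R) : C := Complex x.1 x.2.
have -> : csquare = h @` (`[-1, 1] `*` `[-1, 1]).
  apply/seteqP; split => [[a b] /= [ha hb]|_ [[a b] /= [ha hb] <-]].
    by exists (a, b) => //=; rewrite !in_itv /= -!ler_norml.
  by move: ha hb; rewrite !in_itv /= -!ler_norml.
apply: continuous_compact; last by apply: compact_setX; exact: segment_compact.
apply: continuous_subspaceT => -[x1 x2]; apply: cvgC_dist => r r0.
have r2 : 0 < r / 2 by lra.
have n1 : \forall y \near (x1, x2), `|x1 - y.1| < r / 2.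
  exact: (@cvgr_dist_lt _ _ _ _ _ _ _ (@cvg_fst _ _ (nbhs x1) (nbhs x2) _)).
have n2' : \forall y \near (x1, x2), `|x2 - y.2| < r / 2.
  exact: (@cvgr_dist_lt _ _ _ _ _ _ _ (@cvg_snd _ _ (nbhs x1) (nbhs x2) _)).
apply: filterS2 n1 n2' => -[y1 y2] /= h1 h2.
have e : h (x1, x2) - h (y1, y2) = real_complex R (x1 - y1) + Complex 0 1 * real_complex R (x2 - y2).
  by rewrite /h; apply/eqP; rewrite eq_complex /= !mul0r !mulr0 !mul1r ?subr0 ?addr0 ?add0r !eqxx.
change (nc (h (x1, x2) - h (y1, y2)) < r); rewrite e.
apply: le_lt_trans (ncD _ _) _; rewrite ncM !nc_real.
have -> : nc (Complex 0 1) = 1 by rewrite /Normc.normc expr0n expr1n add0r sqrtr1.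
by rewrite mul1r; lra.
Qed.

Lemma nc_csquare (x : C) : nc x <= 1 -> csquare x.
Proof.
case: x => a b /= h.
have ab0 : 0 <= a ^+ 2 + b ^+ 2 by rewrite addr_ge0 ?sqr_ge0.
have : a ^+ 2 + b ^+ 2 <= 1.
  by rewrite -(sqr_sqrtr ab0) -(expr1n R 2) ler_sqr ?nnegrE ?sqrtr_ge0.
move: (sqr_ge0 a) (sqr_ge0 b) => ha hb hab; rewrite /csquare /= !ler_norml; split; apply/andP; split; nra.
Qed.

(** The normalised representatives are unbounded. Dividing by the coordinate of largest modulus
    instead places every point in the image of one of three compact sets. *)
Lemma PP_compact : compact [set: PP].
Proof.
pose A (k i : 'I_3) : set C := if i == k then [set 1] else csquare.
pose B (k : 'I_3) : set V := [set v | forall i, A k i (v ord0 i)].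
have cB k : compact ((@P2of R : V -> PP) @` B k).
  apply: continuous_compact; last first.
    by apply: rV_compact => i; rewrite /A; case: ifP => _; [exact: compact_set1|exact: csquare_compact].
  apply: continuous_in_subspaceT => v; rewrite inE => Bv; apply: P2of_continuous.
  apply/eqP => v0; have := Bv k; rewrite /A eqxx v0 mxE => /eqP.
  by rewrite eq_sym oner_eq0.
have -> : [set: PP] = (@P2of R : V -> PP) @` B 0 `|` ((@P2of R : V -> PP) @` B 1 `|` (@P2of R : V -> PP) @` B 2%:R).
  apply/seteqP; split => // p _.
  have [k pk] : exists k : 'I_3, forall i, nc (val p 0 i) <= nc (val p 0 k).
    case: (@Order.TotalTheory.arg_maxP _ R 'I_3 0 predT (fun k : 'I_3 => nc (val p 0 k)) isT) => k _ h.
    by exists k => i; apply: h.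
  have pk0 : val p 0 k != 0.
    apply/eqP => z; have := val_P2_neq0 p; case/eqP; apply/rowP => i; rewrite mxE.
    by have := pk i; rewrite z Normc.normc0 => h; apply/eqP/negPn; rewrite -nc_gt0 -leNgt.
  have : ((@P2of R : V -> PP) @` B k) p.
    exists ((val p 0 k)^-1 *: val p); last by rewrite P2of_scale ?P2of_valK ?invr_eq0 // val_P2_neq0.
    move=> i; rewrite /A; case: eqP => [->|_]; first by rewrite /= mxE mulVf.
    apply: nc_csquare; rewrite mxE ncM Normc.normcV mulrC ler_pdivrMr ?mul1r ?nc_gt0 //.
  by move: k {pk pk0}; apply: ord3P => h; [left | right; left | right; right].
by apply: compactU; [|apply: compactU].
Qed.

Definition minor (p : V) (i j : 'I_3) (z : V) : C := z 0 i * p 0 j - z 0 j * p 0 i.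

Lemma minor_scale p i j l z : minor p i j (l *: z) = l * minor p i j z.
Proof. by rewrite /minor !mxE; ring. Qed.

Lemma minor_continuous p i j : continuous (fun z : V => nc (minor p i j z)).
Proof.
move=> z; apply: (@continuous_comp _ _ _ (minor p i j) nc); last exact: nc_continuous.
have h k l : (x 0 k * p 0 l : C) @[x --> z] --> (z 0 k * p 0 l : C).
  apply: (@cvgM C V (nbhs z) _ (fun x => x 0 k) (fun=> p 0 l)).
    exact: (@coord_continuous C 1 3 0 k z).
  exact: (@cvg_cst C (p 0 l) V (nbhs z) _).
exact: (@cvgB C C V (nbhs z) _ (fun x => x 0 i * p 0 j) (fun x => x 0 j * p 0 i) _ _ (h i j) (h j i)).
Qed.

Lemma minors_eq0 (p q : PP) : (forall i j, minor (val p) i j (val q) = 0) -> p = q.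
Proof.
move=> h; have [k pk] : exists k, val p 0 k != 0.
  have [k [_ ? _]] := firstnzP (val_P2_neq0 p); by exists k.
have e : val q = (val q 0 k / val p 0 k) *: val p.
  apply/rowP => i; rewrite mxE mulrAC; apply: (mulIf pk); rewrite mulfVK //.
  by apply/eqP; rewrite -subr_eq0 mulrC (mulrC (val p 0 k)) -/(minor (val p) i k (val q)) h.
have : val q 0 k / val p 0 k != 0.
  by apply: contra_neq (val_P2_neq0 q) => l0; rewrite e l0 scale0r.
by move=> l0; rewrite -(P2of_valK q) e P2of_scale ?val_P2_neq0 // P2of_valK.
Qed.

(** Two distinct points have a nonzero minor. Comparing the moduli of the corresponding minors of
    [z] with [p] and with [q] is homogeneous in [z], and the two strict inequalities separate the
    points. *)
Lemma PP_hausdorff : hausdorff_space PP.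
Proof.
rewrite open_hausdorff => p q pq.
have [i [j ij]] : exists i j, minor (val p) i j (val q) != 0.
  apply: contra_neqP pq => /forallNP h; apply: minors_eq0 => i j.
  by have /forallNP /(_ j) /negP /negPn /eqP := h i.
pose S p q : set V := [set z | nc (minor p i j z) < nc (minor q i j z)].
have oS p' q' : open (cone_set (S p' q') : set PP).
  rewrite open_P2open; apply: cone_open; last by apply: open_ltr; exact: minor_continuous.
  by move=> l z l0; rewrite /S /= !minor_scale !ncM ltr_pM2l // nc_gt0.
exists (cone_set (S (val p) (val q)), cone_set (S (val q) (val p))) => /=.
  rewrite !inE /cone_set /S /=.
  have e0 x : minor x i j x = 0 by rewrite /minor mulrC subrr.
  rewrite !e0 Normc.normc0 !nc_gt0; split => //.
  by rewrite (_ : minor _ i j _ = - minor (val p) i j (val q)) ?oppr_eq0 // /minor; ring.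
split => //; apply/eqP/seteqP; split => // x [].
by rewrite /cone_set /S /= => h1 h2; have := lt_trans h1 h2; rewrite ltxx.
Qed.

End CompactHausdorff.

(** * Traps *)

Section Traps.
Variables (T : ptopologicalType) (f : T -> T).
Hypotheses (cT : compact [set: T]) (hT : hausdorff_space T) (cf : continuous f).

Definition trap (U : set T) := open U /\ closure (f @` U) `<=` U.
Definition maxinv (U : set T) := \bigcap_(n in [set: nat]) (iter n f @` U).

Lemma iter_continuous n : continuous (iter n f).
Proof. by elim: n => [|n IH] x; [exact: cvg_id | apply: continuous_comp; [exact: IH | exact: cf]]. Qed.

Lemma trap_stable U n x : trap U -> U x -> U (iter n f x).
Proof.
move=> [_ h] Ux; elim: n => //= n IH; apply: h; apply: subset_closure; by exists (iter n f x).
Qed.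

Lemma maxinv_compact U : trap U -> compact (maxinv U).
Proof.
(* [U] itself is only open; replacing it by the closure of its image does not change the
   intersection and makes every term compact. *)
move=> [oU hU]; have -> : maxinv U = \bigcap_(n in [set: nat]) (iter n f @` closure (f @` U)).
  apply/seteqP; split => x h n _.
    have [y Uy <-] := h n.+1 I; exists (f y); last by rewrite -iterSr.
    by apply: subset_closure; exists y.
  by have [y Ky <-] := h n I; exists y => //; exact: hU.
apply: subclosed_compact cT _ => //; apply: closed_bigI => n _.
apply: compact_closed => //; apply: continuous_compact.
  exact/continuous_subspaceT/iter_continuous.
by apply: subclosed_compact cT _ => //; exact: closed_closure.
Qed.

Lemma maxinv_sub U : maxinv U `<=` U.
Proof. by move=> x /(_ 0%N I) [y Uy <-]. Qed.

Lemma maxinv_subset U U' : U `<=` U' -> maxinv U `<=` maxinv U'.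
Proof. by move=> s x h n _; have [y Uy <-] := h n I; exists y => //; exact: s. Qed.

Lemma periodic_maxinv U L x : trap U -> (0 < L)%N -> iter L f x = x -> U x -> maxinv U x.
Proof.
(* [n * L] is a multiple of the period and at least [n], so this iterate is an [n]-th preimage of
   [x] inside [U]. *)
move=> tU L0 per Ux n _; exists (iter (n * L - n) f x); first exact: trap_stable.
rewrite -iterD subnKC ?leq_pmulr //; elim: n => // n IH.
by rewrite mulSn iterD IH.
Qed.

(** A point in the closure of the image with [f^j y] in [C j] is approached by images [f u] with
    [f^(j+1) u] in [O j], hence in [C j.+1]; so [u] was already removed. The last stage is closed up
    by the hypothesis that sends [O N.-1] back into [C 0]. *)
Lemma trap_remove U (C O : nat -> set T) N : trap U -> (0 < N)%N ->
  (forall j, closed (C j)) -> (forall j, open (O j)) ->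
  (forall j, C j `<=` O j) -> (forall j, O j `<=` C j.+1) ->
  (forall x, U x -> O N.-1 (iter N f x) -> C 0 x) ->
  trap (U `\` \bigcup_(j in `I_N) (iter j f @^-1` C j)).
Proof.
move=> [oU hU] N0 cC oO CO OC hN; split.
  apply: openI => //; rewrite openC; apply: closed_bigcup; first exact: finite_II.
  by move=> j _; apply: closed_comp => // x _; exact: iter_continuous.
move=> y hy; split.
  by apply: hU; apply: closure_subset hy => _ [u [Uu _] <-]; exists u.
move=> [j /= jN Cy].
have [_ [[u [Uu hu] <-] Ou]] := hy _ (open_nbhs_nbhs (conj (open_comp (fun x _ => @iter_continuous j x) (oO j)) (CO _ _ Cy))).
move: Ou; rewrite /= -iterSr => Ou; apply: hu.
have [jN'|Nj] := ltnP j.+1 N; first by exists j.+1 => //=; apply: OC.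
by exists 0%N => //=; apply: hN => //; have -> : N = j.+1 by apply/eqP; rewrite eqn_leq Nj jN.
Qed.

Lemma compact_decreasing_sub (A : nat -> set T) (V : set T) :
  (forall n, compact (A n)) -> (forall n, A n.+1 `<=` A n) -> open V ->
  \bigcap_(n in [set: nat]) A n `<=` V -> exists n, A n `<=` V.
Proof.
move=> cA dA oV hV.
have mA m n : (m <= n)%N -> A n `<=` A m.
  by move=> /subnK <-; elim: (n - m)%N => // k IH; exact: subset_trans (dA _) IH.
have := cA 0%N; rewrite compact_cover => /(_ nat setT (fun n => V `|` ~` A n)) [||D _ hD].
- by move=> n _; apply: openU => //; rewrite openC; exact: compact_closed.
- move=> x _; have [Vx|nVx] := pselect (V x); first by exists 0%N => //; left.
  have [h|/existsNP [n hn]] := pselect (forall n, A n x); first by case: nVx; apply: hV => n _.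
  by exists n => //; right.
exists (\max_(n <- enum_fset D) n)%N => x Ax.
have [n nD [//|[]]] := hD x (mA _ _ (leq0n _) _ Ax).
by apply: mA Ax; exact: leq_bigmax_seq.
Qed.

Lemma quasi_not_maxinv (U : nat -> set T) (x : nat -> T) (L : nat -> nat) V :
  (forall n, trap (U n)) -> (forall n, U n.+1 `<=` U n) -> trap V ->
  (forall n, (0 < L n)%N /\ iter (L n) f (x n) = x n) ->
  (forall n, U n (x n)) -> (forall n, ~ U n.+1 (x n)) ->
  \bigcap_(n in [set: nat]) maxinv (U n) <> maxinv V.
Proof.
move=> tU dU tV px Ux nUx e.
have [n hn] : exists n, maxinv (U n) `<=` V.
  apply: compact_decreasing_sub.
  - by move=> n; exact: maxinv_compact.
  - by move=> n; exact: maxinv_subset.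
  - exact: tV.1.
  - by rewrite e; exact: maxinv_sub.
have [L0 per] := px n.
have : maxinv V (x n).
  apply: (periodic_maxinv tV L0 per); apply: hn; exact: (periodic_maxinv (tU n) L0 per).
rewrite -e => /(_ n.+1 I) /maxinv_sub; exact: nUx.
Qed.

End Traps.

Lemma trap_attracting (R : realType) (f : PP R -> PP R) U : continuous f -> trap f U ->
  attracting_set f (maxinv f U).
Proof.
move=> cf tU; split.
  by apply: compact_P2compact; apply: maxinv_compact => //; [exact: PP_compact | exact: PP_hausdorff].
by exists U; split; [rewrite -open_P2open; exact: tU.1 | split => //; rewrite P2closure_closure; exact: tU.2].
Qed.

(** * The polynomial endomorphism *)

Section PlaneMap.
Variables (R : realType) (Lam b e t : R).
Hypothesis e_gt0 : 0 < e.
Local Notation C := (Cx R).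
Local Notation V := ('rV[C]_3).
Local Notation rc := (real_complex R : R -> C).

Definition pmap (x : C * C) : C * C :=
  (rc Lam * Bp (rc t) x.1 + Xp (rc b) (rc e) x.2, Qp (rc e) x.1).

(** [Lam] stands for [1 / kappa]. The entries [rc e] on the pure fourth powers are what excludes
    common zeros on the line at infinity. *)
Definition pcoef (k : 'I_3) (i j : 'I_5) : C :=
  match nat_of_ord k, nat_of_ord i, nat_of_ord j with
  | 0%N, 1%N, 0%N => rc Lam
  | 0%N, 2%N, 0%N => rc Lam * (rc t - 8) / 4
  | 0%N, 3%N, 0%N => rc Lam * (5 - rc t) / 4
  | 0%N, 4%N, 0%N => - rc Lam / 4
  | 0%N, 0%N, 1%N => rc b
  | 0%N, 0%N, 4%N | 1%N, 4%N, 0%N => rc e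
  | 1%N, 1%N, 0%N | 2%N, 0%N, 0%N => 1
  | _, _, _ => 0
  end.

Definition hB (z u : C) : C := z * (u - z) * ((z - 2 * u) ^+ 2 + rc t * z * u) / 4.

Lemma hlift_coord0 (z : V) : hlift pcoef z 0 0 =
  rc Lam * hB (z 0 0) (z 0 2%:R) + rc b * z 0 1 * z 0 2%:R ^+ 3 + rc e * z 0 1 ^+ 4.
Proof.
rewrite mxE /hpoly; under eq_bigr do rewrite big_mkcond.
rewrite !(big_ord_recl, big_ord0) /pcoef /= /bump /= /hB.
by move: (z 0 0) (z 0 1) (z 0 2%:R) (rc Lam) (rc b) (rc e) (rc t) => z0 z1 z2 l1 b1 e1 t1; field.
Qed.

Lemma hlift_coord1 (z : V) : hlift pcoef z 0 1 =
  z 0 0 * z 0 2%:R ^+ 3 + rc e * z 0 0 ^+ 4.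
Proof.
rewrite mxE /hpoly; under eq_bigr do rewrite big_mkcond.
rewrite !(big_ord_recl, big_ord0) /pcoef /= /bump /=.
by move: (z 0 0) (z 0 1) (z 0 2%:R) (rc e) => z0 z1 z2 e1; ring.
Qed.

Lemma hlift_coord2 (z : V) : hlift pcoef z 0 2%:R = z 0 2%:R ^+ 4.
Proof.
rewrite mxE /hpoly; under eq_bigr do rewrite big_mkcond.
rewrite !(big_ord_recl, big_ord0) /pcoef /= /bump /=.
by move: (z 0 0) (z 0 1) (z 0 2%:R) => z0 z1 z2; ring.
Qed.

Lemma rc_neq0 (x : R) : x != 0 -> rc x != 0.
Proof. by rewrite (fmorph_eq0 (real_complex R)). Qed.

Lemma pcoef_nondeg : P2nondeg pcoef.
Proof.
move=> z; apply: contra_neq => h; have e0 : rc e != 0 by apply: rc_neq0; rewrite lt0r_neq0.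
have z2 : z 0 2%:R = 0.
  have := hlift_coord2 z; rewrite h mxE => /esym/eqP; rewrite expf_eq0 /= => /eqP //.
have z0 : z 0 0 = 0.
  have := hlift_coord1 z; rewrite h mxE z2 expr0n mulr0 add0r => /esym/eqP.
  by rewrite mulf_eq0 (negbTE e0) expf_eq0 /= => /eqP.
have z1 : z 0 1 = 0.
  have := hlift_coord0 z; rewrite h mxE z2 z0 /hB expr0n !mul0r mulr0 mulr0 add0r add0r => /esym/eqP.
  by rewrite mulf_eq0 (negbTE e0) expf_eq0 /= => /eqP.
by apply/rowP; apply: ord3P; rewrite mxE.
Qed.

Definition pt3 (x : C * C) : V := \row_(j < 3) match nat_of_ord j with 0%N => x.1 | 1%N => x.2 | _ => 1 end.
Definition pt (x : C * C) : PP R := P2of (pt3 x).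

Lemma pt3_neq0 x : pt3 x != 0.
Proof. by apply/eqP => /rowP /(_ 2%:R); rewrite !mxE /= => /eqP; rewrite oner_eq0. Qed.

Lemma pt_inj : injective pt.
Proof.
move=> x y h; have [l l0 hl] := P2of_val (pt3_neq0 x); have [m m0 hm] := P2of_val (pt3_neq0 y).
have hv : l *: pt3 x = m *: pt3 y by rewrite -hl -hm; exact: (congr1 val h).
have l_m : l = m.
  by have /rowP /(_ 2%:R) := hv; rewrite !mxE /= !mulr1.
move: hv; rewrite l_m => /(scalerI m0) /rowP hv.
have h0 := hv 0; have h1 := hv 1; rewrite !mxE /= in h0 h1.
by case: x y h0 h1 {h hl hm hv} => ? ? [? ?] /= -> ->.
Qed.

Lemma pt_of (p : PP R) : val p 0 2%:R != 0 ->
  p = pt (val p 0 0 / val p 0 2%:R, val p 0 1 / val p 0 2%:R).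
Proof.
move=> h; have e1 : pt3 (val p 0 0 / val p 0 2%:R, val p 0 1 / val p 0 2%:R) = (val p 0 2%:R)^-1 *: val p.
  by apply/rowP; apply: ord3P; rewrite !mxE /= ?mulVf // mulrC.
rewrite /pt e1; apply: etrans (esym (P2of_valK p)) (esym _).
by apply: P2of_scale; rewrite ?invr_eq0 // val_P2_neq0.
Qed.

Lemma endo_pt x : endo pcoef (pt x) = pt (pmap x) :> PP R.
Proof.
apply: etrans (endo_P2of pcoef_nondeg (pt3_neq0 x)) _; apply: (congr1 (@P2of R)).
apply/rowP; apply: ord3P.
- rewrite hlift_coord0 !mxE /= /hB /Bp /Xp.
  by move: x.1 x.2 (rc Lam) (rc b) (rc e) (rc t) => z0 z1 l1 b1 e1 t1; field.
- by rewrite hlift_coord1 !mxE /= /Qp expr1n mulr1.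
- by rewrite hlift_coord2 !mxE /= expr1n.
Qed.

Lemma iter_endo_pt n x : iter n (endo pcoef) (pt x) = pt (iter n pmap x) :> PP R.
Proof. by elim: n => [|n IH]; [reflexivity | exact: etrans (congr1 _ IH) (endo_pt _)]. Qed.

End PlaneMap.

(** * The homogeneous inequality that defines the trap *)

Section PlaneTrap.
Variables (R : realType) (Lam b e t : R).
Hypothesis Lam_ge : 10 ^+ 5 <= Lam.
Hypotheses (b2 : 2 <= b) (b3 : b <= 3).
Hypotheses (e_gt0 : 0 < e) (e_le : e <= 10^-1 ^+ 6).
Hypothesis t_le : `|t| <= 10^-1 ^+ 3.
Local Notation C := (Cx R).
Local Notation V := ('rV[C]_3).
Local Notation rc := (real_complex R : R -> C).
Local Notation nc := (@Normc.normc R : C -> R).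
Local Notation n2C := (n2 nc).
Local Notation F := (endo (pcoef Lam b e t) : PP R -> PP R).
Local Notation pmap := (pmap Lam b e t).
Local Notation pt := (@pt R).

Lemma ncX (x : C) n : nc (x ^+ n) = nc x ^+ n.
Proof.
elim: n => [|n IH]; first by rewrite !expr0 Normc.normc1.
by rewrite !exprS ncM IH.
Qed.

Lemma ncD_ge (x y : C) : nc x - nc y <= nc (x + y).
Proof. by have := ncD (x + y) (- y); rewrite addrK ncN; lra. Qed.

Lemma ncB_ge (x y : C) : nc x - nc y <= nc (x - y).
Proof. by have := ncD_ge x (- y); rewrite ncN. Qed.

Lemma nc_nat n : nc n%:R = n%:R.
Proof. by have := nc_real (n%:R : R); rewrite rmorph_nat normr_nat. Qed.

(** Here every factor of [hB] is bounded below by a multiple of a power of [|z|], and [Lam >= 10^5]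
    outweighs the remaining terms. *)
Lemma far_growth (z w u : C) : 38 / 10 * nc u <= nc z -> nc w <= 106 / 100 * nc z ->
  10 ^+ 3 * nc z ^+ 4 <= nc (rc Lam * hB t z u + rc b * w * u ^+ 3 + rc e * w ^+ 4).
Proof.
move=> hu hw; have u0 := nc_ge0 u; have z0 := nc_ge0 z; have w0 := nc_ge0 w.
set Z := nc z in hu hw z0 *; set T := nc u in hu u0 *; set W := nc w in hw w0 *.
have h1 : 7 / 10 * Z <= nc (u - z).
  by rewrite -ncN opprB; have := ncB_ge z u; rewrite -/Z -/T; lra.
have h2 : 47 / 100 * Z <= nc (z - 2 * u).
  by have := ncB_ge z (2 * u); rewrite ncM nc_nat -/Z -/T; lra.
have h3 : 2 / 10 * Z ^+ 2 <= nc ((z - 2 * u) ^+ 2 + rc t * z * u).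
  apply: le_trans (ncD_ge _ _); rewrite ncX !ncM nc_real -/Z -/T.
  have m1 : (47 / 100 * Z) ^+ 2 <= nc (z - 2 * u) ^+ 2.
    by rewrite ler_sqr // nnegrE ?nc_ge0 //; lra.
  have m2 : `|t| * Z * T <= 10^-1 ^+ 3 * Z * Z.
    by apply: ler_pM; [exact: mulr_ge0 | | apply: ler_wpM2r | lra].
  move: m1 m2 (sqr_ge0 Z); rewrite !expr2; nra.
have h4 : 35 / 10 ^+ 3 * Z ^+ 4 <= nc (hB t z u).
  rewrite /hB !ncM Normc.normcV nc_nat -/Z.
  have p1 : (Z * (7 / 10 * Z)) * (2 / 10 * Z ^+ 2) <= (Z * nc (u - z)) * nc ((z - 2 * u) ^+ 2 + rc t * z * u).
    apply: ler_pM => //; [|by rewrite mulr_ge0 // sqr_ge0|by apply: ler_wpM2l].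
    by rewrite !mulr_ge0.
  have q1 : Z * (7 / 10 * Z) * (2 / 10 * Z ^+ 2) = 14 / 100 * Z ^+ 4 by field.
  by move: p1; rewrite q1; lra.
have Z4 : 0 <= Z ^+ 4 by rewrite exprn_ge0.
have h5 : 35 * 10 ^+ 2 * Z ^+ 4 <= nc (rc Lam * hB t z u).
  rewrite ncM nc_real; have -> : 35 * 10 ^+ 2 * Z ^+ 4 = 10 ^+ 5 * (35 / 10 ^+ 3 * Z ^+ 4) by field.
  apply: ler_pM; [by rewrite exprn_ge0 | by rewrite mulr_ge0 // divr_ge0 // exprn_ge0 | | exact: h4].
  exact: le_trans Lam_ge (ler_norm _).
have h6 : nc (rc b * w * u ^+ 3) <= 4 * Z ^+ 4.
  rewrite 2!ncM ncX nc_real -/T -/W ger0_norm; last by move: b2; lra.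
  have -> : 4 * Z ^+ 4 = (3 * (4 / 3 * Z)) * Z ^+ 3 by field.
  apply: ler_pM; [by rewrite mulr_ge0 //; move: b2; lra | by rewrite exprn_ge0 | |].
    by apply: ler_pM => //; [move: b2; lra | lra].
  by apply: lerXn2r; rewrite ?nnegrE //; lra.
have h7 : nc (rc e * w ^+ 4) <= 4 * Z ^+ 4.
  rewrite ncM ncX nc_real -/W (gtr0_norm e_gt0).
  have -> : 4 * Z ^+ 4 = 4^-1 * (2 * Z) ^+ 4 by rewrite exprMn; field.
  apply: ler_pM; rewrite ?exprn_ge0 ?(ltW e_gt0) //.
    by apply: le_trans e_le _; lra.
  by apply: lerXn2r; rewrite ?nnegrE //; lra.
have := ncD_ge (rc Lam * hB t z u + rc b * w * u ^+ 3) (rc e * w ^+ 4).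
have := ncD_ge (rc Lam * hB t z u) (rc b * w * u ^+ 3).
move: h5 h6 h7 Z4; lra.
Qed.

Definition S0 : set V := [set z | nc (z 0 1) < Num.max (4 * nc (z 0 2%:R)) (nc (z 0 0))].
(** A closed condition inside [S0] away from the origin, since 39/10 < 4 and 1/2 < 1. It receives
    the image of [S0], which gives the closure in the definition of a trap. *)
Definition K0 : set V := [set z | nc (z 0 1) <= Num.max (39 / 10 * nc (z 0 2%:R)) (nc (z 0 0) / 2)].

(** If [|z| >= 38/10 |u|], then [|w| <= 106/100 |z|] because 4 / (38/10) < 106/100, and the growth
    of the first coordinate yields the bound by [|z| / 2]. Otherwise the new [w] is at most
    [39/10 |u|^4]. *)
Lemma S0_hlift z : S0 z -> K0 (hlift (pcoef Lam b e t) z).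
Proof.
rewrite /S0 /K0 /= hlift_coord0 hlift_coord1 hlift_coord2.
move: (z 0 0) (z 0 1) (z 0 2%:R) => z0 z1 z2 h.
have u0 := nc_ge0 z2; have p0 := nc_ge0 z0; have w0 := nc_ge0 z1.
have h1 : nc (z0 * z2 ^+ 3 + rc e * z0 ^+ 4) <= nc z0 * nc z2 ^+ 3 + 10^-1 ^+ 6 * nc z0 ^+ 4.
  apply: le_trans (ncD _ _) _; rewrite (ncM z0) (ncM (rc e)) !ncX nc_real (gtr0_norm e_gt0) lerD2l.
  by apply: ler_wpM2r e_le; rewrite exprn_ge0.
apply: le_trans h1 _; rewrite le_max; have [far|near] := leP (38 / 10 * nc z2) (nc z0).
  apply/orP; right; have hw : nc z1 <= 106 / 100 * nc z0.
    by apply: le_trans (ltW h) _; rewrite ge_max; apply/andP; split; lra.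
  have := far_growth far hw; have : nc z0 * nc z2 ^+ 3 <= nc z0 * nc z0 ^+ 3.
    by apply: ler_wpM2l => //; apply: lerXn2r; rewrite ?nnegrE //; lra.
  rewrite -exprS; have : 0 <= nc z0 ^+ 4 by rewrite exprn_ge0.
  set N := nc (_ + _ + _); move: N (nc z0 ^+ 4) (nc z0 * nc z2 ^+ 3) => N Z4 q; lra.
apply/orP; left; rewrite ncX.
have m1 : nc z0 * nc z2 ^+ 3 <= (38 / 10 * nc z2) * nc z2 ^+ 3.
  by apply: ler_wpM2r; [rewrite exprn_ge0 | exact: ltW].
have m2 : nc z0 ^+ 4 <= (4 * nc z2) ^+ 4 by apply: lerXn2r; rewrite ?nnegrE; lra.
move: m1 m2; rewrite exprMn -mulrA -exprS.
have : 0 <= nc z2 ^+ 4 by rewrite exprn_ge0.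
move: (nc z0 * nc z2 ^+ 3) (nc z2 ^+ 4) (nc z0 ^+ 4) => q Z4 r; lra.
Qed.

Lemma S0_scale : scale_inv S0.
Proof.
move=> l z l0; rewrite /S0 /= !mxE !ncM.
have -> : 4 * (nc l * nc (z 0 2%:R)) = nc l * (4 * nc (z 0 2%:R)) by ring.
by rewrite -maxr_pMr ?nc_ge0 // ltr_pM2l // nc_gt0.
Qed.

Lemma K0_scale : scale_inv K0.
Proof.
move=> l z l0; rewrite /K0 /= !mxE !ncM.
have -> : 39 / 10 * (nc l * nc (z 0 2%:R)) = nc l * (39 / 10 * nc (z 0 2%:R)) by ring.
have -> : nc l * nc (z 0 0) / 2 = nc l * (nc (z 0 0) / 2) by ring.
by rewrite -maxr_pMr ?nc_ge0 // ler_pM2l // nc_gt0.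
Qed.

Lemma K0_S0 z : z != 0 -> K0 z -> S0 z.
Proof.
rewrite /K0 /S0 /= => z0.
have [h0 h1 h2] := And3 (nc_ge0 (z 0 0)) (nc_ge0 (z 0 1)) (nc_ge0 (z 0 2%:R)).
rewrite le_max lt_max => /orP h.
have [u0|] := ltP 0 (nc (z 0 2%:R)).
  by case: h => h; [apply/orP; left; lra | have [?|?] := ltP (nc (z 0 1)) (nc (z 0 0)); rewrite ?orbT //; apply/orP; left; lra].
move=> u0; have [p0|p0] := ltP 0 (nc (z 0 0)); first by apply/orP; right; case: h; lra.
exfalso; move/eqP: z0; apply; apply/rowP; apply: ord3P; rewrite mxE; apply/eqP/negPn; rewrite -nc_gt0 -leNgt //.
by case: h; lra.
Qed.

End PlaneTrap.

(** * Preimages inside the trap *)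

Section PlanePreimages.
Variables (R : realType) (Lam b e t : R).
Hypothesis Lam_ge : 10 ^+ 5 <= Lam.
Hypotheses (b2 : 2 <= b) (b3 : b <= 3).
Hypotheses (e_gt0 : 0 < e) (e_le : e <= 10^-1 ^+ 6).
Hypothesis t_le : `|t| <= 10^-1 ^+ 3.
Local Notation C := (Cx R).
Local Notation V := ('rV[C]_3).
Local Notation rc := (real_complex R : R -> C).
Local Notation nc := (@Normc.normc R : C -> R).
Local Notation n2C := (n2 nc).
Local Notation F := (endo (pcoef Lam b e t) : PP R -> PP R).
Local Notation pmap := (pmap Lam b e t).
Local Notation pt := (@pt R).


Local Notation S0 := (@S0 R).
Local Notation K0 := (@K0 R).

Definition U0 : set (PP R) := cone_set S0.

Lemma ncZ_continuous (a : R) (j : 'I_3) : continuous (fun z : V => a * nc (z 0 j)).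
Proof.
move=> z; apply: (@cvgM R V (nbhs z) _ (fun=> a) (fun z => nc (z 0 j))).
  exact: (@cvg_cst R a V (nbhs z) _).
exact: coord_nc_continuous.
Qed.

Lemma U0_trap : trap F U0.
Proof.
split.
  rewrite open_P2open; apply: cone_open; first exact: S0_scale.
  have -> : S0 = [set z | nc (z 0 1) < 4 * nc (z 0 2%:R)] `|` [set z | nc (z 0 1) < nc (z 0 0)].
    apply/seteqP; split => z; rewrite /S0 /= lt_max => /orP //.
  by apply: openU; apply: open_ltr; first [exact: coord_nc_continuous | exact: ncZ_continuous].
have cK : closed (cone_set K0 : set (PP R)).
  rewrite -openC; have -> : ~` (cone_set K0 : set (PP R)) = cone_set (~` K0) by [].
  rewrite open_P2open; apply: cone_open.
    by move=> l z l0 h; rewrite /setC /= (scale_invE _ (@K0_scale R) l0).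
  have -> : ~` K0 = [set z | 39 / 10 * nc (z 0 2%:R) < nc (z 0 1)]
      `&` [set z | 1 / 2 * nc (z 0 0) < nc (z 0 1)].
    apply/seteqP; split => z; rewrite /setC /K0 /= => h.
      by move: h => /negP; rewrite -ltNge gt_max => /andP[h1 h2]; split; lra.
    by move: h => [h1 h2]; apply/negP; rewrite -ltNge gt_max; apply/andP; split; lra.
  by apply: openI; apply: open_ltr; first [exact: coord_nc_continuous | exact: ncZ_continuous].
apply: (@subset_trans (PP R) (cone_set K0)).
  have e1 := (closure_id (cone_set K0 : set (PP R))).1 cK; rewrite [X in _ `<=` X]e1.
  apply: (@closure_subset (PP R)) => _ [p Up <-]; rewrite /cone_set /=.
  rewrite (scale_inv_P2of (@K0_scale R)); last exact: pcoef_nondeg e_gt0 _ (val_P2_neq0 _).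
  exact: S0_hlift.
by move=> p; apply: K0_S0; exact: val_P2_neq0.
Qed.

Lemma U0_proper : U0 <> setT.
Proof.
move=> h; pose z : V := \row_j (j == 1)%:R.
have z0 : z != 0 by apply/eqP => /rowP /(_ 1); rewrite !mxE /= => /eqP; rewrite oner_eq0.
have : U0 (P2of z) by rewrite h.
have [e1 [e2 e3]] : z 0 0 = 0 /\ z 0 1 = 1 /\ z 0 2%:R = 0 by rewrite !mxE.
rewrite /U0 /cone_set /= (scale_inv_P2of (@S0_scale R)) // /S0 /mkset e1 e2 e3.
by rewrite Normc.normc0 Normc.normc1 mulr0 maxxx ltr10.
Qed.

Lemma U0_pt u : U0 (pt u) <-> nc u.2 < Num.max 4 (nc u.1).
Proof.
rewrite /U0 /cone_set /= (scale_inv_P2of (@S0_scale R)) ?pt3_neq0 // /S0 /mkset.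
have [e1 [e2 e3]] : pt3 u 0 0 = u.1 /\ pt3 u 0 1 = u.2 /\ pt3 u 0 2%:R = 1 by rewrite !mxE.
by rewrite e1 e2 e3 Normc.normc1 mulr1.
Qed.

Lemma pmap_far u : 38 / 10 <= nc u.1 -> nc u.2 <= 106 / 100 * nc u.1 -> 3 < nc (pmap u).1.
Proof.
move=> h1 h2; have := @far_growth R Lam b e t Lam_ge b2 b3 e_gt0 e_le t_le u.1 u.2 1.
rewrite Normc.normc1 mulr1 => /(_ h1 h2).
have -> : rc Lam * hB t u.1 1 + rc b * u.2 * 1 ^+ 3 + rc e * u.2 ^+ 4 = (pmap u).1.
  rewrite /pmap /= /Bp /Xp /hB /=.
  by move: u.1 u.2 (rc Lam) (rc b) (rc e) (rc t) => z0 z1 l1 b1 e1 t1; field.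
apply: lt_le_trans; have : (38 / 10) ^+ 4 <= nc u.1 ^+ 4.
  by apply: lerXn2r; rewrite ?nnegrE ?nc_ge0 //; lra.
lra.
Qed.

(** A point of the trap with [|z| >= 38/10] has an image with first coordinate above 3. For the
    others the second coordinate [z + eps z^4] of the image bounds [z], and the trap bounds [w]. *)
Lemma pmap_bounded_preimage u : nc u.2 < Num.max 4 (nc u.1) ->
  nc (pmap u).1 < 3 -> nc (pmap u).2 < 3 -> nc u.1 <= 7 / 2 /\ nc u.2 <= 4.
Proof.
move=> hu x1 x2; have u1 : nc u.1 < 38 / 10.
  rewrite ltNge; apply/negP => far; have : 3 < nc (pmap u).1.
    apply: (pmap_far far); apply: le_trans (ltW hu) _; rewrite ge_max; apply/andP; split; lra.
  by move=> /(lt_trans x1); rewrite ltxx.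
split; last by move: hu; rewrite lt_max => /orP[]; lra.
have : nc u.1 - nc (rc e * u.1 ^+ 4) <= nc (pmap u).2 by exact: ncD_ge.
rewrite ncM ncX nc_real (gtr0_norm e_gt0).
have : e * nc u.1 ^+ 4 <= 10^-1 ^+ 6 * 4 ^+ 4.
  apply: ler_pM; [exact: ltW | by rewrite exprn_ge0 ?nc_ge0 | exact: e_le |].
  by apply: lerXn2r; rewrite ?nnegrE ?nc_ge0 //; lra.
move: x2; move: (nc (pmap u).2) (e * nc u.1 ^+ 4) => r s; lra.
Qed.

(** The line at infinity is mapped into itself, so a preimage of an affine point is affine. *)
Lemma U0_preimage p x : U0 p -> F p = pt x -> nc x.1 < 3 -> nc x.2 < 3 ->
  exists u, [/\ p = pt u, pmap u = x, nc u.1 <= 7 / 2 & nc u.2 <= 4].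
Proof.
move=> Up Fp x1 x2.
have p2 : val p 0 2%:R != 0.
  apply/eqP => p2; have [l l0 hl] := P2of_val (@pcoef_nondeg R Lam b e t e_gt0 _ (val_P2_neq0 p)).
  have [m m0 hm] := P2of_val (pt3_neq0 x).
  have : l *: hlift (pcoef Lam b e t) (val p) = m *: pt3 x.
    by rewrite -hl -hm; exact: (congr1 val Fp).
  move=> /rowP /(_ 2%:R); rewrite mxE hlift_coord2 p2 expr0n mulr0 !mxE /= mulr1 => m0'.
  by rewrite -m0' eqxx in m0.
have [u pu] : exists u, p = pt u by exists (val p 0 0 / val p 0 2%:R, val p 0 1 / val p 0 2%:R); exact: pt_of.
have ux : pmap u = x by apply: (@pt_inj R); rewrite -Fp pu; apply: esym; exact: endo_pt.
have hu : nc u.2 < Num.max 4 (nc u.1) by apply/U0_pt; rewrite -pu.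
by rewrite -ux in x1 x2; have [h1 h2] := pmap_bounded_preimage hu x1 x2; exists u; split.
Qed.

Lemma ncM_le (x y : C) (a c : R) : nc x <= a -> nc y <= c -> nc (x * y) <= a * c.
Proof. by move=> ha hc; rewrite ncM; apply: ler_pM => //; exact: nc_ge0. Qed.

Lemma ncD_le (x y : C) (a c : R) : nc x <= a -> nc y <= c -> nc (x + y) <= a + c.
Proof. by move=> ha hc; apply: le_trans (ncD _ _) _; exact: lerD. Qed.

Lemma ncB_le (x y : C) (a c : R) : nc x <= a -> nc y <= c -> nc (x - y) <= a + c.
Proof. by move=> ha hc; apply: ncD_le => //; rewrite ncN. Qed.

Lemma nc_S4 (x y : C) : nc x <= 4 -> nc y <= 4 -> nc (S4 (rc e) x y) <= 1 / 2.
Proof.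
move=> hx hy; have h3 (u v w : C) : nc u <= 4 -> nc v <= 4 -> nc w <= 4 -> nc (u * v * w) <= 4 * 4 * 4.
  by move=> hu hv hw; do 2 ?apply: ncM_le.
have he : nc (rc e) <= 10^-1 ^+ 6 by rewrite nc_real gtr0_norm.
apply: le_trans (ncM_le he (ncD_le (ncD_le (ncD_le (h3 _ _ _ hx hx hx) (h3 _ _ _ hx hx hy))
  (h3 _ _ _ hx hy hy)) (h3 _ _ _ hy hy hy))) _; lra.
Qed.

Lemma nc_SB (x y : C) : nc x <= 4 -> nc y <= 4 -> nc (SB (rc t) x y) <= 200.
Proof.
move=> hx hy; have h2 (u v : C) : nc u <= 4 -> nc v <= 4 -> nc (u * v) <= 4 * 4 by exact: ncM_le.
have h3 (u v w : C) : nc u <= 4 -> nc v <= 4 -> nc w <= 4 -> nc (u * v * w) <= 4 * 4 * 4.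
  by move=> hu hv hw; do 2 ?apply: ncM_le.
have ht : nc (rc t) <= 10^-1 ^+ 3 by rewrite nc_real.
have hn n : nc n%:R <= n%:R by rewrite nc_nat.
have hi : nc 4^-1 <= 4^-1 by rewrite Normc.normcV nc_nat.
have q2 := ncD_le (ncD_le (h2 _ _ hx hx) (h2 _ _ hx hy)) (h2 _ _ hy hy).
have q3 := ncD_le (ncD_le (ncD_le (h3 _ _ _ hx hx hx) (h3 _ _ _ hx hx hy)) (h3 _ _ _ hx hy hy)) (h3 _ _ _ hy hy hy).
have q1 := ncD_le hx hy.
have := ncM_le (ncB_le (ncD_le (ncB_le (ncD_le (ncB_le (hn 4) (ncM_le (hn 8) q1)) (ncM_le (hn 5) q2)) q3)
  (ncM_le ht q1)) (ncM_le ht q2)) hi.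
move=> h; apply: le_trans h _; lra.
Qed.

(** [z] is recovered from the second coordinate, of slope near 1, and then [w] from the first, of
    slope near [b] in [w]; on the bidisc of radius 4 the quartic terms change these slopes by at
    most 1/2. *)
Lemma pmap_inverse_lipschitz : exists2 M, 1 <= M & forall u v,
  nc u.1 <= 4 -> nc u.2 <= 4 -> nc v.1 <= 4 -> nc v.2 <= 4 ->
  n2C (u - v) <= M * n2C (pmap u - pmap v).
Proof.
have L0 : 0 <= Lam by move: Lam_ge; apply: le_trans; rewrite exprn_ge0.
exists (2 + 400 * Lam); first by move: L0; lra.
move=> u v u1 u2 v1 v2; set D := n2C (pmap u - pmap v).
have d1 : nc (pmap u - pmap v).1 <= D := nrm1_le nc _.
have d2 : nc (pmap u - pmap v).2 <= D := nrm2_le nc _.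
have e2 : (pmap u - pmap v).2 = (u - v).1 + S4 (rc e) u.1 v.1 * (u - v).1.
  rewrite /pmap /Qp /S4 /=; move: (rc e) u.1 v.1 => ? ? ?; ring.
have e1 : (pmap u - pmap v).1 = rc b * (u - v).2 + (S4 (rc e) u.2 v.2 * (u - v).2
     + rc Lam * (SB (rc t) u.1 v.1 * (u - v).1)).
  rewrite /pmap /Bp /Xp /S4 /SB /=.
  by move: (rc e) (rc b) (rc t) (rc Lam) u.1 v.1 u.2 v.2 => ? ? ? ? ? ? ? ?; field.
have D0 : 0 <= D by apply: le_trans d2; exact: nc_ge0.
have x1 : nc (u - v).1 <= 2 * D.
  move: d2; rewrite e2; have := ncD_ge (u - v).1 (S4 (rc e) u.1 v.1 * (u - v).1).
  by have := ncM_le (nc_S4 u1 v1) (lexx (nc (u - v).1)); lra.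
have x2 : nc (u - v).2 <= D + Lam * (200 * (2 * D)).
  move: d1; rewrite e1.
  have m1 := ncM_le (nc_S4 u2 v2) (lexx (nc (u - v).2)).
  have m2 : nc (rc Lam * (SB (rc t) u.1 v.1 * (u - v).1)) <= Lam * (200 * (2 * D)).
    by apply: ncM_le; [rewrite nc_real ger0_norm | apply: ncM_le => //; exact: nc_SB].
  have m3 := ncD_ge (rc b * (u - v).2) (S4 (rc e) u.2 v.2 * (u - v).2
     + rc Lam * (SB (rc t) u.1 v.1 * (u - v).1)).
  have m4 := ncD (S4 (rc e) u.2 v.2 * (u - v).2) (rc Lam * (SB (rc t) u.1 v.1 * (u - v).1)).
  have m5 : 2 * nc (u - v).2 <= nc (rc b * (u - v).2).
    rewrite ncM nc_real ger0_norm; last by move: b2; lra.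
    by apply: ler_wpM2r b2; exact: nc_ge0.
  have m6 := nc_ge0 (u - v).2; lra.
have LD : 0 <= Lam * D by exact: mulr_ge0.
by rewrite n2_le; apply/andP; split; lra.
Qed.

End PlanePreimages.

(** * Pulling back along a cycle *)

Section SourcesInThePlane.
Variables (R : realType) (b : R).
Hypotheses (b2 : 2 <= b) (b3 : b <= 3).
Local Notation C := (Cx R).
Local Notation V := ('rV[C]_3).
Local Notation nc := (@Normc.normc R : C -> R).
Local Notation n2C := (n2 nc).
Local Notation kk := (kk R).

Definition fcoef := pcoef (kapf b)^-1 b kk (tau b).
Local Notation F := (endo fcoef : PP R -> PP R).
Local Notation pt := (@pt R).
Local Notation U0 := (@U0 R).
Local Notation nNC := (nN nc).

Lemma fcoef_Lam : 10 ^+ 5 <= (kapf b)^-1.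
Proof.
have h1 := kapf_gt0 b2 b3; have h2 := kapf_le b2 b3.
rewrite -[_ ^+ _]invrK lef_pV2 ?posrE ?invr_gt0 ?exprn_gt0 //.
by apply: le_trans h2 _; have := kk_small R; rewrite -exprVn; lra.
Qed.

Lemma fcoef_e : kk <= 10^-1 ^+ 6. Proof. exact: kk_small. Qed.

Lemma fcoef_t : `|tau b| <= 10^-1 ^+ 3.
Proof. by have [bu _ _] := homS_spec b2 b3; exact: (box_t (kk_gt0 R) (kk_small R) bu). Qed.

Lemma fcoef_nondeg : P2nondeg fcoef.
Proof. exact/pcoef_nondeg/kk_gt0. Qed.

Lemma F_continuous : continuous F.
Proof. exact: endo_continuous fcoef_nondeg. Qed.

Lemma F_trap : trap F U0.
Proof. exact: (U0_trap fcoef_Lam b2 b3 (kk_gt0 R) fcoef_e fcoef_t). Qed.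

Lemma F_pt n x : iter n F (pt x) = pt (iter n (fC b) x).
Proof. exact: iter_endo_pt (kk_gt0 R) n x. Qed.

Lemma F_preimage p x : U0 p -> F p = pt x -> nc x.1 < 3 -> nc x.2 < 3 ->
  exists u, [/\ p = pt u, fC b u = x, nc u.1 <= 4 & nc u.2 <= 4].
Proof.
move=> h1 h2 h3 h4.
have [u [q1 q2 q3 q4]] := U0_preimage fcoef_Lam b2 b3 (kk_gt0 R) fcoef_e fcoef_t h1 h2 h3 h4.
by exists u; split; [exact: q1 | exact: q2 | move: q3; lra | exact: q4].
Qed.

(** As long as the error is below 1/4, the points stay in the bidisc of radius 3 about 0; their
    preimages in the trap then lie where the inverse is Lipschitz, so the backward chain follows the
    cycle. *)
Lemma F_pullback L x M (p : PP R) (v : C * C) (del : R) : (0 < L)%N -> 1 <= M ->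
  (forall u v, nc u.1 <= 4 -> nc u.2 <= 4 -> nc v.1 <= 4 -> nc v.2 <= 4 ->
     n2C (u - v) <= M * n2C (fC b u - fC b v)) ->
  iter L (fC b) x = x ->
  (forall j, (j < L)%N -> nc (iter j (fC b) x).1 <= 5 / 2 /\ nc (iter j (fC b) x).2 <= 5 / 2) ->
  U0 p -> iter L F p = pt v -> n2C (v - x) <= del -> M ^+ L * del <= 1 / 4 ->
  exists u, [/\ p = pt u, iter L (fC b) u = v & n2C (u - x) <= M ^+ L * del].
Proof.
move=> L0 M1 hM per hx Up Fp hv small.
have M0 : 0 <= M by move: M1; lra.
have hx' j : (j <= L)%N -> nc (iter j (fC b) x).1 <= 5 / 2 /\ nc (iter j (fC b) x).2 <= 5 / 2.
  by rewrite leq_eqVlt => /predU1P[->|/hx //]; rewrite per; exact: (hx 0%N L0).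
have del0 : 0 <= del by apply: le_trans hv; rewrite /n2 le_max nc_ge0.
have small' j : (j <= L)%N -> M ^+ j * del <= 1 / 4.
  move=> jL; apply: le_trans small; apply: ler_wpM2r => //; exact: ler_weXn2l.
have claim j : (j <= L)%N -> exists u, [/\ iter (L - j) F p = pt u, iter j (fC b) u = v &
    n2C (u - iter (L - j) (fC b) x) <= M ^+ j * del].
  elim: j => [|j IH] jL; first by exists v; rewrite subn0 per expr0 mul1r; split.
  have [w [Fw hw bw]] := IH (ltnW jL).
  have sj : (L - j = (L - j.+1).+1)%N by rewrite subnSK.
  have [w1 w2] : nc w.1 < 3 /\ nc w.2 < 3.
    have := le_trans bw (small' j (ltnW jL)); rewrite n2_le => /andP[d1 d2].
    have [y1 y2] := hx' (L - j)%N (leq_subr _ _).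
    by split; [have := ncD (w.1 - (iter (L - j) (fC b) x).1) (iter (L - j) (fC b) x).1
              |have := ncD (w.2 - (iter (L - j) (fC b) x).2) (iter (L - j) (fC b) x).2];
       rewrite subrK => q; apply: le_lt_trans q _; move: d1 d2 y1 y2 => /=;
       set c1 := nc _; set c2 := nc _; set c3 := nc _; set c4 := nc _; lra.
  rewrite sj in Fw bw.
  have [u [e1 e2 u1 u2]] := F_preimage (trap_stable (L - j.+1) F_trap Up) Fw w1 w2.
  exists u; split; [exact: e1 | by rewrite iterSr e2 |].
  have [y1 y2] := hx' (L - j.+1)%N (leq_subr _ _).
  apply: le_trans (hM _ _ u1 u2 _ _) _; [by apply: le_trans y1 _; lra | by apply: le_trans y2 _; lra |].
  rewrite e2 -iterS exprS -mulrA; exact: ler_wpM2l.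
have [u [e1 e2 e3]] := claim L (leqnn _); rewrite subnn in e1 e3.
by exists u; split.
Qed.

End SourcesInThePlane.

(** * Balls around a source *)

Section SourceRemoval.
Variables (R : realType) (b : R).
Hypotheses (b2 : 2 <= b) (b3 : b <= 3).
Local Notation C := (Cx R).
Local Notation V := ('rV[C]_3).
Local Notation nc := (@Normc.normc R : C -> R).
Local Notation n2C := (n2 nc).

Local Notation F := (endo (fcoef b) : PP R -> PP R).
Local Notation pt := (@pt R).
Local Notation U0 := (@U0 R).
Local Notation nNC := (nN nc).


(** [F_pullback] first puts the preimage close to [x]; there the expansion of the source applies,
    and read backwards it contracts by 2/3. *)
Lemma source_pullback L x w0 k rho : (0 < L)%N -> source b L x w0 k rho ->
  exists2 s, 0 < s & forall (p : PP R) v, U0 p -> iter L F p = pt v -> nNC w0 k (v - x) <= s ->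
    exists2 u, p = pt u & 3 / 2 * nNC w0 k (u - x) <= nNC w0 k (v - x).
Proof.
move=> L0 [per hx _ [k1 rho0] hexp].
have [M M1 hM] := pmap_inverse_lipschitz (fcoef_Lam b2 b3) b2 (kk_gt0 R) (fcoef_e R) (fcoef_t b2 b3).
have A0 : 0 < 1 + nc w0 by have := nc_ge0 w0; lra.
have ML0 : 0 < M ^+ L by apply: exprn_gt0; apply: lt_le_trans M1.
pose r := Num.min (1 / 4) rho; have r0 : 0 < r by rewrite lt_min rho0 andbT; lra.
have [r1 r2] : r <= 1 / 4 /\ r <= rho by rewrite /r !ge_min !lexx orbT.
exists (r / (M ^+ L * (1 + nc w0))); first by rewrite divr_gt0 // mulr_gt0.
move=> p v Up Fp hv.
have hv2 : n2C (v - x) <= r / M ^+ L.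
  apply: le_trans (n2_le_nN (@ncD R) (@ncM R) (@nc_real R) w0 (v - x) k1) _.
  apply: le_trans (ler_wpM2l (ltW A0) hv) _.
  rewrite (_ : (1 + nc w0) * (r / (M ^+ L * (1 + nc w0))) = r / M ^+ L) //.
  by move: (M ^+ L) (1 + nc w0) ML0 A0 => m a m0 a0; field; rewrite !lt0r_neq0.
have e1 : M ^+ L * (r / M ^+ L) = r by rewrite mulrC divfK // lt0r_neq0.
have [|u [pu Lu ux]] := F_pullback b2 b3 L0 M1 hM per hx Up Fp hv2; first by rewrite e1.
exists u; first exact: pu.
by rewrite -Lu; apply: hexp; rewrite e1 in ux; apply: le_trans r2.
Qed.

Section Balls.
Variables (x : C * C) (w0 : C) (k : R).
Hypothesis k1 : 1 <= k.

(** For a representative [z] of the affine point [u] this is [u - x] times the last coordinate,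
    which makes a ball a homogeneous condition. *)
Definition bform (z : V) : C * C := (z 0 0 - x.1 * z 0 2%:R, z 0 1 - x.2 * z 0 2%:R).
Definition osph (s : R) : set V := [set z | nNC w0 k (bform z) < s * nc (z 0 2%:R)].
Definition csph (s : R) : set V := [set z | nNC w0 k (bform z) <= s * nc (z 0 2%:R)].
Definition oball s : set (PP R) := cone_set (osph s).
Definition cball s : set (PP R) := cone_set (csph s).

Lemma bform_scale l z : nNC w0 k (bform (l *: z)) = nc l * nNC w0 k (bform z).
Proof.
rewrite /bform /nN /shear /= !mxE.
have -> : l * z 0 0 - x.1 * (l * z 0 2%:R) = l * (z 0 0 - x.1 * z 0 2%:R) by ring.
have -> : l * z 0 1 - x.2 * (l * z 0 2%:R) - w0 * (l * (z 0 0 - x.1 * z 0 2%:R)) =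
  l * (z 0 1 - x.2 * z 0 2%:R - w0 * (z 0 0 - x.1 * z 0 2%:R)) by ring.
by rewrite !(ncM l) mulrCA maxr_pMr // nc_ge0.
Qed.

Lemma osph_scale s : scale_inv (osph s).
Proof. by move=> l z l0; rewrite /osph /mkset bform_scale mxE ncM mulrCA ltr_pM2l // nc_gt0. Qed.

Lemma csph_scale s : scale_inv (csph s).
Proof. by move=> l z l0; rewrite /csph /mkset bform_scale mxE ncM mulrCA ler_pM2l // nc_gt0. Qed.

Lemma bform_pt u : bform (pt3 u) = u - x.
Proof. by rewrite /bform !mxE /= !mulr1. Qed.

Lemma oball_pt u s : oball s (pt u) <-> nNC w0 k (u - x) < s.
Proof.
rewrite /oball /cone_set /mkset (scale_inv_P2of (@osph_scale s)) ?pt3_neq0 // /osph /mkset bform_pt.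
by have -> : pt3 u 0 2%:R = 1 by [rewrite mxE]; rewrite Normc.normc1 mulr1.
Qed.

Lemma cball_pt u s : cball s (pt u) <-> nNC w0 k (u - x) <= s.
Proof.
rewrite /cball /cone_set /mkset (scale_inv_P2of (@csph_scale s)) ?pt3_neq0 // /csph /mkset bform_pt.
by have -> : pt3 u 0 2%:R = 1 by [rewrite mxE]; rewrite Normc.normc1 mulr1.
Qed.

Lemma oball_cball s s' : s <= s' -> oball s `<=` cball s'.
Proof.
move=> ss p; rewrite /oball /cball /cone_set /osph /csph /mkset => /ltW h.
by apply: le_trans h _; apply: ler_wpM2r => //; exact: nc_ge0.
Qed.

Lemma nN_bound_eq0 (y : C * C) : nNC w0 k y <= 0 -> y = 0.
Proof.
rewrite /nN ge_max => /andP[h1 h2].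
have y1 : y.1 = 0 by apply/eqP/negPn; rewrite -nc_gt0 -leNgt.
have y2 : y.2 = 0.
  apply/eqP/negPn; rewrite -nc_gt0 -leNgt; move: h2; rewrite /shear y1 mulr0 subr0.
  by rewrite pmulr_rle0 //; apply: lt_le_trans k1.
by case: y y1 y2 {h1 h2} => ? ? /= -> ->.
Qed.

(** On the line at infinity the bound is 0, which would force the other two coordinates to vanish as
    well. *)
Lemma cball_is_pt s p : cball s p -> exists u, p = pt u.
Proof.
rewrite /cball /cone_set /csph /mkset => h.
have p2 : val p 0 2%:R != 0.
  apply/eqP => p2; move: h; rewrite /bform p2 !mulr0 !subr0 Normc.normc0 mulr0 => /nN_bound_eq0 [p0 p1].
  have := val_P2_neq0 p => /eqP; apply; apply/rowP; apply: ord3P; rewrite mxE; first exact: p0.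
    exact: p1.
  exact: p2.
by exists (val p 0 0 / val p 0 2%:R, val p 0 1 / val p 0 2%:R); exact: pt_of.
Qed.

Lemma linear_form_continuous (a : R) (c0 c1 c2 : C) :
  continuous (fun z : V => a * nc (c0 * z 0 0 + c1 * z 0 1 + c2 * z 0 2%:R)).
Proof.
move=> z; apply: (@cvgM R V (nbhs z) _ (fun=> a) (fun z => nc _)).
  exact: (@cvg_cst R a V (nbhs z) _).
apply: (@continuous_comp _ _ _ (fun z : V => c0 * z 0 0 + c1 * z 0 1 + c2 * z 0 2%:R) nc); last exact: nc_continuous.
have h (c : C) j : (c * y 0 j : C) @[y --> z] --> (c * z 0 j : C).
  apply: (@cvgM C V (nbhs z) _ (fun=> c) (fun y => y 0 j)).
    exact: (@cvg_cst C c V (nbhs z) _).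
  exact: (@coord_continuous C 1 3 0 j z).
apply: (@cvgD C C V (nbhs z) _ (fun y => c0 * y 0 0 + c1 * y 0 1) (fun y => c2 * y 0 2%:R)); last exact: h.
by apply: (@cvgD C C V (nbhs z) _ (fun y => c0 * y 0 0) (fun y => c1 * y 0 1)); exact: h.
Qed.

Lemma nN_bformE z : nNC w0 k (bform z) =
  Num.max (1 * nc (1 * z 0 0 + 0 * z 0 1 + (- x.1) * z 0 2%:R))
    (k * nc (- w0 * z 0 0 + 1 * z 0 1 + (w0 * x.1 - x.2) * z 0 2%:R)).
Proof.
rewrite /nN /bform /shear /=; congr (Num.max _ _).
  by rewrite mul1r; congr (nc _); ring.
by congr (k * nc _); ring.
Qed.

Lemma oball_open s : open (oball s).
Proof.
rewrite open_P2open; apply: cone_open; first exact: osph_scale.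
rewrite /osph; under eq_set => z do rewrite nN_bformE gt_max.
rewrite (_ : [set _ | _] = [set z : V | 1 * nc (1 * z 0 0 + 0 * z 0 1 + (- x.1) * z 0 2%:R) < s * nc (z 0 2%:R)]
  `&` [set z : V | k * nc (- w0 * z 0 0 + 1 * z 0 1 + (w0 * x.1 - x.2) * z 0 2%:R) < s * nc (z 0 2%:R)]).
  by apply: openI; apply: open_ltr; first [exact: linear_form_continuous | exact: ncZ_continuous].
by apply/seteqP; split => z; rewrite /setI /mkset => /andP.
Qed.

Lemma cball_closed s : closed (cball s).
Proof.
rewrite -openC; have -> : ~` cball s = cone_set (~` csph s) by [].
rewrite open_P2open; apply: cone_open.
  by move=> l z l0 h; rewrite /setC /mkset (scale_invE _ (@csph_scale s) l0).
rewrite (_ : ~` _ = [set z : V | s * nc (z 0 2%:R) < 1 * nc (1 * z 0 0 + 0 * z 0 1 + (- x.1) * z 0 2%:R)]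
  `|` [set z : V | s * nc (z 0 2%:R) < k * nc (- w0 * z 0 0 + 1 * z 0 1 + (w0 * x.1 - x.2) * z 0 2%:R)]).
  by apply: openU; apply: open_ltr; first [exact: linear_form_continuous | exact: ncZ_continuous].
apply/seteqP; split => z; rewrite /setC /setU /csph /mkset nN_bformE => h.
  by apply/orP; rewrite -lt_max ltNge; apply/negP.
by apply/negP; rewrite -ltNge lt_max; apply/orP.
Qed.

End Balls.

End SourceRemoval.

Lemma iter_period (T : Type) (f : T -> T) n m y : iter n f y = y -> iter (m * n) f y = y.
Proof. by move=> h; rewrite iterM iter_fix. Qed.

(** For a point of period [n], going [n * L - L] steps forward amounts to going [L] steps back. *)
Lemma iter_period_pull (T : Type) (f : T -> T) n L i y : (0 < n)%N -> iter n f y = y ->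
  iter L f (iter (i.+1 * (n * L - L)) f y) = iter (i * (n * L - L)) f y.
Proof.
move=> n0 h; rewrite -iterD mulSn addnA subnKC ?leq_pmull // addnC iterD.
have -> // : iter (n * L) f y = y by rewrite mulnC; exact: iter_period.
Qed.

(** * Removing one source from a trap *)

Section QuasiAttractor.
Variables (R : realType) (b : R).
Hypotheses (b2 : 2 <= b) (b3 : b <= 3).
Local Notation C := (Cx R).
Local Notation V := ('rV[C]_3).
Local Notation nc := (@Normc.normc R : C -> R).
Local Notation n2C := (n2 nc).

Local Notation F := (endo (fcoef b) : PP R -> PP R).
Local Notation pt := (@pt R).
Local Notation U0 := (@U0 R).
Local Notation nNC := (nN nc).



Lemma nN_eq0 (w0 : C) (k : R) : nNC w0 k 0 = 0.
Proof.
rewrite /nN /shear (_ : (0 : C * C).1 = 0) // (_ : (0 : C * C).2 = 0) //.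
by rewrite mulr0 subr0 Normc.normc0 mulr0 maxxx.
Qed.

(** The removed set is built from balls about one point of the cycle, with radii increasing slowly
    enough for [trap_remove]. A periodic orbit in the trap that meets it can be followed backwards
    for ever, each turn contracting by 2/3, so it must be the removed cycle. *)
Lemma source_removal L x w0 k rho : (0 < L)%N -> source b L x w0 k rho ->
  exists Rm : set (PP R), [/\ Rm (pt x),
    forall U, trap F U -> U `<=` U0 -> trap F (U `\` Rm) &
    forall n (y : PP R), (0 < n)%N -> iter n F y = y -> U0 y -> Rm y -> exists j, iter j F y = pt x].
Proof.
move=> L0 src; have [s s0 pull] := source_pullback b2 b3 L0 src; have [_ _ _ [k1 _] _] := src.
have Lr : 0 < (L%:R : R) by rewrite ltr0n.
(* The radii grow from [s / 2] at 0 to [3 / 4 * s] at [L], and 2/3 of 3/4 is 1/2: a backward turn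
   lands in the first ball. The argument is real so that the open balls fit at half-integers. *)
pose r j : R := s / 2 * (1 + j / (2 * L%:R)).
have rD i j : i <= j -> r i <= r j.
  by move=> ij; apply: ler_wpM2l; [lra|]; rewrite lerD2l ler_pM2r // invr_gt0; lra.
have rs j : j <= L%:R -> r j <= s * (3 / 4).
  move=> jL; apply: le_trans (rD _ _ jL) _; rewrite /r (_ : L%:R / (2 * L%:R) = 1 / 2 :> R); first lra.
  by field; rewrite lt0r_neq0.
pose Cj j := cball x w0 k (r j%:R); pose Oj j := oball x w0 k (r (j%:R + 1 / 2)).
have kge0 : 0 <= k by move: k1; lra.
exists (\bigcup_(j in `I_L) (iter j F @^-1` Cj j)); split.
- exists 0%N => //; apply/cball_pt; rewrite subrr nN_eq0.
  by rewrite /r mul0r addr0 mulr1; lra.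
- move=> U tU UU0; apply: (@trap_remove _ _ (@F_continuous R b) U Cj Oj L tU L0).
  + by move=> j; exact: cball_closed.
  + by move=> j; exact: oball_open.
  + move=> j p; rewrite /Cj /Oj => Cp; have [u pu] := cball_is_pt k1 Cp; move: Cp; rewrite pu.
    move=> /cball_pt h; apply/oball_pt; apply: le_lt_trans h _.
    by rewrite /r ltr_pM2l ?ltrD2l ?ltr_pM2r ?invr_gt0 //; lra.
  + by move=> j; apply: oball_cball; apply: rD; rewrite -(natr1 j); lra.
  + move=> p Up Op; have Cp := oball_cball (lexx _) Op; have [v pv] := cball_is_pt k1 Cp.
    have hv : nNC w0 k (v - x) <= s * (3 / 4).
      rewrite pv in Cp; move/cball_pt: Cp => h; apply: le_trans h _; apply: rs.
      by rewrite -[X in _ <= X%:R](prednK L0) -(natr1 L.-1); lra.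
    have [|u pu hu] := pull p v (UU0 _ Up) pv; first by move: hv; lra.
    rewrite /Cj pu; apply/cball_pt; rewrite /r mul0r addr0 mulr1; move: hu hv.
    by move: (nNC w0 k (u - x)) (nNC w0 k (v - x)) => a c; lra.
move=> n y n0 per Uy [j /= jL Cy]; exists j.
have [u yu] := cball_is_pt k1 Cy; set y' := iter j F y in Cy yu *.
have hu : nNC w0 k (u - x) <= s.
  rewrite yu in Cy; move/cball_pt: Cy => h; apply: le_trans h _; apply: le_trans (rs _ _) _; last lra.
  by rewrite ler_nat ltnW.
have per' : iter n F y' = y' by rewrite /y' -iterD addnC iterD per.
have Uy' i : U0 (iter i F y') by rewrite /y' -iterD; exact: trap_stable (F_trap b2 b3) Uy.
(* This iterate lies [i * L] steps back along the cycle of [y']; for [i = n] it is [y'] again. *)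
have claim i : exists2 v, iter (i * (n * L - L)) F y' = pt v & (3 / 2) ^+ i * nNC w0 k (v - x) <= nNC w0 k (u - x).
  elim: i => [|i [v yv hv]]; first by exists u; [rewrite mul0n; exact: yu | rewrite expr0 mul1r].
  have e1 := etrans (iter_period_pull L i n0 per') yv.
  have nv : 0 <= nNC w0 k (v - x) by rewrite /nN le_max nc_ge0.
  have p1 : 1 <= (3 / 2 : R) ^+ i by rewrite exprn_ege1 //; lra.
  have [|v' yv' hv'] := pull _ v (Uy' _) e1.
    apply: le_trans hu; apply: le_trans hv; exact: ler_peMl.
  exists v'; first exact: yv'.
  rewrite exprSr -mulrA; apply: le_trans hv; apply: ler_wpM2l => //; by apply: le_trans p1.
have [v yv hv] := claim n.
have uv : u = v.
  apply: (@pt_inj R); apply: etrans (esym yu) _; apply: etrans _ yv; apply: esym.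
  by rewrite mulnC; exact: iter_period per'.
rewrite -uv in hv; have : 3 / 2 * nNC w0 k (u - x) <= nNC w0 k (u - x).
  apply: le_trans hv; apply: ler_wpM2r; first by rewrite /nN le_max nc_ge0.
  by rewrite -[X in X <= _]expr1; apply: ler_weXn2l => //; lra.
move=> h; have : nNC w0 k (u - x) <= 0 by move: h; move: (nNC w0 k (u - x)) => a; lra.
by move=> /(nN_bound_eq0 k1) /eqP; rewrite subr_eq0 => /eqP <-; exact: yu.
Qed.

(** A common point would match the passages near the fold, which occur once per turn of either
    cycle, and so force equal lengths. *)
Lemma source_period L x w0 k rho L' x' w0' k' rho' j :
  source b L x w0 k rho -> source b L' x' w0' k' rho' -> (0 < L < L')%N ->
  iter j (fC b) x' <> x.
Proof.
move=> [per _ near _ _] [per' _ near' _ _] /andP[L0 LL'] e.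
have L'0 : (0 < L')%N by exact: ltn_trans LL'.
have red i : iter i (fC b) x' = iter (i %% L') (fC b) x'.
  by rewrite {1}(divn_eq i L') addnC iterD iter_period.
have := near 0%N L0; rewrite eqxx /= -e red near' ?ltn_mod // => /eqP m0.
have e' : x = x' by rewrite -e red m0.
have := near' L LL'; rewrite -{1}e' per; have := near 0%N L0; rewrite eqxx /= => -> /esym/eqP h.
by rewrite h in L0.
Qed.

End QuasiAttractor.

(** * The decreasing sequence of traps and the infinitely many cycles *)

Section SourceSequence.
Variables (R : realType) (b : R).
Hypotheses (b2 : 2 <= b) (b3 : b <= 3).
Local Notation C := (Cx R).
Local Notation V := ('rV[C]_3).
Local Notation nc := (@Normc.normc R : C -> R).
Local Notation n2C := (n2 nc).

Local Notation F := (endo (fcoef b) : PP R -> PP R).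
Local Notation pt := (@pt R).
Local Notation U0 := (@U0 R).
Local Notation nNC := (nN nc).



Definition has_source (L : nat) (x : C * C) := exists w0 k rho, source b L x w0 k rho.
Hypothesis sources : forall N, exists2 L, (N <= L)%N & exists x w0 k rho, source b L x w0 k rho.

Lemma source_sequence : exists (L : nat -> nat) (x : nat -> C * C),
  [/\ forall n, (0 < L n)%N, forall m n, (m < n)%N -> (L m < L n)%N & forall n, has_source (L n) (x n)].
Proof.
have ch N : exists p : nat * (C * C), (N < p.1)%N /\ has_source p.1 p.2.
  by have [L NL [x h]] := sources N.+1; exists (L, x).
pose g N := projT1 (cid (ch N)); have gP N : (N < (g N).1)%N /\ has_source (g N).1 (g N).2.
  by rewrite /g; case: cid.
pose s := fix s n := g (if n is n'.+1 then (s n').1 else 0%N).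
exists (fun n => (s n).1), (fun n => (s n).2); split.
- by case=> [|n] /=; apply: leq_ltn_trans (gP _).1.
- move=> m; elim=> // n IH; rewrite ltnS leq_eqVlt => /predU1P[->|/IH h]; first exact: (gP _).1.
  exact: ltn_trans h (gP _).1.
- by case=> [|n]; exact: (gP _).2.
Qed.

Lemma source_U0 L x : (0 < L)%N -> has_source L x -> U0 (pt x).
Proof.
move=> L0 [w0 [k [rho [_ h _ _ _]]]]; apply/U0_pt; rewrite lt_max; apply/orP; left.
by have [_ h2] := h 0%N L0; apply: le_lt_trans h2 _; lra.
Qed.

Lemma source_periodic L x : has_source L x -> iter L F (pt x) = pt x.
Proof.
by move=> [w0 [k [rho [per _ _ _ _]]]]; have h := F_pt b L x; rewrite per in h; exact h.
Qed.

Lemma source_distinct L x L' x' j : (0 < L)%N -> (L < L')%N -> has_source L x -> has_source L' x' ->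
  iter j F (pt x') <> pt x.
Proof.
move=> L0 LL' [w0 [k [rho s1]]] [w0' [k' [rho' s2]]] e.
apply: (source_period s1 s2 (j := j)); first by rewrite L0.
by apply: (@pt_inj R); have h := F_pt b j x'; exact (etrans (esym h) e).
Qed.

Lemma quasi_attractor_not_attracting : exists Q : set (P2 R),
  quasi_attractor (endo (fcoef b)) Q /\ ~ attracting_set (endo (fcoef b)) Q.
Proof.
have [L [x [L0 Lm hs]]] := source_sequence.
have rm n : exists Rm : set (PP R), [/\ Rm (pt (x n)),
    forall U, trap F U -> U `<=` U0 -> trap F (U `\` Rm) &
    forall i (y : PP R), (0 < i)%N -> iter i F y = y -> U0 y -> Rm y -> exists j, iter j F y = pt (x n)].
  have [w0 [k [rho s1]]] := hs n; exact (source_removal b2 b3 (L0 n) s1).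
pose Rm n := projT1 (cid (rm n)).
have RmP n : [/\ Rm n (pt (x n)), forall U, trap F U -> U `<=` U0 -> trap F (U `\` Rm n) &
    forall i (y : PP R), (0 < i)%N -> iter i F y = y -> U0 y -> Rm n y -> exists j, iter j F y = pt (x n)].
  by rewrite /Rm; case: cid.
pose U := fix U n : set (PP R) := if n is n'.+1 then U n' `\` Rm n' else U0.
have UU0 n : U n `<=` U0.
  by elim: n => [|n IH] y //= [Uy _]; exact: IH.
have tU n : trap F (U n).
  elim: n => [|n IH]; first exact: F_trap.
  by have [_ h _] := RmP n; exact: h.
(* Later sources survive each removal: a periodic point caught at stage [m] lies on the cycle of
   [x m], and the lengths differ. *)
have Ux m n : (m <= n)%N -> U m (pt (x n)).
  elim: m => [|m IH] mn; first exact: source_U0 (L0 n) (hs n).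
  split; first exact: IH (ltnW mn).
  move=> rx; have [_ _ h] := RmP m.
  have [j] := h (L n) _ (L0 n) (source_periodic (hs n)) (source_U0 (L0 n) (hs n)) rx.
  exact: source_distinct (L0 m) (Lm m n mn) (hs m) (hs n).
exists (\bigcap_(n in [set: nat]) maxinv F (U n)); split.
  exists (fun n => maxinv F (U n)); split; last split => //.
    by move=> n; apply: trap_attracting => //; exact: F_continuous.
  by move=> n; apply: (@maxinv_subset (PP R) F (U n.+1) (U n)) => y [].
move=> [_ [W [oW [hW e]]]].
have tW : trap F W by split; [rewrite open_P2open | rewrite -P2closure_closure].
move: e; apply: (@quasi_not_maxinv (PP R) F (@PP_compact R) (@PP_hausdorff R) (@F_continuous R b) U
  (fun n => pt (x n)) L W tU) => //.
- by move=> n y [].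
- by move=> n; split; [exact: L0 | exact: source_periodic].
- by move=> n; exact: Ux.
- by move=> n [_]; apply; have [] := RmP n.
Qed.

Lemma infinitely_many_cycles (A : set (P2 R)) :
  (forall L x, (0 < L)%N -> has_source L x -> repelling_periodic (endo (fcoef b)) (pt x)) ->
  A = maxinv F U0 -> ~ finite_set (repelling_cycles_in (endo (fcoef b)) A).
Proof.
move=> rep -> fin; have [L [x [L0 Lm hs]]] := source_sequence.
pose g n : set (P2 R) := cycle_of (endo (fcoef b)) (pt (x n)).
have gi : injective g.
  have lt m n : (m < n)%N -> g m <> g n.
    move=> mn e; have : g n (pt (x m)) by rewrite -e; exists 0%N.
    by move=> [j _]; exact: source_distinct (L0 m) (Lm m n mn) (hs m) (hs n).
  move=> m n e; apply/eqP; rewrite eqn_leq; apply/andP; split; rewrite leqNgt; apply/negP => h.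
    exact (lt _ _ h (esym e)).
  exact (lt _ _ h e).
have sub : range g `<=` repelling_cycles_in (endo (fcoef b)) (maxinv F U0).
  move=> _ [n _ <-]; exists (pt (x n)); split; first exact: rep (L0 n) (hs n).
  split => // _ [j _ <-].
  have tU := F_trap b2 b3.
  apply: (periodic_maxinv tU (L0 n)); last exact: trap_stable tU (source_U0 (L0 n) (hs n)).
  have e := source_periodic (hs n).
  by rewrite -iterD addnC iterD e.
have fin_g : finite_set (range g) := sub_finite_set sub fin.
(* [xget] supplies a left inverse of [g], which would map the finite range of [g] onto all natural
   numbers. *)
apply: infinite_nat; apply: sub_finite_set (finite_image (fun S => xget 0%N [set n | g n = S]) fin_g).
move=> n _; exists (g n); first by exists n.
by apply: gi; exact: (@xgetPex _ 0%N [set m | g m = g n] (ex_intro _ n erefl)).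
Qed.

End SourceSequence.

(** * The iterates in an affine chart *)

Section Repelling.
Variables (R : realType) (b : R).
Hypotheses (b2 : 2 <= b) (b3 : b <= 3).
Local Notation C := (Cx R).
Local Notation V := ('rV[C]_3).
Local Notation nc := (@Normc.normc R : C -> R).
Local Notation n2C := (n2 nc).

Local Notation F := (endo (fcoef b) : PP R -> PP R).
Local Notation pt := (@pt R).
Local Notation U0 := (@U0 R).
Local Notation nNC := (nN nc).



Local Notation V2 := ('rV[C]_2).
Local Notation rc := (real_complex R : R -> C).

Definition row2 (y : C * C) : V2 := \row_(j < 2) (if j == 0 then y.1 else y.2).
Definition pair2 (u : V2) : C * C := (u 0 0, u 0 1).

Lemma pair2K : cancel row2 pair2.
Proof. by move=> [y1 y2]; rewrite /pair2 !mxE. Qed.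

Lemma ord2P (Q : 'I_2 -> Prop) : Q 0 -> Q 1 -> forall k, Q k.
Proof.
move=> q0 q1 [[|[|//]] i].
- by rewrite (_ : Ordinal i = 0) //; apply/val_inj.
- by rewrite (_ : Ordinal i = 1) //; apply/val_inj.
Qed.

Lemma row2K : cancel pair2 row2.
Proof. by move=> u; apply/rowP; apply: ord2P; rewrite !mxE. Qed.

Lemma unchart_pt3 u : unchart 2%:R u = pt3 (pair2 u).
Proof.
apply/rowP; apply: ord3P; rewrite !mxE.
- have -> : (0 : 'I_3) = lift 2%:R (0 : 'I_2) by apply/val_inj.
  by rewrite liftK.
- have -> : (1 : 'I_3) = lift 2%:R (1 : 'I_2) by apply/val_inj.
  by rewrite liftK.
- by rewrite unlift_none.
Qed.

Lemma chart_pt y : chart 2%:R (val (pt y)) = row2 y.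
Proof.
have [l l0 h] := P2of_val (pt3_neq0 y).
have {}h : val (pt y) = l *: pt3 y := h.
apply/rowP => j; rewrite /chart mxE h mxE [X in _ / X]mxE.
have -> : pt3 y 0 2%:R = 1 by rewrite mxE.
rewrite mulr1 mulrAC mulfV // mul1r [LHS]mxE [RHS]mxE.
by move: j; apply: ord2P.
Qed.

Lemma in_chart_iter n u : in_chart 2%:R (iter n (endo (fcoef b))) u = row2 (iter n (fC b) (pair2 u)).
Proof.
rewrite /in_chart unchart_pt3.
have h := F_pt b n (pair2 u); rewrite -chart_pt.
exact (congr1 (fun p : PP R => chart 2%:R (val p)) h).
Qed.

Definition hmap (u : V2) : V2 := row2 (fC b (pair2 u)).

Lemma hmap_differentiable u : differentiable hmap u.
Proof.
have dM (f g : V2 -> C) : differentiable f u -> differentiable g u -> differentiable (fun u => f u * g u) u.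
  exact: differentiableM.
have dD (f g : V2 -> C) : differentiable f u -> differentiable g u -> differentiable (fun u => f u + g u) u.
  exact: differentiableD.
have dN (f : V2 -> C) : differentiable f u -> differentiable (fun u => - f u) u.
  exact: differentiableN.
have dc (c : C) : differentiable (fun _ : V2 => c) u by exact: differentiable_cst.
have dX (f : V2 -> C) n : differentiable f u -> differentiable (fun u => f u ^+ n) u.
  move=> df; elim: n => [|n IH]; first exact: dc.
  have -> : (fun u => f u ^+ n.+1) = (fun u => f u * f u ^+ n) by apply/funext => v; rewrite exprS.
  exact: dM.
have d0 : differentiable (fun u : V2 => u 0 0) u by exact: differentiable_coord.
have d1 : differentiable (fun u : V2 => u 0 1) u by exact: differentiable_coord.
(* The components are written with sums, opposites and products only, to match the differentiation
   rules above. *)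
pose P : V2 -> C := fun u =>
  rc (kapf b)^-1 * (u 0 0 * (1 + - u 0 0) * ((u 0 0 + - 2) ^+ 2 + rc (tau b) * u 0 0) * 4^-1)
  + (rc b * u 0 1 + rc (kk R) * u 0 1 ^+ 4).
pose Q : V2 -> C := fun u => u 0 0 + rc (kk R) * u 0 0 ^+ 4.
have -> : hmap = (fun u : V2 => P u *: delta_mx 0 0 + Q u *: delta_mx 0 1).
  apply/funext => v; apply/rowP; apply: ord2P; rewrite !mxE /=.
    by rewrite mulr1 mulr0 addr0.
  by rewrite mulr0 mulr1 add0r.
have dP : differentiable P u.
  by repeat first [exact: dc | exact: d0 | exact: d1 | apply: (dD) | apply: (dM) | apply: (dN) | apply: (dX)].
have dQ : differentiable Q u.
  by repeat first [exact: dc | exact: d0 | apply: (dD) | apply: (dM) | apply: (dX)].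
apply: differentiableD; exact: differentiableZl.
Qed.

Lemma iter_hmap n u : iter n hmap u = row2 (iter n (fC b) (pair2 u)).
Proof. by elim: n => [|n IH]; rewrite ?row2K //= IH /hmap pair2K. Qed.

Lemma iter_hmap_differentiable n u : differentiable (iter n hmap) u.
Proof.
elim: n => [|n IH]; first exact: ex_diff.
exact: (differentiable_comp IH (hmap_differentiable _)).
Qed.

End Repelling.

(** * From expansion to the eigenvalues of the Jacobian matrix *)

Section Eigenvalues.
Variables (R : realType) (b : R).
Hypotheses (b2 : 2 <= b) (b3 : b <= 3).
Local Notation C := (Cx R).
Local Notation V := ('rV[C]_3).
Local Notation nc := (@Normc.normc R : C -> R).
Local Notation n2C := (n2 nc).

Local Notation F := (endo (fcoef b) : PP R -> PP R).
Local Notation pt := (@pt R).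
Local Notation U0 := (@U0 R).
Local Notation nNC := (nN nc).



Local Notation V2 := ('rV[C]_2).

Lemma nN_scale w0 k (l : C) (e : C * C) : nNC w0 k (l * e.1, l * e.2) = nc l * nNC w0 k e.
Proof.
rewrite /nN /shear (_ : (l * e.1, l * e.2).1 = l * e.1) // (_ : (l * e.1, l * e.2).2 = l * e.2) //.
rewrite (_ : l * e.2 - w0 * (l * e.1) = l * (e.2 - w0 * e.1)); last by ring.
by rewrite !(ncM l) mulrCA maxr_pMr // nc_ge0.
Qed.

Lemma near_coords (l : V2) (e : R) : 0 < e -> nbhs l [set y : V2 | forall j, nc (l 0 j - y 0 j) < e].
Proof.
move=> e0; have h (j : 'I_2) : nbhs l [set y : V2 | nc (l 0 j - y 0 j) < e].
  exact: (@coord_continuous C 1 2 0 j l _ (near_dist (l 0 j) e0)).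
apply: filterS (filterI (h 0) (h 1)) => y [h0 h1].
exact: (@ord2P (fun j => nc (l 0 j - y 0 j) < e)).
Qed.

(** The difference quotients [q h] in the direction of an eigenvector tend to [a *: v], while the
    expansion gives each of them at least 3/2 of the norm of [v]. The Jacobian matrix need not be
    computed. *)
Lemma expanding_eigenvalue (G : V2 -> V2) (p : V2) w0 k rho a : 1 <= k -> 0 < rho ->
  differentiable G p -> G p = p ->
  (forall y, n2C (pair2 y - pair2 p) <= rho ->
     3 / 2 * nNC w0 k (pair2 y - pair2 p) <= nNC w0 k (pair2 (G y) - pair2 p)) ->
  eigenvalue ('J G p) a -> 3 / 2 <= nc a.
Proof.
move=> k1 rho0 dG Gp hexp /eigenvalueP [v va v0].
have k0 : 0 <= k by move: k1; lra.
have nv : 0 < nNC w0 k (pair2 v).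
  rewrite ltNge; apply/negP => /(nN_bound_eq0 k1) h; move/eqP: v0; apply.
  by rewrite -(row2K v) h; apply/rowP; apply: ord2P; rewrite !mxE.
pose q (h : C) : V2 := h^-1 *: (G (h *: v + p) - G p).
have cq : q h @[h --> 0^'] --> a *: v.
  rewrite -va -(deriveEjacobian v dG); exact: (@diff_derivable _ _ _ G p v dG).
rewrite leNgt; apply/negP => a32.
pose A := 1 + k * (1 + nc w0); have A0 : 0 < A.
  have : 0 <= k * (1 + nc w0) by rewrite mulr_ge0 // addr_ge0 // nc_ge0.
  by rewrite /A; lra.
(* Chosen so that [A * eps] is half of the gap between [3 / 2] and [nc a], times the norm of [v]. *)
pose eps := (3 / 2 - nc a) * nNC w0 k (pair2 v) / (2 * A).
have eps0 : 0 < eps by rewrite divr_gt0 // mulr_gt0 // ?subr_gt0 //; lra.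
have n1 : \forall h \near 0^', forall j, nc ((a *: v) 0 j - (q h) 0 j) < eps.
  exact: cq _ (near_coords _ eps0).
have n2v : 0 < n2C (pair2 v) + 1 by rewrite ltr_wpDl // /n2 le_max nc_ge0.
have n2' : \forall h \near (0 : C)^', nc (0 - h) < rho / (n2C (pair2 v) + 1).
  by apply: (@cvg_within _ (nbhs (0 : C))); apply: near_dist; rewrite divr_gt0.
have n3 : \forall h \near (0 : C)^', h != 0 by exact: nbhs_dnbhs_neq.
have [h [[h1 h2] h0]] := filter_ex (filterI (filterI n1 n2') n3).
have hv : pair2 (h *: v + p) - pair2 p = (h * (pair2 v).1, h * (pair2 v).2).
  by rewrite /pair2 !mxE; congr (_, _) => /=; rewrite addrK.
have hq : pair2 (G (h *: v + p)) - pair2 p = (h * (pair2 (q h)).1, h * (pair2 (q h)).2).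
  by rewrite /pair2 /q Gp !mxE; congr (_, _) => /=; rewrite mulVKf.
have hh : 0 < nc h by rewrite nc_gt0.
have /hexp : n2C (pair2 (h *: v + p) - pair2 p) <= rho.
  have hs : nc h * (n2C (pair2 v) + 1) <= rho.
    by move: h2; rewrite sub0r ncN ltr_pdivlMr // => /ltW.
  rewrite hv n2_le /fst /snd !(ncM h); apply/andP; split; apply: le_trans hs; apply: ler_wpM2l (ltW hh) _ _ _.
    by have := nrm1_le nc (pair2 v); rewrite /fst; lra.
  by have := nrm2_le nc (pair2 v); rewrite /snd; lra.
rewrite hv hq !nN_scale mulrCA ler_pM2l // => key.
have d : nNC w0 k (pair2 (q h)) <= nc a * nNC w0 k (pair2 v) + A * eps.
  have e1 : pair2 (q h) = (a * (pair2 v).1, a * (pair2 v).2) + (pair2 (q h) - pair2 (a *: v)).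
    have <- : pair2 (a *: v) = (a * (pair2 v).1, a * (pair2 v).2) by rewrite /pair2 !mxE.
    by rewrite addrC subrK.
  rewrite e1; apply: le_trans (nND (@ncD R) _ _ _ k0) _; rewrite nN_scale lerD2l.
  apply: le_trans (nN_le_n2 (@ncD R) (@ncM R) (@nc_real R) w0 _ k0) _.
  apply: ler_wpM2l; first exact: ltW.
  rewrite n2_le; apply/andP; split; rewrite -ncN opprB; apply: ltW; exact: h1.
have e2 : A * eps = (3 / 2 - nc a) * nNC w0 k (pair2 v) / 2.
  rewrite /eps; have : A != 0 by rewrite lt0r_neq0.
  by move: (A) (nNC w0 k (pair2 v)) (nc a) => ? ? ? ?; field.
have : 0 < (3 / 2 - nc a) * nNC w0 k (pair2 v) by rewrite mulr_gt0 // subr_gt0.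
move: key d; rewrite e2; move: (nNC w0 k (pair2 (q h))) => Nq; move: (nNC w0 k (pair2 v)) (nc a) => x y.
rewrite mulrBl; lra.
Qed.

Lemma source_repelling L x : (0 < L)%N -> has_source b L x ->
  repelling_periodic (endo (fcoef b)) (pt x).
Proof.
move=> L0 hs; exists L; split => //; split; first exact (source_periodic hs).
exists 2%:R; split.
  have [l l0 h] := P2of_val (pt3_neq0 x); have {}h : val (pt x) = l *: pt3 x := h.
  by rewrite h mxE mulf_neq0 // mxE oner_neq0.
have -> : in_chart 2%:R (iter L (endo (fcoef b))) = iter L (hmap b).
  by apply/funext => u; rewrite in_chart_iter iter_hmap.
rewrite chart_pt; split; first exact: iter_hmap_differentiable.
move=> a ea; have [w0 [k [rho [per _ _ [k1 rho0] hexp]]]] := hs.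
have : 3 / 2 <= nc a.
  apply: expanding_eigenvalue k1 rho0 (iter_hmap_differentiable b L (row2 x)) _ _ ea.
    by rewrite iter_hmap pair2K per.
  by move=> y; rewrite iter_hmap !pair2K; exact: hexp.
move=> h; have : (1 : R) < nc a by lra.
by rewrite -ltcR.
Qed.

End Eigenvalues.

Theorem theorem1p5 (R : realType) :
  (exists (d : nat) (c : 'I_3 -> 'I_d.+1 -> 'I_d.+1 -> Cx R),
     (2 <= d)%N /\ P2nondeg c /\
     exists A : set (P2 R),
       proper_attracting_set (endo c) A /\
       ~ finite_set (repelling_cycles_in (endo c) A)) /\
  (exists (d : nat) (c : 'I_3 -> 'I_d.+1 -> 'I_d.+1 -> Cx R),
     (2 <= d)%N /\ P2nondeg c /\
     exists Q : set (P2 R),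
       quasi_attractor (endo c) Q /\ ~ attracting_set (endo c) Q).
Proof.
have [b [b2 [b3 src]]] := infinitely_many_sources R.
have nd := fcoef_nondeg b.
split; exists 4%N, (fcoef b); split => //; split; [exact nd | | exact nd |].
- exists (maxinv (endo (fcoef b) : PP R -> PP R) (@U0 R)); split; first split.
  + apply: (@trap_attracting R (endo (fcoef b))); [exact: F_continuous | exact: F_trap].
  + move=> e; apply: (@U0_proper R); apply/seteqP; split => [p _|p _]; first exact I.
    have : setT p by exact I.
    by rewrite -e => h; exact (@maxinv_sub (PP R) (endo (fcoef b)) (@U0 R) p h).
  + apply: (infinitely_many_cycles b2 b3 src _ erefl) => L x L0 hs.
    exact (source_repelling L0 hs).
- exact (quasi_attractor_not_attracting b2 b3 src).
Qed.
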